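(* Let $s>0$, $1\le p<\infty$, $L>0$, $\sigma>0$. There is a constant $C'>0$ depending on $s,p,L,\sigma$ such that, for all sufficiently large $n$, $$\left(\inf_{\hat T}\sup_{f\in\mathcal{B}_{p,\infty}^s(L)}\mathbb{E}_f\left(\hat T-\|f\|_1\right)^2\right)^{1/2}\ge C'(n\ln n)^{-\frac{s}{2s+1}},$$ where the infimum is over all real-valued measurable maps $\hat T$ of the observation $\{Y(t)\}_{t\in[0,1]}$ in the Gaussian white noise model $dY(t)=f(t)\,dt+\frac{\sigma}{\sqrt n}\,dB(t)$, $t\in[0,1]$.
   Context: $B$ is a standard Brownian motion on $[0,1]$, $\sigma$ is known, and $\mathbb{E}_f$ is expectation when the mean function is $f$. $\|f\|_q=(\int_0^1|f(x)|^q\,dx)^{1/q}$. Besov ball: for $f$ on $[0,1]$ and $m\in\mathbb{N}$, let $\Delta_u^m f(x)=\sum_{k=0}^m(-1)^{m-k}\binom mk f(x+(k-\frac m2)u)$, set to $0$ if $x+\frac m2u$ or $x-\frac m2u$ is not in $[0,1]$; $\omega^m(f,t)_p=\sup_{0<u\le t}\|\Delta_u^mf\|_p$; $\|f\|_{\mathcal{B}^s_{p,\infty}}=\|f\|_p+\sup_{t>0}t^{-s}\omega^m(f,t)_p$ with $m=\lfloor s\rfloor+1$; $\mathcal{B}^s_{p,\infty}(L)=\{f\in L_p[0,1]:\|f\|_{\mathcal{B}^s_{p,\infty}}\le L\}$. *)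

(* Defs.v *)
From HB Require Import structures.
From mathcomp Require Import all_boot all_order all_algebra.
From mathcomp Require Import all_classical all_reals all_analysis.

Set Implicit Arguments.
Unset Strict Implicit.
Unset Printing Implicit Defensive.
Import Order.TTheory GRing.Theory Num.Theory.
Import numFieldNormedType.Exports.
Local Open Scope classical_set_scope.
Local Open Scope ring_scope.

Section function_classes.
Context {R : realType}.
Implicit Types (f : R -> R) (m : nat) (s p q t u x L : R).

(* A function on [0,1] is a total f : R -> R; everything below depends only on
   its values on [0,1]. *)
Definition norm01 q f : \bar R :=
  'N[lebesgue_measure]_(q%:E)[EFin \o (f \_ `[0, 1])].

Definition diff_op m u f x : R :=
  if (0 <= x + m%:R / 2 * u <= 1) && (0 <= x - m%:R / 2 * u <= 1) then
    \sum_(k < m.+1)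
      (-1) ^+ (m - k) * 'C(m, k)%:R * f (x + (k%:R - m%:R / 2) * u)
  else 0.

Definition smoothness_modulus m f t p : \bar R :=
  ereal_sup [set norm01 p (diff_op m u f) | u in [set u | 0 < u <= t]].

(* truncn is the floor here, as it is only used for s > 0 *)
Definition besov_norm s p f : \bar R :=
  let m := (Num.truncn s).+1 in
  (norm01 p f +
   ereal_sup [set (t `^ (- s))%:E * smoothness_modulus m f t p
             | t in [set t | (0 < t)%R]])%E.

Definition besov_ball s p L : set (R -> R) :=
  [set f : R -> R | [/\ measurable_fun (`[0, 1] : set R) f,
               (norm01 p f < +oo)%E &
               (besov_norm s p f <= L%:E)%E]].

End function_classes.

(* Only the restriction of the process to the times in [0,1] matters. *)
Record brownian_motion01 {R : realType} {d : measure_display}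
    {T : measurableType d} (P : probability T R) (B : R -> T -> R) : Prop :=
  BrownianMotion01 {
    bm_measurable : forall t : R, 0 <= t <= 1 -> measurable_fun [set: T] (B t) ;
    bm_start : {ae P, forall w, B 0 w = 0} ;
    bm_continuous : {ae P, forall w, {within `[0, 1], continuous (B ^~ w)}} ;
    bm_gaussian_increments : forall (s t : R) (A : set R),
      0 <= s -> s < t -> t <= 1 -> measurable A ->
      P [set w | A (B t w - B s w)] = normal_prob 0 (Num.sqrt (t - s)) A ;
    bm_independent_increments :
      forall (k : nat) (t : nat -> R) (A : nat -> set R),
      (forall i, (i <= k)%N -> 0 <= t i <= 1) ->
      (forall i, (i < k)%N -> t i <= t i.+1) ->
      (forall i, (i < k)%N -> measurable (A i)) ->
      P (\bigcap_(i < k) [set w | A i (B (t i.+1) w - B (t i) w)]) =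
      (\prod_(i < k) P [set w | A i (B (t i.+1) w - B (t i) w)%R])%E }.

Definition path01 (R : realType) : Type := (`[0, 1]%classic : set R) -> R.

HB.instance Definition _ (R : realType) := Pointed.on (path01 R).

(* The product sigma-algebra on R^[0,1]; its trace on C[0,1] is the Borel
   sigma-algebra of the uniform norm. *)
Definition cylinders (R : realType) : set (set (path01 R)) :=
  \bigcup_t preimage_set_system [set: path01 R] (fun y : path01 R => y t)
              (measurable : set (set R)).

Notation observation_space R := (g_sigma_algebraType (@cylinders R)).

Section white_noise_model.
Context {R : realType} {d : measure_display} {T : measurableType d}.
Variables (P : probability T R) (B : R -> T -> R)
  (sigma : R) (n : nat).

Definition observation (f : R -> R) (w : T) : observation_space R :=
  fun t => \int[lebesgue_measure]_(x in `[0, val t]) f x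
           + sigma / Num.sqrt n%:R * B (val t) w.

Definition L1_risk (That : observation_space R -> R) (f : R -> R) : \bar R :=
  'E_P[fun w => (That (observation f w) - fine (norm01 1 f)) ^+ 2].

Definition minimax_L1_risk (F : set (R -> R)) : \bar R :=
  ereal_inf [set ereal_sup [set L1_risk That f | f in F]
            | That in [set That | measurable_fun [set: observation_space R] That]].

End white_noise_model.

(* Main.v *)
Require Import Defs.
From HB Require Import structures.
From mathcomp Require Import all_boot all_order all_algebra.
From mathcomp Require Import ring lra zify.
From mathcomp Require Import all_classical all_reals all_analysis.
From mathcomp Require Import measurable_realfun.
Import Order.TTheory GRing.Theory Num.Theory.
Import numFieldNormedType.Exports.
Local Open Scope classical_set_scope.
Local Open Scope ring_scope.

(** The absolute value has a kink at 0, where polynomials approximate it badly,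
    and what the noise leaves visible of a small random amplitude is its first
    moments. Cut [0, 1] into N cells and consider the functions with a bump of
    height beta K x_i in the cell i, where |x_i| <= 1. Their L1-norm is beta K times
    a weighted mean of the |x_i|. Draw the x_i independently from one of two laws
    mu1, mu0 that have equal moments up to the order K - 1 while their means of |x|
    differ by at least c / K ([moment_matched_pair]). The norm then concentrates
    around two values at a distance of order beta, so an estimator of small risk
    would tell the two priors apart.

    The observation cannot do so. Exchange the laws of the coordinates one at a time
    ([expect_telescope]). For one coordinate the other bumps are a known signal, and
    the difference of the two mixtures of Gaussian likelihoods has a squared L2-norm
    equal to the double sum of nu_i nu_j exp (x_i x_j z), where nu = mu1 - mu0 and
    z is at most (beta K)^2 n / (sigma^2 N), the squared signal-to-noise ratio of a
    cell ([white_noise_bound]). The terms of order below K of the exponential series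
    cancel, so the sum is smaller than exp (- 8 K), up to a constant, as soon as z is
    at most K exp (- 9) ([moment_matching_bound]).
    With K of order ln n, the N exchanges together cost less than 1 / 4.

    A height of beta K x_i is compatible with the Besov ball when
    beta = A N^(-s) and the p-mean of the K x_i is bounded ([comb_besov]); this is
    why mu1 and mu0 must also have p-th moments of order K^(-p). The condition on the
    signal-to-noise ratio becomes N^(2 s + 1) of order n ln n, and beta is then of
    order (n ln n)^(- s / (2 s + 1)). [two_priors_risk] puts these facts together.

    The two laws are explicit. Their nodes are the points sin (pi i / N') and their
    opposites, split between mu1 and mu0 according to the parity of i, with a power of
    a Dirichlet kernel as weights. The even moments of the difference are alternating
    sums of cosine polynomials of low degree, which vanish; the decay of the kernel
    bounds the p-th moments; and the gap in the mean of |x| survives because the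
    kernel has nonnegative Fourier coefficients ([alternating_sin_cospan]). *)

(** * Measures with a density *)

Section density.
Context {d : measure_display} {T : measurableType d} {R : realType}.
Variables (mu : {measure set T -> \bar R}) (g : T -> R).
Hypotheses (g0 : forall x, 0 <= g x) (mg : measurable_fun [set: T] g).

(** The two proofs are arguments so that a measure structure can be attached to
    the resulting set function. *)
Definition density_measure (_ : forall x, 0 <= g x)
    (_ : measurable_fun [set: T] g) (A : set T) : \bar R :=
  (\int[mu]_(x in A) (g x)%:E)%E.

Local Notation dg := (density_measure g0 mg).

Let mge : measurable_fun [set: T] (EFin \o g).
Proof. exact/measurable_EFinP. Qed.

Let dens0 : dg set0 = 0%E. Proof. by rewrite /density_measure integral_set0. Qed.

Let dens_ge0 A : (0 <= dg A)%E.
Proof. by apply: integral_ge0 => x _; rewrite lee_fin. Qed.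

Let dens_sigma_additive : semi_sigma_additive dg.
Proof.
move=> /= A mA tA mUA; rewrite /density_measure ge0_integral_bigcup//=.
- by apply: is_cvg_ereal_nneg_natsum_cond => n _ _; exact: dens_ge0.
- exact: measurable_funTS.
- by move=> x _; rewrite lee_fin.
Qed.

HB.instance Definition _ :=
  isMeasure.Build _ _ _ dg dens0 dens_ge0 dens_sigma_additive.

Import HBNNSimple.

Let integral_dens_nnsfun (h : {nnsfun T >-> R}) :
  (\int[dg]_x (h x)%:E = \int[mu]_x ((h x)%:E * (g x)%:E))%E.
Proof.
rewrite integralT_nnsfun sintegralE.
under [RHS]eq_integral => x _.
  rewrite (fimfunE h x) -fsumEFin// ge0_mule_fsuml; last first.
    by move=> y; exact: nnfun_muleindic_ge0.
  over.
rewrite ge0_integral_fsum//.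
- apply: eq_fsbigr => y; rewrite inE => -[t _ <-] /=.
  under [RHS]eq_integral do rewrite EFinM -muleA.
  rewrite ge0_integralZl//.
  + congr (_ * _)%E; rewrite /density_measure integral_mkcond.
    by apply: eq_integral => x _; rewrite muleC epatch_indic.
  + by apply: emeasurable_funM => //; exact/measurable_EFinP.
  + by move=> x _; rewrite mule_ge0 ?lee_fin.
  + by rewrite lee_fin.
- move=> y; apply: emeasurable_funM => //; apply/measurable_EFinP.
  exact: measurable_funM.
- by move=> y x _; rewrite mule_ge0 ?lee_fin// -lee_fin nnfun_muleindic_ge0.
Qed.

Lemma ge0_integral_density (f : T -> R) : (forall x, 0 <= f x) ->
  measurable_fun [set: T] f ->
  (\int[dg]_x (f x)%:E = \int[mu]_x (f x * g x)%:E)%E.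
Proof.
move=> f0 /measurable_EFinP mf.
pose h := nnsfun_approx measurableT mf.
have h_cvg x : (h n x)%:E @[n --> \oo] --> (f x)%:E.
  by apply: cvg_nnsfun_approx => // y _; rewrite lee_fin.
have h_nd x : {homo h ^~ x : a b / (a <= b)%N >-> a <= b}.
  by move=> a b ab; exact/lefP/(nd_nnsfun_approx measurableT mf).
have e1 x : (f x)%:E = lim ((h n x)%:E @[n --> \oo]).
  by apply/esym/cvg_lim => //; exact: h_cvg.
have e2 x : (f x * g x)%:E = lim (((h n x)%:E * (g x)%:E)%E @[n --> \oo]).
  by apply/esym/cvg_lim => //; rewrite EFinM; apply: cvgeZr => //; exact: h_cvg.
rewrite [LHS](eq_integral (fun x => lim ((h n x)%:E @[n --> \oo]))); last first.
  by move=> x _; exact: e1.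
rewrite [RHS](eq_integral
    (fun x => lim (((h n x)%:E * (g x)%:E)%E @[n --> \oo]))); last first.
  by move=> x _; exact: e2.
rewrite !monotone_convergence//.
- by apply/congr_lim/funext => n; exact: integral_dens_nnsfun.
- by move=> n; apply: emeasurable_funM => //; exact/measurable_EFinP.
- by move=> n x _; rewrite mule_ge0 ?lee_fin.
- by move=> x _ a b ab; rewrite lee_wpmul2r ?lee_fin//; exact: h_nd.
- by move=> n; exact/measurable_EFinP.
- by move=> n x _; rewrite lee_fin.
- by move=> x _ a b ab; rewrite lee_fin; exact: h_nd.
Qed.

End density.

(** * Expectations of products of independent variables *)

Section product_rule.
Context {d : measure_display} {T : measurableType d} {R : realType}.
Variables (P : probability T R) (k : nat) (X : nat -> T -> R).
Hypothesis mX : forall j, (j < k)%N -> measurable_fun [set: T] (X j).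
Hypothesis indep : forall A : nat -> set R,
  (forall j, (j < k)%N -> measurable (A j)) ->
  P (\bigcap_(j < k) [set w | A j (X j w)]) =
  (\prod_(j < k) P [set w | A j (X j w)])%E.

Let preimage_measurable j (A : set R) : (j < k)%N -> measurable A ->
  measurable [set w | A (X j w)].
Proof. by move=> jk mA; rewrite -[X in measurable X]setTI; exact: mX. Qed.

Let integral_prod_indic (phi : nat -> R -> R) (r : nat -> R) :
  (forall j, (j < k)%N -> exists2 A, measurable A & phi j = \1_A) ->
  (forall j, (j < k)%N -> \int[P]_w (phi j (X j w))%:E = (r j)%:E)%E ->
  (\int[P]_w (\prod_(j < k) phi j (X j w))%:E = (\prod_(j < k) r j)%:E)%E.
Proof.
move=> phiA rE.
have /choice[A HA] j : exists A : set R, (j < k)%N -> measurable A /\ phi j = \1_A.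
  have [jk|jk] := ltnP j k; last by exists set0.
  by have [A mA pA] := phiA _ jk; exists A.
have mA j : (j < k)%N -> measurable (A j) by move=> /HA[].
have phiE j : (j < k)%N -> phi j = \1_(A j) by move=> /HA[].
transitivity (\int[P]_w (\1_(\bigcap_(j < k) [set w | A j (X j w)]) w : R)%:E)%E.
  apply: eq_integral => w _; congr EFin; rewrite indicE.
  have [|] := boolP (w \in _).
    rewrite inE => Aw; rewrite big1// => j _; rewrite phiE// indicE mem_set//.
    exact: (Aw j (ltn_ord j)).
  move=> /negP Aw; apply/eqP; rewrite eq_sym.
  have [i Ai] : exists i : 'I_k, ~ A i (X i w).
    apply/not_existsP => H; apply: Aw; rewrite inE => j /= jk.
    by have /contrapT := H (Ordinal jk).
  by rewrite (bigD1 i)//= phiE// indicE memNset ?mul0r.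
rewrite integral_indic//=; last first.
  apply: bigcap_measurableType => j /= jk; apply: preimage_measurable => //.
  exact: mA.
rewrite setIT indep// -prodEFin; apply: eq_bigr => j _.
rewrite -rE// phiE//.
have mXA := preimage_measurable j _ (ltn_ord j) (mA _ (ltn_ord j)).
transitivity (\int[P]_w (\1_[set w | A j (X j w)] w)%:E)%E.
  by rewrite integral_indic// setIT.
by apply: eq_integral.
Qed.

(** Independence is given for events only. The indicators are replaced by
    nonnegative functions one factor at a time: when the other factors are
    fixed, both sides are measures in the event that carries factor l, and by
    induction they agree on events, hence on functions. *)
Lemma integral_prod (phi : nat -> R -> R) (r : nat -> R) :
  (forall j x, 0 <= phi j x) ->
  (forall j, measurable_fun [set: R] (phi j)) ->
  (forall j, (j < k)%N -> \int[P]_w (phi j (X j w))%:E = (r j)%:E)%E ->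
  (\int[P]_w (\prod_(j < k) phi j (X j w))%:E = (\prod_(j < k) r j)%:E)%E.
Proof.
(* l counts the factors already allowed to be arbitrary functions *)
suff H l : forall (phi : nat -> R -> R) (r : nat -> R),
  (forall j, (l <= j < k)%N -> exists2 A, measurable A & phi j = \1_A) ->
  (forall j x, 0 <= phi j x) ->
  (forall j, measurable_fun [set: R] (phi j)) ->
  (forall j, (j < k)%N -> \int[P]_w (phi j (X j w))%:E = (r j)%:E)%E ->
  (\int[P]_w (\prod_(j < k) phi j (X j w))%:E = (\prod_(j < k) r j)%:E)%E.
  by apply: (H k) => j /andP[kj /(leq_ltn_trans kj)]; rewrite ltnn.
elim: l => {phi r} [|l IH] phi r phiA phi0 mphi rE.
  by apply: integral_prod_indic => // j jk; apply: phiA.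
have [kl|lk] := leqP k l.
  apply: IH => // j /andP[lj jk]; move: (leq_trans jk (leq_trans kl lj)).
  by rewrite ltnn.
pose L := Ordinal lk.
pose W w := \prod_(j < k | j != L) phi j (X j w).
have W0 w : 0 <= W w by apply: prodr_ge0.
have mphiX j : (j < k)%N -> measurable_fun [set: T] (fun w => phi j (X j w)).
  by move=> jk; apply: measurableT_comp => //; exact: mX.
have mW : measurable_fun [set: T] W.
  rewrite /W; under eq_fun do rewrite big_mkcond/=.
  apply: measurable_prod => j _; case: (j != L); last exact: measurable_cst.
  exact: mphiX.
pose c := \prod_(j < k | j != L) r j.
have r0 j : (j < k)%N -> 0 <= r j.
  by move=> jk; rewrite -lee_fin -rE//; apply: integral_ge0 => w _; rewrite lee_fin.
have c0 : 0 <= c by apply: prodr_ge0 => j _; exact: r0.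
have mcc : measurable_fun [set: R] (cst c) by exact: measurable_cst.
have key A : measurable A ->
    (pushforward (density_measure P W W0 mW) (X l) A =
     density_measure (pushforward P (X l)) (cst c) (fun=> c0) mcc A)%E.
  move=> mA; have mXA := preimage_measurable l A lk mA.
  have PE : (fine (P [set w | A (X l w)]))%:E = P [set w | A (X l w)].
    by rewrite fineK//; exact: fin_num_measure.
  rewrite /pushforward /density_measure/= integral_cst//=.
  pose phi' j := if j == l then \1_A else phi j.
  pose r' j := if j == l then fine (P [set w | A (X l w)]) else r j.
  have /= := IH phi' r'.
  have -> : \prod_(j < k) r' j = fine (P [set w | A (X l w)]) * c.
    rewrite (bigD1 L)//= {1}/r' eqxx; congr (_ * _); apply: eq_bigr => j jL.
    by rewrite /r' ifN.
  rewrite EFinM PE muleC => <-.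
  - rewrite integral_mkcond; apply: eq_integral => w _; rewrite patchE.
    rewrite (bigD1 L)//= {1}/phi' eqxx indicE.
    have -> : \prod_(i < k | i != L) phi' i (X i w) = W w.
      by apply: eq_bigr => j jL; rewrite /phi' ifN.
    rewrite -[w \in _]/(X l w \in A).
    have <- : (w \in X l @^-1` A) = (X l w \in A) by apply/idP/idP; rewrite !inE.
    by case: ifP; rewrite ?mul1r ?mul0r.
  - move=> j /andP[lj jk]; rewrite /phi'; case: eqP => [_|/eqP jl]; first by exists A.
    by apply: phiA; rewrite jk andbT ltn_neqAle eq_sym jl.
  - by move=> j x; rewrite /phi'; case: eqP.
  - by move=> j; rewrite /phi'; case: eqP.
  - move=> j jk; rewrite /phi' /r'; case: eqP => [->|_]; last exact: rE.
    rewrite PE.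
    transitivity (\int[P]_w (\1_[set w | A (X l w)] w)%:E)%E.
      by apply: eq_integral.
    by rewrite integral_indic// setIT.
have mXl := mX _ lk.
transitivity (\int[P]_w (phi l (X l w) * W w)%:E)%E.
  by apply: eq_integral => w _; rewrite (bigD1 L).
rewrite -(ge0_integral_density P W W0 mW (fun w => phi l (X l w)))//; last exact: mphiX.
have e1 := @ge0_integral_pushforward _ _ _ _ R _ mXl (density_measure P W W0 mW)
  setT (EFin \o phi l) measurableT.
rewrite preimage_setT in e1; rewrite -e1; [|exact/measurable_EFinP|]; last first.
  by move=> y _; rewrite lee_fin.
have mphi_l : measurable_fun [set: R] (EFin \o phi l) by exact/measurable_EFinP.
rewrite (eq_measure_integral
  (density_measure (pushforward P (X l)) (cst c) (fun=> c0) mcc)); last first.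
  by move=> A mA _; exact: key.
rewrite (ge0_integral_density (pushforward P (X l)) (cst c) (fun=> c0) mcc (phi l))//.
have e2 := @ge0_integral_pushforward _ _ _ _ R _ mXl P
  setT (fun y => (phi l y * c)%:E) measurableT.
rewrite preimage_setT in e2; rewrite e2; last 2 first.
- by apply/measurable_EFinP; exact: measurable_funM.
- by move=> y _; rewrite lee_fin mulr_ge0.
rewrite (eq_integral (fun w => c%:E * (phi l (X l w))%:E)%E); last first.
  by move=> w _; rewrite /= mulrC EFinM.
rewrite ge0_integralZl//; last 2 first.
- by apply/measurable_EFinP; exact: mphiX.
- by move=> w _; rewrite lee_fin.
by rewrite rE// (bigD1 L)//= -EFinM mulrC.
Qed.
End product_rule.

(** * Gaussian likelihood ratios *)

Section normal_tilt.
Context {R : realType}.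
Local Notation mu := (@lebesgue_measure R).

(** The density of N(c, s^2) with respect to N(0, s^2). *)
Definition tilt (s c x : R) : R := expR (c * x / s ^+ 2 - c ^+ 2 / (s ^+ 2 *+ 2)).

Lemma tilt_ge0 s c x : 0 <= tilt s c x. Proof. exact: expR_ge0. Qed.

Lemma measurable_tilt s c : measurable_fun [set: R] (tilt s c).
Proof.
apply: measurableT_comp => //; apply: measurable_funB => //.
by apply: measurable_funM => //; exact: measurable_funM.
Qed.

(** This identity is what produces the exponential kernel of the second moments
    in [integral_likelihoodM]. *)
Lemma tiltM s c c' x : s != 0 ->
  tilt s c x * tilt s c' x = expR (c * c' / s ^+ 2) * tilt s (c + c') x.
Proof. by move=> s0; rewrite /tilt -!expRD; congr expR; field. Qed.

Lemma normal_pdf_tilt s c x : s != 0 ->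
  normal_pdf 0 s x * tilt s c x = normal_pdf c s x.
Proof.
move=> s0; rewrite !normal_pdfE// -mulrA /normal_fun /tilt -expRD.
by congr (_ * expR _); field.
Qed.

Lemma integral_normal_prob m s (phi : R -> R) : (forall x, 0 <= phi x) ->
  measurable_fun [set: R] phi ->
  (\int[normal_prob m s]_x (phi x)%:E = \int[mu]_x (phi x * normal_pdf m s x)%:E)%E.
Proof.
move=> phi0 mphi.
have <- := @ge0_integral_density _ (measurableTypeR R) R mu (normal_pdf m s)
  (@normal_pdf_ge0 R m s) (@measurable_normal_pdf R m s) phi phi0 mphi.
exact: eq_measure_integral.
Qed.

Lemma integral_normal_tilt s c (phi : R -> R) : s != 0 -> (forall x, 0 <= phi x) ->
  measurable_fun [set: R] phi ->
  (\int[normal_prob 0 s]_x (phi x * tilt s c x)%:E = \int[normal_prob c s]_x (phi x)%:E)%E.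
Proof.
move=> s0 phi0 mphi; rewrite !integral_normal_prob//.
- by apply: eq_integral => x _; rewrite -(normal_pdf_tilt s c x s0) mulrAC mulrA.
- by move=> x; rewrite mulr_ge0// tilt_ge0.
- by apply: measurable_funM => //; exact: measurable_tilt.
Qed.

Lemma lebesgue_measureD (c : R) (A : set R) : measurable A ->
  pushforward mu (fun x : measurableTypeR R => x + c : measurableTypeR R) A = mu A.
Proof.
move=> mA; apply/esym/lebesgue_measure_unique => //=.
  by apply: measurable_funD.
move=> _ _ [[a b]] _ <-; rewrite /pushforward/=.
rewrite (_ : _ @^-1` _ = `](a - c), (b - c)]%classic); last first.
  by apply/seteqP; split=> x /=; rewrite !in_itv/= ltrBlDr lerBrDr.
rewrite !lebesgue_measure_itv/= !lte_fin ltrD2r.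
by case: ifP => // _; rewrite -!EFinB; congr EFin; ring.
Qed.

Lemma normal_prob_shift s c (A : set R) : s != 0 -> measurable A ->
  normal_prob 0 s [set x | A (x + c)] = normal_prob c s A.
Proof.
move=> s0 mA; rewrite /normal_prob.
pose D : measurableTypeR R -> measurableTypeR R := fun x => x + c.
have mD : measurable_fun [set: measurableTypeR R] D by apply: measurable_funD.
rewrite [RHS](eq_measure_integral (pushforward mu D)); last first.
  by move=> B mB _; exact/esym/lebesgue_measureD.
rewrite ge0_integral_pushforward//.
- apply: eq_integral => x _ /=; congr EFin.
  by rewrite !normal_pdfE// /normal_fun /D addrK subr0.
- by apply/measurable_EFinP/measurable_funTS; exact: measurable_normal_pdf.
- by move=> x _; rewrite lee_fin normal_pdf_ge0.
Qed.

End normal_tilt.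

Section second_moment.
Context {d : measure_display} {T : measurableType d} {R : realType}.
Variables (P : probability T R) (I : finType) (g : I -> T -> R) (nu : I -> R) (m : I -> I -> R).
Hypothesis g0 : forall i w, 0 <= g i w.
Hypothesis mg : forall i, measurable_fun [set: T] (g i).
Hypothesis g1 : forall i, (\int[P]_w (g i w)%:E = 1)%E.
Hypothesis g2 : forall i j, (\int[P]_w (g i w * g j w)%:E = (m i j)%:E)%E.

Let D w := \sum_i nu i * g i w.

(** Cauchy-Schwarz: what a signed mixture of the densities g i gives to an event
    is at most the L2-norm of the mixture, and the square of that norm is a
    quadratic form in the weights. *)
Lemma second_moment_bound (S : set T) : measurable S ->
  `|\sum_i nu i * fine (\int[P]_(w in S) (g i w)%:E)| <=
  Num.sqrt (\sum_i \sum_j nu i * nu j * m i j).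
Proof.
move=> mS; set x := (X in `|X|); set Q := (X in Num.sqrt X).
have ig i : P.-integrable [set: T] (EFin \o g i).
  apply/integrableP; split; first exact/measurable_EFinP.
  by under eq_integral do rewrite /= ger0_norm//; rewrite g1 ltry.
have igS i : P.-integrable S (EFin \o g i) by apply: integrableS (ig i).
have igg i j : P.-integrable [set: T] (fun w => (g i w * g j w)%:E).
  apply/integrableP; split; first by apply/measurable_EFinP; exact: measurable_funM.
  by under eq_integral do rewrite /= ger0_norm ?mulr_ge0//; rewrite g2 ltry.
have D2E w : (D w ^+ 2)%:E =
    (\sum_i \sum_j (nu i * nu j)%:E * (g i w * g j w)%:E)%E.
  rewrite expr2 mulr_suml -sumEFin; apply: eq_bigr => i _.
  rewrite mulr_sumr -sumEFin; apply: eq_bigr => j _.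
  by rewrite -EFinM mulrACA.
have iD : P.-integrable S (fun w => (D w)%:E).
  rewrite (_ : (fun w => _) = (fun w => \sum_i (nu i)%:E * (g i w)%:E)%E).
    by apply: integrable_sum => // i _; apply: integrableZl => //; exact: igS.
  by apply/funext => w; rewrite -sumEFin.
have iD2 : P.-integrable [set: T] (fun w => (D w ^+ 2)%:E).
  under eq_fun do rewrite D2E.
  by do 2 apply: integrable_sum => // ? _; apply: integrableZl => //; exact: igg.
have xE : (\int[P]_(w in S) (D w)%:E = x%:E)%E.
  transitivity (\int[P]_(w in S) (\sum_i (nu i)%:E * (g i w)%:E))%E.
    by apply: eq_integral => w _; rewrite -sumEFin.
  rewrite integral_sum//; last first.
    by move=> i; apply: integrableZl => //; exact: igS.
  rewrite -sumEFin; apply: eq_bigr => i _.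
  rewrite integralZl//; last exact: igS.
  by rewrite EFinM fineK//; apply: integrable_fin_num => //; exact: igS.
have QE : (\int[P]_w (D w ^+ 2)%:E = Q%:E)%E.
  under eq_integral do rewrite D2E.
  rewrite integral_sum//; last first.
    by move=> i; apply: integrable_sum => // ? _; apply: integrableZl.
  rewrite -sumEFin; apply: eq_bigr => i _.
  rewrite integral_sum//; last first.
    by move=> j; apply: integrableZl => //; exact: igg.
  rewrite -sumEFin; apply: eq_bigr => j _.
  by rewrite integralZl ?g2//; exact: igg.
suff x2Q : x ^+ 2 <= Q.
  by rewrite -sqrtr_sqr ler_sqrt// (le_trans _ x2Q)// sqr_ge0.
have iD2S : P.-integrable S (fun w => (D w ^+ 2)%:E) by apply: integrableS iD2.
have q_le : (\int[P]_(w in S) (D w ^+ 2)%:E <= Q%:E)%E.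
  rewrite -QE; apply: ge0_subset_integral => //.
  - by case/integrableP : iD2.
  - by move=> w _; rewrite lee_fin sqr_ge0.
(* expand the integral over S of (D - x)^2, using that P S is at most 1 *)
have : (0 <= \int[P]_(w in S) ((D w ^+ 2)%:E + ((- (2 * x))%:E * (D w)%:E + (x ^+ 2)%:E)))%E.
  apply: integral_ge0 => w _; rewrite -EFinM -!EFinD lee_fin.
  by rewrite [leRHS](_ : _ = (D w - x) ^+ 2) ?sqr_ge0//; ring.
have icst (c : R) : P.-integrable S (fun=> c%:E).
  by apply: finite_measure_integrable_cst.
rewrite integralD//; last by apply: integrableD => //; exact: integrableZl.
rewrite integralD//; last exact: integrableZl.
rewrite integralZl// xE integral_cst// => /le_trans; move=> /(_ (Q%:E +
  ((- (2 * x))%:E * x%:E + (x ^+ 2)%:E))%E).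
rewrite -EFinM -!EFinD lee_fin => H.
suff: 0 <= Q + (- (2 * x) * x + x ^+ 2).
  by rewrite [X in _ <= X](_ : _ = Q - x ^+ 2) ?subr_ge0//; ring.
apply: H; rewrite !EFinD; apply: leeD => //; apply: leeD => //.
rewrite -[leRHS]mule1; apply: lee_wpmul2l; first by rewrite lee_fin sqr_ge0.
exact: probability_le1.
Qed.

End second_moment.

(** Sequences stand for k-tuples: these boxes generate the product sigma-algebra
    of R^k pulled back to sequences. *)
Definition rectangles {R : realType} (k : nat) : set (set (nat -> R)) :=
  [set B | exists2 A : nat -> set R, (forall j, measurable (A j)) &
           B = [set x | forall j, (j < k)%N -> A j (x j)]].

Section gaussian_shift.
Context {d : measure_display} {T : measurableType d} {R : realType}.
Variables (P : probability T R) (k : nat) (X : nat -> T -> R) (s : nat -> R).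
Hypothesis mX : forall j, (j < k)%N -> measurable_fun [set: T] (X j).
Hypothesis indep : forall A : nat -> set R,
  (forall j, (j < k)%N -> measurable (A j)) ->
  P (\bigcap_(j < k) [set w | A j (X j w)]) =
  (\prod_(j < k) P [set w | A j (X j w)])%E.
Hypothesis s0 : forall j, (j < k)%N -> s j != 0.
Hypothesis lawX : forall j (A : set R), (j < k)%N -> measurable A ->
  P [set w | A (X j w)] = normal_prob 0 (s j) A.

Lemma integral_law j (phi : R -> R) : (j < k)%N -> (forall x, 0 <= phi x) ->
  measurable_fun [set: R] phi ->
  (\int[P]_w (phi (X j w))%:E = \int[normal_prob 0 (s j)]_x (phi x)%:E)%E.
Proof.
move=> jk phi0 mphi.
have e := @ge0_integral_pushforward _ _ _ (measurableTypeR R) R (X j) (mX _ jk) P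
  setT (EFin \o phi) measurableT.
rewrite preimage_setT in e; rewrite -e; last 2 first.
- exact/measurable_EFinP.
- by move=> y _; rewrite lee_fin.
apply: eq_measure_integral => [|mXj A mA _]; first exact: mX.
exact: (lawX j A jk mA).
Qed.

Variable c : nat -> R.

Definition likelihood (a : R) (w : T) : R := \prod_(j < k) tilt (s j) (a * c j) (X j w).

Definition shifted (a : R) (w : T) : nat -> R := fun j => X j w + a * c j.

Let mtX a j : (j < k)%N -> measurable_fun [set: T] (fun w => tilt (s j) (a * c j) (X j w)).
Proof. by move=> jk; apply: measurableT_comp (mX _ jk); exact: measurable_tilt. Qed.

Lemma measurable_likelihood a : measurable_fun [set: T] (likelihood a).
Proof. by apply: measurable_prod => j _; exact: mtX. Qed.

Lemma likelihood_ge0 a w : 0 <= likelihood a w.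
Proof. by apply: prodr_ge0 => j _; exact: tilt_ge0. Qed.

Lemma integral_likelihood a (A : nat -> set R) : (forall j, measurable (A j)) ->
  (\int[P]_w (\prod_(j < k) (\1_(A j) (X j w) * tilt (s j) (a * c j) (X j w)))%:E =
   \prod_(j < k) normal_prob (a * c j) (s j) (A j))%E.
Proof.
move=> mA.
have fm j : normal_prob (a * c j) (s j) (A j) \is a fin_num.
  by apply: (fin_num_measure (normal_prob (a * c j) (s j))); exact: mA.
rewrite (integral_prod P k X mX indep
  (fun j x => \1_(A j) x * tilt (s j) (a * c j) x)
  (fun j => fine (normal_prob (a * c j) (s j) (A j)))).
- by rewrite -prodEFin; apply: eq_bigr => j _; rewrite fineK.
- by move=> j x; rewrite mulr_ge0 ?tilt_ge0.
- by move=> j; apply: measurable_funM => //; exact: measurable_tilt.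
move=> j jk; rewrite fineK// (integral_law j (fun x => \1_(A j) x * tilt (s j) (a * c j) x))//.
- rewrite (integral_normal_tilt _ _ (\1_(A j)))//; last exact: s0.
  have mAj : @measurable _ (measurableTypeR R) (A j) := mA j.
  by rewrite (integral_indic (normal_prob (a * c j) (s j)) measurableT mAj) setIT.
- by move=> x; rewrite mulr_ge0 ?tilt_ge0.
- by apply: measurable_funM => //; exact: measurable_tilt.
Qed.

Lemma integral_likelihood1 a : (\int[P]_w (likelihood a w)%:E = 1)%E.
Proof.
have := integral_likelihood a (fun=> setT) (fun=> measurableT).
rewrite big1 => [<-|j _]; last exact: probability_setT.
apply: eq_integral => w _; congr EFin; apply: eq_bigr => j _.
by rewrite indicT mul1r.
Qed.

Lemma integral_likelihoodM a b : (\int[P]_w (likelihood a w * likelihood b w)%:E =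
  (expR (a * b * \sum_(j < k) c j ^+ 2 / s j ^+ 2))%:E)%E.
Proof.
transitivity (\int[P]_w ((expR (a * b * \sum_(j < k) c j ^+ 2 / s j ^+ 2))%:E *
   (likelihood (a + b) w)%:E))%E.
  apply: eq_integral => w _; rewrite -EFinM; congr EFin.
  rewrite mulr_sumr expR_sum -!big_split/=; apply: eq_bigr => j _.
  rewrite tiltM ?s0// mulrDl; congr (expR _ * _).
  by rewrite -!mulrA; congr (_ * _); rewrite mulrCA expr2 !mulrA.
rewrite ge0_integralZl//.
- by rewrite integral_likelihood1 mule1.
- exact/measurable_EFinP/measurable_likelihood.
- by move=> w _; rewrite lee_fin likelihood_ge0.
Qed.

Local Notation seqspace := (g_sigma_algebraType (@rectangles R k)).

Lemma measurable_shifted a : measurable_fun [set: T] (shifted a : T -> seqspace).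
Proof.
apply: (measurability (@rectangles R k : set (set (seqspace)))) => //.
move=> _ [_ [A mA ->] <-]; rewrite setTI.
rewrite (_ : _ @^-1` _ = \bigcap_(j in `I_k) [set w | A j (X j w + a * c j)])//.
apply: bigcap_measurableType => j /= jk.
have mj : measurable_fun [set: T] (fun w => X j w + a * c j).
  by apply: measurable_funD => //; exact: mX.
by rewrite -[X in measurable X]setTI; exact: mj.
Qed.

(** The finite-dimensional Cameron-Martin formula. Both sides are finite measures
    in C, and on boxes both are products of one-dimensional Gaussian
    probabilities. *)
Lemma shifted_density a (C : set seqspace) : measurable C ->
  P [set w | C (shifted a w)] =
  (\int[P]_(w in [set w | C (shifted 0 w)]) (likelihood a w)%:E)%E.
Proof.
move=> mC.
pose Pa := density_measure P (likelihood a) (likelihood_ge0 a) (measurable_likelihood a).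
pose V b : T -> seqspace := shifted b.
have mV b : measurable_fun [set: T] (V b) := measurable_shifted b.
have setIr : setI_closed (@rectangles R k).
  move=> _ _ [A mA ->] [B mB ->]; exists (fun j => A j `&` B j).
    by move=> j; exact: measurableI.
  apply/seteqP; split => [x [Ax Bx] j jk|x AB]; first by split; [exact: Ax|exact: Bx].
  by split => j jk; have [] := AB _ jk.
have rT : @rectangles R k setT.
  by exists (fun=> setT) => //; apply/seteqP; split.
have eqm B : @rectangles R k B -> pushforward P (V a) B = pushforward Pa (V 0) B.
  move=> [A mA ->]; rewrite /pushforward /Pa /density_measure.
  have mXa j : (j < k)%N -> measurable [set w | A j (X j w + a * c j)].
    move=> jk; have mXj := mX j jk.
    have mj : measurable_fun [set: T] (fun w => X j w + a * c j).
      by apply: measurable_funD.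
    by rewrite -[X in measurable X]setTI; exact: mj.
  have mA' j : measurable [set x | A j (x + a * c j)].
    have mDj : measurable_fun [set: R] (fun x : R => x + a * c j).
      exact: measurable_funD.
    by rewrite -[X in measurable X]setTI; exact: mDj.
  have PE := indep (fun j => [set x | A j (x + a * c j)]) (fun j _ => mA' j).
  transitivity (\prod_(j < k) normal_prob (a * c j) (s j) (A j))%E.
    rewrite [LHS]PE; apply: eq_bigr => j _; rewrite lawX//.
    by rewrite (normal_prob_shift (s j) (a * c j))//; exact: s0.
  rewrite -integral_likelihood// [RHS]integral_mkcond; apply: eq_integral => w _.
  rewrite patchE big_split/=; case: ifPn => [|/negP] Vw.
    rewrite big1 ?mul1r// => j _; rewrite indicE mem_set//.
    by move: Vw; rewrite inE => /(_ j (ltn_ord j)); rewrite /V /shifted mul0r addr0.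
  have [i Ai] : exists i : 'I_k, ~ A i (X i w).
    apply/not_existsP => H; apply: Vw; rewrite inE => j jk.
    by rewrite /V /shifted mul0r addr0; have /contrapT := H (Ordinal jk).
  by rewrite (bigD1 i)//= indicE memNset// !mul0r.
apply: (@measure_unique _ R seqspace (@rectangles R k) (fun=> setT) erefl setIr
  (fun=> rT) _ (pushforward P (V a)) (pushforward Pa (V 0)) eqm _ C mC) => //.
- exact: bigcup_const.
- move=> _; change (P [set: T] < +oo)%E; rewrite probability_setT.
  exact: ltry.
Qed.

(** Applied with nu the difference of two laws on the amplitudes a, this bounds
    how well an event can tell the two laws apart. Only the energy of the shift,
    relative to the noise, enters the right-hand side. *)
Lemma shifted_mixture_bound (I : finType) (a nu : I -> R) (C : set seqspace) :
  measurable C ->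
  `|\sum_i nu i * fine (P [set w | C (shifted (a i) w)])| <=
  Num.sqrt (\sum_i \sum_j nu i * nu j *
     expR (a i * a j * \sum_(l < k) c l ^+ 2 / s l ^+ 2)).
Proof.
move=> mC; under eq_bigr do rewrite shifted_density//.
apply: (second_moment_bound P I (fun i => likelihood (a i))).
- by move=> i w; exact: likelihood_ge0.
- by move=> i; exact: measurable_likelihood.
- by move=> i; exact: integral_likelihood1.
- by move=> i j; exact: integral_likelihoodM.
by rewrite -[X in measurable X]setTI; exact: measurable_shifted.
Qed.

End gaussian_shift.

(** * Paths observed at finitely many times *)

Local Notation time R := ((`[0, 1]%classic : set R) : Type).

Section finitely_many_times.
Context {R : realType}.

Definition times_sigma (s : seq (time R)) : set (set (path01 R)) :=
  <<s \bigcup_(t in [set` s]) preimage_set_system [set: path01 R]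
        (fun y : path01 R => y t) (measurable : set (set R)) >>.

Lemma times_sigmaS (s s' : seq (time R)) : {subset s <= s'} ->
  times_sigma s `<=` times_sigma s'.
Proof.
move=> ss'; apply: smallest_sub; first exact: smallest_sigma_algebra.
move=> A [t ts tA]; apply: sub_sigma_algebra; exists t => //=; exact: ss'.
Qed.

Lemma times_sigma_agree (s : seq (time R)) (A : set (path01 R)) (y y' : path01 R) :
  times_sigma s A -> (forall t, t \in s -> y t = y' t) -> A y <-> A y'.
Proof.
move=> sA yy'; move: A sA; apply: smallest_sub.
  split => //.
  - by move=> A AE; split=> -[_ H]; split => // Ay; apply: H; apply/AE.
  - by move=> A AE; split => -[n _ Ay]; exists n => //; apply/AE.
move=> _ [t ts [D mD <-]]; split=> -[_ Dy]; split => //=; move: Dy => /=.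
  by rewrite yy'.
by rewrite -yy'.
Qed.

Lemma times_sigma_measurable (s : seq (time R)) (A : set (path01 R)) :
  times_sigma s A -> measurable (A : set (observation_space R)).
Proof.
move: A; apply: smallest_sub; first exact: smallest_sigma_algebra.
by move=> A [t _ tA]; apply: sub_sigma_algebra; exists t.
Qed.

End finitely_many_times.

Section grid.
Context {R : realType}.
Variable s : seq (time R).

(** Time 0 is added so that a path at any time of s is its value at 0 plus a sum
    of increments over the grid. *)
Definition grid : seq R := sort <=%O (undup (0 :: map val s)).

Lemma grid_sorted : sorted <%O grid.
Proof. by rewrite sort_lt_sorted undup_uniq. Qed.

Lemma mem_grid x : (x \in grid) = (x == 0) || (x \in map val s).
Proof. by rewrite mem_sort mem_undup inE. Qed.

Lemma grid_bounds x : x \in grid -> 0 <= x <= 1.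
Proof.
rewrite mem_grid => /orP[/eqP ->|/mapP[t _ ->]]; first by rewrite lexx ler01.
by have := set_valP t; rewrite /= in_itv/=.
Qed.

Lemma size_grid : size grid = (size grid).-1.+1.
Proof.
by rewrite prednK// lt0n size_eq0; apply/eqP => g0; have := mem_grid 0; rewrite g0 eqxx.
Qed.

Local Notation k := (size grid).-1.
Local Notation u := (nth 0 grid).

Lemma nth_grid_bounds i : (i <= k)%N -> 0 <= u i <= 1.
Proof. by move=> ik; apply/grid_bounds/mem_nth; rewrite size_grid ltnS. Qed.

Lemma nth_grid_lt i : (i < k)%N -> u i < u i.+1.
Proof.
move=> ik; apply: (sorted_ltn_nth lt_trans) => //; rewrite ?inE.
- exact: grid_sorted.
- by rewrite size_grid ltnS ltnW.
- by rewrite size_grid ltnS.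
Qed.

Lemma nth_grid0 : u 0 = 0.
Proof.
apply/eqP; rewrite eq_le; have /andP[-> _] := nth_grid_bounds 0 (leq0n _).
have := mem_grid 0; rewrite eqxx/= => g0; rewrite andbT.
rewrite -[leRHS](nth_index 0 g0); apply: (sorted_leq_nth le_trans le_refl).
- by apply: (sub_sorted (@ltW _ R)); exact: grid_sorted.
- by rewrite inE size_grid.
- by rewrite inE index_mem.
- by [].
Qed.

End grid.

(** * Signals of random amplitude in white noise *)

(** Brownian motion starts at 0 only almost surely; through this lemma an identity
    that needs the starting value can be used inside a probability. *)
Lemma eq_measure_negligible {d : measure_display} {T : measurableType d} {R : realType}
    (P : {measure set T -> \bar R}) (Q : T -> Prop) (E E' : set T) :
  measurable E -> measurable E' -> {ae P, forall w, Q w} ->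
  (forall w, Q w -> E w <-> E' w) -> P E = P E'.
Proof.
move=> mE mE' [N [mN N0 QN]] EE'.
have NQ w : ~ N w -> Q w by move=> Nw; apply: contrapT => /QN.
have cut F : measurable F -> P F = P (F `\` N).
  move=> mF; rewrite (measureDI P mF mN) [X in (_ + X)%E](_ : _ = 0%E) ?adde0//.
  by apply/eqP; rewrite -measure_le0 -N0 le_measure ?inE//; exact: measurableI.
rewrite cut// [RHS]cut//; congr (P _); apply/seteqP.
by split => w [Ew Nw]; split => //; apply/(EE' _ (NQ _ Nw)).
Qed.

Section white_noise_shift.
Context {d : measure_display} {T : measurableType d} {R : realType}.
Variables (P : probability T R) (B : R -> T -> R).
Hypothesis bm : brownian_motion01 P B.
Variables (F G l : R -> R) (eps M h : R).
(* F is the part of the signal common to all hypotheses and G the part whose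
   amplitude is uncertain. The function l is a clock that runs only where G moves:
   G is M-Lipschitz along it and its total length is at most h, so the energy of G
   over any grid is at most M^2 h. *)
Hypothesis eps0 : 0 < eps.
Hypothesis G0 : G 0 = 0.
Hypothesis M0 : 0 <= M.
Hypothesis l_incr : forall t t', 0 <= t -> t <= t' -> t' <= 1 -> 0 <= l t' - l t <= t' - t.
Hypothesis G_l : forall t t', 0 <= t -> t <= t' -> t' <= 1 ->
  `|G t' - G t| <= M * (l t' - l t).
Hypothesis lh : l 1 - l 0 <= h.
Variables (I : finType) (a nu : I -> R) (delta : R).
Hypothesis delta0 : 0 <= delta.
Hypothesis Hdelta : forall z, 0 <= z <= M ^+ 2 * h / eps ^+ 2 ->
  \sum_i \sum_j nu i * nu j * expR (a i * a j * z) <= delta ^+ 2.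

Definition shifted_noise (b : R) (w : T) : observation_space R :=
  fun t => F (val t) + b * G (val t) + eps * B (val t) w.

Lemma measurable_shifted_noise b :
  measurable_fun [set: T] (shifted_noise b : T -> observation_space R).
Proof.
apply: (measurability (@cylinders R : set (set (observation_space R)))) => //.
move=> _ [_ [t _ [D mD <-]] <-]; rewrite !setTI.
have tb : 0 <= val t <= 1 by have := set_valP t; rewrite /= in_itv/=.
have mt : measurable_fun [set: T] (fun w => F (val t) + b * G (val t) + eps * B (val t) w).
  by apply: measurable_funD => //; apply: measurable_funM => //; exact: (bm_measurable bm).
by rewrite -[X in measurable X]setTI; exact: mt.
Qed.

Section fixed_times.
Variable s : seq (time R).

Local Notation k := (size (grid s)).-1.
Local Notation u := (nth 0 (grid s)).

Let X j w := B (u j.+1) w - B (u j) w.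
Let sd j := Num.sqrt (u j.+1 - u j).
Let c j := (G (u j.+1) - G (u j)) / eps.

(** The path at the times of s is a function of its increments over the grid. *)
Let rebuild (x : nat -> R) : path01 R :=
  fun t => F (val t) + eps * \sum_(j < index (val t) (grid s)) x j.

Local Notation seqspace := (g_sigma_algebraType (@rectangles R k)).

Let measurable_rebuild (A : set (path01 R)) : times_sigma s A ->
  measurable (rebuild @^-1` A : set seqspace).
Proof.
move: A; apply: smallest_sub.
  split => /=.
  - by rewrite preimage_set0.
  - by move=> A mA; rewrite setTD preimage_setC; exact: measurableC.
  - by move=> A mA; rewrite preimage_bigcup; exact: bigcupT_measurable.
move=> _ [t ts [D mD <-]]; rewrite setTI.
have mx j : (j < k)%N -> measurable_fun [set: seqspace] (fun x : seqspace => (x : nat -> R) j).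
  move=> jk _ /= E mE; rewrite setTI; apply: sub_sigma_algebra.
  exists (fun i => if i == j then E else setT).
    by move=> i; case: eqP.
  apply/seteqP; split => x /=; first by move=> Ex i _; case: eqP => // ->.
  by move=> /(_ j jk); rewrite eqxx.
have idx : (index (val t) (grid s) <= k)%N.
  rewrite -ltnS -size_grid index_mem mem_grid; apply/orP; right.
  by apply/mapP; exists t.
have mr : measurable_fun [set: seqspace] (fun x : seqspace => rebuild x t).
  apply: measurable_funD => //; apply: measurable_funM => //.
  apply: measurable_sum => j; apply: mx; exact: leq_trans (ltn_ord j) idx.
by rewrite -[X in measurable X]setTI; exact: mr.
Qed.

(** The square of an increment of G is at most M^2 dl^2, and dl^2 / dt is at most
    dl because the clock is not faster than time; the sum of the dl telescopes. *)
Let energy : 0 <= \sum_(j < k) c j ^+ 2 / sd j ^+ 2 <= M ^+ 2 * h / eps ^+ 2.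
Proof.
apply/andP; split.
  by apply: sumr_ge0 => j _; rewrite divr_ge0 ?sqr_ge0.
apply: (@le_trans _ _ (\sum_(j < k) M ^+ 2 / eps ^+ 2 * (l (u j.+1) - l (u j)))).
  apply: ler_sum => j _.
  have jk := ltn_ord j; have ult := nth_grid_lt s j jk.
  have /andP[u0 _] := nth_grid_bounds s j (ltnW jk).
  have /andP[_ u1] := nth_grid_bounds s j.+1 jk.
  have /andP[l0 l1] := l_incr (u j) (u j.+1) u0 (ltW ult) u1.
  have Gl := G_l (u j) (u j.+1) u0 (ltW ult) u1.
  have du0 : 0 < u j.+1 - u j by rewrite subr_gt0.
  rewrite /sd sqr_sqrtr ?(ltW du0)// /c expr_div_n ler_pdivrMr//.
  rewrite [leRHS](_ : _ = M ^+ 2 * (l (u j.+1) - l (u j)) * (u j.+1 - u j) / eps ^+ 2); last by ring.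
  rewrite ler_pM2r ?invr_gt0 ?exprn_gt0//.
  rewrite -[leLHS]real_normK ?num_real//.
  apply: (@le_trans _ _ ((M * (l (u j.+1) - l (u j))) ^+ 2)).
    by rewrite ler_sqr ?nnegrE// mulr_ge0.
  rewrite exprMn -mulrA ler_wpM2l ?sqr_ge0// expr2 ler_wpM2l//.
rewrite -mulr_sumr -[X in _ * X](big_mkord xpredT (fun j => l (u j.+1) - l (u j))) telescope_sumr//.
rewrite nth_grid0 mulrAC ler_wpM2r ?invr_ge0 ?sqr_ge0// ler_wpM2l ?sqr_ge0//.
apply: le_trans lh; rewrite lerB//.
have /andP[uk0 uk1] := nth_grid_bounds s k (leqnn _).
by have /andP[] := l_incr _ _ uk0 uk1 (lexx _); rewrite subr_ge0.
Qed.

Let rebuildE b w t : B 0 w = 0 -> t \in s ->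
  shifted_noise b w t = rebuild (shifted X c b w) t.
Proof.
move=> B0 ts; rewrite /shifted_noise /rebuild/= -addrA; congr (_ + _).
have tg : val t \in grid s.
  by rewrite mem_grid; apply/orP; right; apply/mapP; exists t.
set J := index _ _.
have uJ : u J = val t by rewrite nth_index.
rewrite -uJ /shifted big_split/= -mulr_sumr.
rewrite -(big_mkord xpredT (fun j => X j w)) telescope_sumr// nth_grid0 B0 subr0.
rewrite -(big_mkord xpredT c) /c -mulr_suml telescope_sumr// nth_grid0 G0 subr0.
by field; rewrite gt_eqF.
Qed.

(** For an event that reads the path at finitely many times, the observation is a
    vector of independent Gaussian increments shifted along one direction. *)
Lemma finite_times_bound (A : set (path01 R)) : times_sigma s A ->
  `|\sum_i nu i * fine (P [set w | A (shifted_noise (a i) w)])| <= delta.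
Proof.
move=> sA.
have mX j : (j < k)%N -> measurable_fun [set: T] (X j).
  move=> jk; apply: measurable_funB; apply: (bm_measurable bm); apply: nth_grid_bounds => //.
  exact: ltnW.
have indep (D : nat -> set R) : (forall j, (j < k)%N -> measurable (D j)) ->
    P (\bigcap_(j < k) [set w | D j (X j w)]) = (\prod_(j < k) P [set w | D j (X j w)])%E.
  move=> mD; apply: (bm_independent_increments bm) => // i ik.
  - exact: nth_grid_bounds.
  - exact/ltW/nth_grid_lt.
have sd0 j : (j < k)%N -> sd j != 0.
  by move=> jk; rewrite gt_eqF// sqrtr_gt0 subr_gt0 nth_grid_lt.
have lawX j (D : set R) : (j < k)%N -> measurable D ->
    P [set w | D (X j w)] = normal_prob 0 (sd j) D.
  move=> jk mD; apply: (bm_gaussian_increments bm) => //.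
  - by have /andP[] := nth_grid_bounds s j (ltnW jk).
  - exact: nth_grid_lt.
  - by have /andP[] := nth_grid_bounds s j.+1 jk.
have mA' : measurable (rebuild @^-1` A : set seqspace) by exact: measurable_rebuild.
have := shifted_mixture_bound P k X sd mX indep sd0 lawX c I a nu _ mA'.
have -> : \sum_i nu i * fine (P [set w | (rebuild @^-1` A) (shifted X c (a i) w)]) =
    \sum_i nu i * fine (P [set w | A (shifted_noise (a i) w)]).
  apply: eq_bigr => i _; congr (_ * fine _).
  apply: (eq_measure_negligible P _ _ _ _ _ (bm_start bm)).
  - rewrite -[X in measurable X]setTI.
    exact: (measurable_shifted k X mX c (a i)).
  - have mS := measurable_shifted_noise (a i).
    by rewrite -[X in measurable X]setTI; apply: mS => //; exact: times_sigma_measurable sA.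
  - by move=> w B0; apply: (times_sigma_agree s) => // t ts; rewrite rebuildE.
move=> /le_trans; apply.
rewrite -[leRHS](ger0_norm delta0) -sqrtr_sqr ler_wsqrtr//; exact: Hdelta.
Qed.
End fixed_times.

Let fin_dim : set (set (path01 R)) := \bigcup_(s in [set: seq (time R)]) times_sigma s.

Let fin_dim_setring : setring fin_dim.
Proof.
have sg (s : seq (time R)) : sigma_algebra [set: path01 R] (times_sigma s).
  exact: smallest_sigma_algebra.
have U : setU_closed fin_dim.
  move=> A1 A2 [s1 _ A1s] [s2 _ A2s]; exists (s1 ++ s2) => //.
  have B1 : times_sigma (s1 ++ s2) A1.
    by apply: times_sigmaS A1s => t ts; rewrite mem_cat ts.
  have B2 : times_sigma (s1 ++ s2) A2.
    by apply: times_sigmaS A2s => t ts; rewrite mem_cat ts orbT.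
  have [_ _ sU] := sg (s1 ++ s2).
  have s0 : times_sigma (s1 ++ s2) set0 by have [] := sg (s1 ++ s2).
  rewrite -bigcup2E; apply: (sU (bigcup2 A1 A2)) => -[|[|n]]//=.
have C A : fin_dim A -> fin_dim (~` A).
  move=> [s _ As]; exists s => //; rewrite -setTD.
  by have [_ sC _] := sg s; exact: sC.
split => //; first by exists [::] => //; have [] := sg [::].
move=> A1 A2 F1 F2; rewrite setDE -[A1]setCK -setCU.
by apply: (C); apply: U => //; exact: C.
Qed.

(** Events that depend on finitely many times form a field that generates the
    sigma-algebra of the observation, and the events that satisfy the bound are
    closed under monotone limits, so the monotone class theorem extends
    [finite_times_bound] to every event. This replaces a likelihood for the whole
    path, and with it the stochastic integral. *)
Lemma white_noise_bound (A : set (observation_space R)) : measurable A ->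
  `|\sum_i nu i * fine (P [set w | A (shifted_noise (a i) w)])| <= delta.
Proof.
pose p i (E : set (observation_space R)) := fine (P [set w | E (shifted_noise (a i) w)]).
have mp i (E : set (observation_space R)) : measurable E ->
    measurable [set w | E (shifted_noise (a i) w)].
  by move=> mE; have mS := measurable_shifted_noise (a i);
     rewrite -[X in measurable X]setTI; exact: mS.
pose good := [set E : set (observation_space R) | measurable E /\ `|\sum_i nu i * p i E| <= delta].
suff : <<sr fin_dim >> `<=` good.
  move=> H mA; suff /H[] : <<sr fin_dim >> A by [].
  have [_ srD srU] := smallest_sigma_ring fin_dim.
  move: A mA; apply: smallest_sub.
    split => //; first by have [] := smallest_sigma_ring fin_dim.
    move=> E; apply: srD; apply: sub_g_sigma_ring; exists [::] => //.
    rewrite -[setT]setC0 -setTD.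
    have [s0 sC _] : sigma_algebra [set: path01 R] (times_sigma [::]).
      exact: smallest_sigma_algebra.
    exact: sC.
  move=> E [t _ tE]; apply: sub_g_sigma_ring; exists [:: t] => //.
  by apply: sub_sigma_algebra; exists t => //=; rewrite mem_head.
apply: monotone_setring_sub_g_sigma_ring => //; last first.
  move=> E [s _ sE]; split; first exact: times_sigma_measurable sE.
  exact: finite_times_bound sE.
have lim_bound (E : (set (observation_space R))^nat) (E' : set (observation_space R)) :
    measurable E' -> (forall n, good (E n)) ->
    (forall i, P [set w | E n (shifted_noise (a i) w)] @[n --> \oo] -->
               P [set w | E' (shifted_noise (a i) w)]) ->
    `|\sum_i nu i * p i E'| <= delta.
  move=> mE' gE cE.
  have cp i : p i (E n) @[n --> \oo] --> p i E'.
    have fE : P [set w | E' (shifted_noise (a i) w)] \is a fin_num.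
      by apply: fin_num_measure; exact: mp.
    by apply: fine_cvg; rewrite (fineK fE); exact: cE.
  have cs : `|\sum_i nu i * p i (E n)| @[n --> \oo] --> `|\sum_i nu i * p i E'|.
    apply: cvg_norm; apply: cvg_big => [x|i _]; first exact: add_continuous.
    by apply: cvgM; [exact: cvg_cst|exact: cp].
  apply: (cvgr_to_le cs).
  by apply: nearW => n; have [] := gE n.
split=> E mono gE.
- have mU : measurable (\bigcup_i E i : set (observation_space R)).
    by apply: bigcupT_measurable => n; have [] := gE n.
  split=> //; apply: (lim_bound E) => // i.
  apply: (@nondecreasing_cvg_mu _ _ _ P (fun n => [set w | E n (shifted_noise (a i) w)])).
  + by move=> n; apply: mp; have [] := gE n.
  + exact: (mp i _ mU).
  + move=> m n mn; apply/subsetPset => w /=; have /subsetPset := mono _ _ mn; exact.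
- have mI : measurable (\bigcap_i E i : set (observation_space R)).
    by apply: bigcapT_measurable => n; have [] := gE n.
  split=> //; apply: (lim_bound E) => // i.
  apply: (@nonincreasing_cvg_mu _ _ _ P (fun n => [set w | E n (shifted_noise (a i) w)])).
  + by rewrite -ge0_fin_numE//; apply: fin_num_measure; apply: mp; have [] := gE 0%N.
  + by move=> n; apply: mp; have [] := gE n.
  + exact: (mp i _ mI).
  + move=> m n mn; apply/subsetPset => w /=; have /subsetPset := mono _ _ mn; exact.
Qed.

End white_noise_shift.

(** * Moment matching makes amplitudes indistinguishable *)

Section moment_matching.
Context {R : realType}.

Lemma series_exp_coeff_le (x : R) n : 0 <= x -> series (exp_coeff x) n <= expR x.
Proof.
move=> x0; apply: nondecreasing_cvgn_le; last exact: is_cvg_series_exp_coeff.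
move=> a b ab; rewrite -subr_ge0 sub_series_geq//; apply: sumr_ge0 => i _.
by rewrite /exp_coeff divr_ge0// exprn_ge0.
Qed.

(** Expanding the exponential turns the double sum into the series of the
    z^k / k! (sum_i nu_i x_i^k)^2. Its terms with k < K vanish, and in the others
    the squared moment is at most 4 while z^k is at most (z / K)^K K^k. *)
Lemma moment_matching_bound (I : finType) (x nu : I -> R) (K : nat) (z : R) :
  (0 < K)%N -> (forall i, `|x i| <= 1) -> \sum_i `|nu i| <= 2 ->
  (forall k, (k < K)%N -> \sum_i nu i * x i ^+ k = 0) ->
  0 <= z <= K%:R ->
  \sum_i \sum_j nu i * nu j * expR (x i * x j * z) <=
  4 * (z / K%:R) ^+ K * expR K%:R.
Proof.
move=> K0 x1 nu2 mom /andP[z0 zK].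
have KR : (0 : R) < K%:R by rewrite ltr0n.
pose S n := \sum_i \sum_j nu i * nu j * series (exp_coeff (x i * x j * z)) n.
have cS : S n @[n --> \oo] --> \sum_i \sum_j nu i * nu j * expR (x i * x j * z).
  do 2 (apply: cvg_big => [?|? _]; first exact: add_continuous).
  by apply: cvgM; [exact: cvg_cst|exact: is_cvg_series_exp_coeff].
apply: (cvgr_to_le cS); apply: nearW => n.
have -> : S n = \sum_(0 <= k < n) z ^+ k / k`!%:R * (\sum_i nu i * x i ^+ k) ^+ 2.
  rewrite /S; under eq_bigr do under eq_bigr do rewrite /series/= mulr_sumr.
  under eq_bigr do rewrite exchange_big/=.
  rewrite exchange_big/=; apply: eq_bigr => k _.
  rewrite expr2 mulr_suml mulr_sumr; apply: eq_bigr => i _.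
  rewrite !mulr_sumr; apply: eq_bigr => j _.
  by rewrite /exp_coeff /= !exprMn; ring.
apply: (@le_trans _ _ (\sum_(0 <= k < n) 4 * (z / K%:R) ^+ K * exp_coeff K%:R k)).
  apply: ler_sum => k _; have [kK|Kk] := ltnP k K.
    rewrite mom// expr0n/= mulr0; apply: mulr_ge0; last exact/exp_coeff_ge0/ltW.
    by apply: mulr_ge0 => //; apply: exprn_ge0; rewrite divr_ge0// ltW.
  have D4 : (\sum_i nu i * x i ^+ k) ^+ 2 <= 4.
    rewrite -[leLHS]real_normK ?num_real// (_ : 4 = 2 ^+ 2 :> R); last by rewrite -natrX.
    rewrite ler_sqr ?nnegrE//; apply: le_trans nu2.
    apply: le_trans (ler_norm_sum _ _ _) _; apply: ler_sum => i _.
    by rewrite normrM normrX ler_piMr// exprn_ile1.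
  rewrite [leRHS](_ : _ = (z / K%:R) ^+ K * K%:R ^+ k / k`!%:R * 4); last first.
    by rewrite /exp_coeff/=; ring.
  have zk : z ^+ k <= (z / K%:R) ^+ K * K%:R ^+ k.
    rewrite -[in leLHS](divfK (lt0r_neq0 KR) z) exprMn.
    rewrite ler_wpM2r ?exprn_ge0// ?ler0n//.
    apply: ler_wiXn2l => //; first by rewrite divr_ge0// ltW.
    by rewrite ler_pdivrMr// mul1r.
  rewrite ler_pM// ?sqr_ge0// ?divr_ge0 ?exprn_ge0//.
  by rewrite ler_wpM2r// invr_ge0.
rewrite -mulr_sumr ler_wpM2l//.
  by rewrite mulr_ge0// exprn_ge0// divr_ge0// ltW.
by apply: (series_exp_coeff_le _ n); exact: ltW.
Qed.

End moment_matching.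

(** * Finite product priors *)

Section product_expectation.
Context {R : realType} {A : finType}.
Implicit Types (w : A -> R) (th : nat -> A) (H : (nat -> A) -> R).

Definition update th n a : nat -> A := fun i => if i == n then a else th i.

(** The product measure w^n is integrated one coordinate at a time, so that its
    properties follow by induction on n; the coordinates from n on are those of
    th. *)
Fixpoint expect w n H th : R :=
  if n is n'.+1 then \sum_a w a * expect w n' (fun th => H (update th n' a)) th
  else H th.

Variable w : A -> R.
Hypothesis w0 : forall a, 0 <= w a.
Hypothesis w1 : \sum_a w a = 1.

Lemma expectZD n H H' c th :
  expect w n (fun th => c * H th + H' th) th = c * expect w n H th + expect w n H' th.
Proof.
elim: n H H' => //= n IH H H'; rewrite mulr_sumr -big_split/=.
by apply: eq_bigr => a _; rewrite IH; ring.
Qed.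

Lemma le_expect n H H' th : (forall th, H th <= H' th) ->
  expect w n H th <= expect w n H' th.
Proof.
by elim: n H H' => //= n IH H H' HH'; apply: ler_sum => a _; rewrite ler_wpM2l// IH.
Qed.

Lemma eq_expect n H H' th : (forall th, H th = H' th) ->
  expect w n H th = expect w n H' th.
Proof.
by elim: n H H' => //= n IH H H' HH'; apply: eq_bigr => a _; congr (_ * _); apply: IH.
Qed.

Lemma expect_cst n c th : expect w n (fun=> c) th = c.
Proof.
elim: n c => //= n IH c; under eq_bigr do rewrite IH.
by rewrite -mulr_suml w1 mul1r.
Qed.

Lemma expect_sum n (f : nat -> A -> R) th :
  expect w n (fun th => \sum_(i < n) f i (th i)) th =
  \sum_(i < n) \sum_a w a * f i a.
Proof.
elim: n => [|n IH] /=; first by rewrite !big_ord0.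
rewrite big_ord_recr/=.
transitivity (\sum_a (w a * expect w n (fun th => \sum_(i < n) f i (th i)) th + w a * f n a)).
  apply: eq_bigr => a _; rewrite -mulrDr; congr (_ * _).
  rewrite -[X in _ + X](expect_cst n _ th) -[in RHS](mul1r (expect _ _ _ _)) -expectZD.
  apply: eq_expect => th'; rewrite mul1r big_ord_recr/= /update eqxx; congr (_ + _).
  by apply: eq_bigr => i _; rewrite ltn_eqF.
by rewrite big_split/= -mulr_suml w1 mul1r IH.
Qed.

Lemma expect_sqr_sum n (f : nat -> A -> R) th :
  (forall i, \sum_a w a * f i a = 0) ->
  expect w n (fun th => (\sum_(i < n) f i (th i)) ^+ 2) th =
  \sum_(i < n) \sum_a w a * f i a ^+ 2.
Proof.
move=> f0; elim: n => [|n IH] /=; first by rewrite !big_ord0 expr0n.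
rewrite big_ord_recr/=.
pose S th := \sum_(i < n) f i (th i).
transitivity (\sum_a (w a * expect w n (fun th => S th ^+ 2) th + w a * f n a ^+ 2)).
  apply: eq_bigr => a _; rewrite -mulrDr; congr (_ * _).
  transitivity (expect w n (fun th => 2 * f n a * S th + (1 * S th ^+ 2 + f n a ^+ 2)) th).
    apply: eq_expect => th'; rewrite big_ord_recr/= /update eqxx.
    rewrite (_ : \sum_(i < n) _ = S th'); first by ring.
    by apply: eq_bigr => i _; rewrite ltn_eqF.
  rewrite !expectZD expect_cst expect_sum big1 ?mulr0 ?add0r ?mul1r//.
by rewrite big_split/= -mulr_suml w1 mul1r IH.
Qed.

Lemma expect_suml (J : Type) (r : seq J) n (c : J -> R) (H : J -> (nat -> A) -> R) th :
  expect w n (fun th => \sum_(j <- r) c j * H j th) th =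
  \sum_(j <- r) c j * expect w n (H j) th.
Proof.
elim: r => [|j r IH].
  by rewrite big_nil -[RHS](expect_cst n 0 th); apply: eq_expect => ?; rewrite big_nil.
by rewrite big_cons -IH -expectZD; apply: eq_expect => ?; rewrite big_cons.
Qed.

Lemma expect_markov n H th (t : R) : (forall th, 0 <= H th) -> 0 < t ->
  expect w n (fun th => (t < H th)%R%:R) th <= expect w n H th / t.
Proof.
move=> H0 t0; rewrite ler_pdivlMr// mulrC -[leLHS]addr0 -(expect_cst n 0 th) -expectZD.
apply: le_expect => th'; rewrite addr0; case: ltP => [/ltW|_]; first by rewrite mulr1.
by rewrite mulr0.
Qed.

End product_expectation.

(** The laws of the coordinates are exchanged one after the other. The cost of one
    exchange is bounded uniformly in the other coordinates, so it does not matter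
    which law these have at that stage. *)
Lemma expect_telescope {R : realType} {A : finType} (w w' : A -> R) n
    (H : (nat -> A) -> R) th delta :
  (forall a, 0 <= w a) -> \sum_a w a = 1 ->
  (forall a, 0 <= w' a) -> \sum_a w' a = 1 ->
  (forall i th, (i < n)%N -> `|\sum_a (w a - w' a) * H (update th i a)| <= delta) ->
  `|expect w n H th - expect w' n H th| <= n%:R * delta.
Proof.
move=> w0 w1 w'0 w'1; elim: n H => [|n IH] H Hd /=.
  by rewrite subrr normr0 mul0r.
rewrite [X in `|X|](_ : _ =
  \sum_a w a * (expect w n (fun th => H (update th n a)) th -
                expect w' n (fun th => H (update th n a)) th) +
  expect w' n (fun th => \sum_a (w a - w' a) * H (update th n a)) th); last first.
  rewrite (expect_suml w' w'1) -big_split/= -sumrB; apply: eq_bigr => a _.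
  by rewrite !mulrBl mulrBr; ring.
apply: le_trans (ler_normD _ _) _; rewrite -natr1 mulrDl mul1r lerD//.
  apply: le_trans (ler_norm_sum _ _ _) _.
  rewrite -[leRHS]mul1r -[X in _ <= X * _]w1 mulr_suml; apply: ler_sum => a _.
  rewrite normrM ger0_norm// ler_wpM2l//; apply: IH => i th' ni.
  rewrite (eq_bigr (fun b => (w b - w' b) * H (update (update th' n a) i b))).
    by apply: Hd; exact: ltnW.
  move=> b _; congr (_ * H _); apply/funext => j; rewrite /update.
  by case: eqP => // ->; rewrite gtn_eqF.
pose D th := \sum_a (w a - w' a) * H (update th n a).
have Dd th' : `|D th'| <= delta by exact: Hd.
rewrite ler_norml -[- delta](expect_cst w' w'1 n _ th) -[X in _ && (_ <= X)](expect_cst w' w'1 n _ th).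
by apply/andP; split; apply: le_expect => // th'; have := Dd th'; rewrite ler_norml => /andP[].
Qed.

(** * Alternating trigonometric sums *)

Section trigonometric_sums.
Context {R : realType}.

Lemma sin_le (t : R) : 0 <= t -> sin t <= t.
Proof.
move=> t0; have [|x _] := @MVT_segment R sin cos 0 t t0 (fun x _ => is_derive_sin x).
- exact/continuous_subspaceT/continuous_sin.
- by rewrite sin0 !subr0 => ->; rewrite ler_piMl// cos_le1.
Qed.

(** A crude form of Jordan's inequality. *)
Lemma sin_ge (t : R) : 0 <= t <= pi / 2 -> t / 4 <= sin t.
Proof.
move=> /andP[t0 t2].
have pi0 := @pi_gt0 R; have pi2 := @pihalf_lt2 R.
have c4 : cos (pi / 4) ^+ 2 = 2^-1 :> R.
  have := @cos_mulr2n R (pi / 4).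
  rewrite (_ : pi / 4 *+ 2 = pi / 2 :> R); last by field.
  by rewrite cos_pihalf => /esym/eqP; rewrite subr_eq0 => /eqP; lra.
have c4ge : 2^-1 <= cos (pi / 4) :> R.
  have c0 : 0 <= cos (pi / 4) :> R by apply: cos_ge0_pihalf; apply/andP; split; lra.
  by nra.
have s4 : 2^-1 <= sin (pi / 4) :> R.
  have s0 : 0 <= sin (pi / 4) :> R by apply: sin_ge0_pi; apply/andP; split; lra.
  by have := @cos2Dsin2 R (pi / 4); nra.
have [t4|t4] := leP t (pi / 4).
- have [|x /[!in_itv]/= /andP[x0 xt]] :=
    @MVT_segment R sin cos 0 t t0 (fun x _ => is_derive_sin x).
  + exact/continuous_subspaceT/continuous_sin.
  + rewrite sin0 !subr0 => ->; rewrite mulrC ler_wpM2r//.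
    have : cos (pi / 4) <= cos x.
      have := @ltr_cos R x (pi / 4); rewrite !in_itv/=.
      have [->//|xn] := eqVneq x (pi / 4).
      move=> H; apply: ltW; rewrite H; last 2 first.
        by apply/andP; split; lra.
        by apply/andP; split; lra.
      by rewrite lt_neqAle xn/=; lra.
    by lra.
- have : sin (pi / 4) < sin t.
    by rewrite ltr_sin// in_itv/=; apply/andP; split; lra.
  by lra.
Qed.

Let alternate n : (-1) ^+ n.+1 = - (-1) ^+ n :> R.
Proof. by rewrite exprS mulN1r. Qed.

Lemma cos_natpi2 k : cos (pi *+ 2 *+ k) = 1 :> R.
Proof. by have := periodicn (@cosD2pi R) k 0; rewrite add0r cos0. Qed.

Lemma sin_natpi2 k : sin (pi *+ 2 *+ k) = 0 :> R.
Proof. by have := periodicn (@sinD2pi R) k 0; rewrite add0r sin0. Qed.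

(** Multiplying the terms by 2 cos (b / 2) makes the alternating sum telescope;
    the same device proves [alternating_cos_sum]. *)
Lemma alternating_sin_sum (N : nat) (b : R) : ~~ odd N ->
  cos (b *+ N) = -1 ->
  2 * cos (b / 2) * \sum_(i < N) (-1) ^+ i * sin (b *+ i) = - 2 * sin (b / 2).
Proof.
move=> evN cN.
have sN : sin (b *+ N) = 0 by apply: cos1sin0; rewrite cN normrN1.
pose U i : R := - (-1) ^+ i * sin (b *+ i - b / 2).
have step i : 2 * cos (b / 2) * ((-1) ^+ i * sin (b *+ i)) = U i.+1 - U i.
  rewrite /U alternate (mulrS b) (_ : b + b *+ i - b / 2 = b *+ i + b / 2); last by field.
  by rewrite sinD sinB; ring.
rewrite mulr_sumr (eq_bigr (fun i : 'I_N => U i.+1 - U i)) => [|i _]; last exact: step.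
rewrite -(big_mkord xpredT (fun i => U i.+1 - U i)) telescope_sumr// /U.
rewrite mulr0n sub0r sinN sinB sN cN -signr_odd (negbTE evN) !expr0; ring.
Qed.

Lemma alternating_cos_sum (N : nat) (b : R) : ~~ odd N ->
  cos (b *+ N) = 1 -> cos (b / 2) != 0 ->
  \sum_(i < N) (-1) ^+ i * cos (b *+ i) = 0.
Proof.
move=> evN cN cb.
have sN : sin (b *+ N) = 0 by apply: cos1sin0; rewrite cN normr1.
pose U i : R := - (-1) ^+ i * cos (b *+ i - b / 2).
have step i : 2 * cos (b / 2) * ((-1) ^+ i * cos (b *+ i)) = U i.+1 - U i.
  rewrite /U alternate (mulrS b) (_ : b + b *+ i - b / 2 = b *+ i + b / 2); last by field.
  by rewrite cosD cosB; ring.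
have c2 : 2 * cos (b / 2) != 0 by rewrite mulf_neq0.
apply: (mulfI c2); rewrite mulr0.
rewrite mulr_sumr (eq_bigr (fun i : 'I_N => U i.+1 - U i)) => [|i _]; last exact: step.
rewrite -(big_mkord xpredT (fun i => U i.+1 - U i)) telescope_sumr// /U.
rewrite mulr0n sub0r cosN cosB sN cN -signr_odd (negbTE evN) !expr0; ring.
Qed.

End trigonometric_sums.

Section cosine_span.
Context {R : realType}.
Implicit Types (C : R -> Prop) (D k : nat) (f g : R -> R).

(** Cosine polynomials of degree at most D with coefficients in C. With C the
    nonnegative numbers, [alternating_sin_cospan] can exclude cancellation between
    the frequencies. *)
Inductive cospan C D : (R -> R) -> Prop :=
| cospan_cos k : (k <= D)%N -> cospan C D (fun y => cos (y *+ k))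
| cospanD f g : cospan C D f -> cospan C D g -> cospan C D (fun y => f y + g y)
| cospanZ c f : C c -> cospan C D f -> cospan C D (fun y => c * f y).

Lemma cospanS C C' D D' f : (forall c, C c -> C' c) -> (D <= D')%N ->
  cospan C D f -> cospan C' D' f.
Proof.
move=> CC' DD'; elim=> [k kD|{}f g _ If _ Ig|c {}f Cc _ If].
- by apply: cospan_cos; exact: leq_trans DD'.
- exact: cospanD.
- by apply: cospanZ => //; exact: CC'.
Qed.

Lemma cospan_cst C D c : C c -> cospan C D (fun=> c).
Proof.
move=> Cc; rewrite (_ : (fun=> c) = (fun y => c * cos (y *+ 0))).
  by apply: cospanZ => //; exact: cospan_cos.
by apply/funext => y; rewrite mulr0n cos0 mulr1.
Qed.

(** The product-to-sum formula brings in no other coefficient than 1 / 2; in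
    particular it preserves nonnegative coefficients. *)
Lemma cospanM C D E f g : C 2^-1 -> cospan C D f -> cospan C E g ->
  cospan C (D + E) (fun y => f y * g y).
Proof.
move=> C2 + Cg; elim=> [k kD|{}f h _ If _ Ih|c {}f Cc _ If]; last 2 first.
- rewrite (_ : (fun y => _) = (fun y => f y * g y + h y * g y)).
    exact: cospanD.
  by apply/funext => y; rewrite mulrDl.
- rewrite (_ : (fun y => _) = (fun y => c * (f y * g y))).
    exact: cospanZ.
  by apply/funext => y; rewrite mulrA.
elim: Cg => [l lE|{}f h _ If _ Ih|c {}f Cc _ If]; last 2 first.
- rewrite (_ : (fun y => _) = (fun y => cos (y *+ k) * f y + cos (y *+ k) * h y)).
    exact: cospanD.
  by apply/funext => y; rewrite mulrDr.
- rewrite (_ : (fun y => _) = (fun y => c * (cos (y *+ k) * f y))).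
    exact: cospanZ.
  by apply/funext => y; rewrite mulrCA.
rewrite (_ : (fun y => _) =
    (fun y => 2^-1 * (cos (y *+ (k + l)) + cos (y *+ (maxn k l - minn k l))))).
  apply: cospanZ => //; apply: cospanD; apply: cospan_cos; first exact: leq_add.
  by apply: leq_trans (leq_subr _ _) _; rewrite geq_max; apply/andP; split; lia.
apply/funext => y.
have -> : cos (y *+ (maxn k l - minn k l)) = cos (y *+ k - y *+ l).
  have [kl|lk] := leqP k l; rewrite mulrnBr//; last exact: ltnW.
  by rewrite -opprB cosN.
by rewrite mulrnDr cosD cosB; field.
Qed.

Lemma cospanX C D f n : C 2^-1 -> C 1 -> cospan C D f ->
  cospan C (n * D) (fun y => f y ^+ n).
Proof.
move=> C2 C1 Cf; elim: n => [|n IH].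
  by rewrite (_ : (fun y => _) = (fun=> 1)); [exact: cospan_cst|exact/funext].
rewrite mulSn (_ : (fun y => _) = (fun y => f y * f y ^+ n)); last first.
  by apply/funext => y; rewrite exprS.
exact: cospanM.
Qed.

Variable H : nat.
Hypothesis H0 : (0 < H)%N.
Local Notation N := (H.*2).
Let th : R := pi / N%:R.

Let NR : 0 < N%:R :> R. Proof. by rewrite ltr0n double_gt0. Qed.

Let thN : th *+ N = pi.
Proof. by rewrite -mulr_natr divfK// lt0r_neq0. Qed.

Let evenN : ~~ odd N. Proof. by rewrite odd_double. Qed.

Let th_lt k : (k < N)%N -> th / 2 * k%:R < pi / 2.
Proof.
move=> kN; rewrite mulrAC ltr_pM2r// /th mulrAC ltr_pdivrMr// ltr_pM2l ?pi_gt0//.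
by rewrite ltr_nat.
Qed.

Let th0 : 0 < th. Proof. by rewrite divr_gt0 ?pi_gt0. Qed.

(** The alternating sign on 2 H equally spaced points is the frequency H, which is
    orthogonal on these points to all lower ones. *)
Lemma alternating_cospan C D f : (D < H)%N -> cospan C D f ->
  \sum_(i < N) (-1) ^+ i * f (th *+ i *+ 2) = 0.
Proof.
move=> DH; elim=> [k kD|{}f g _ If _ Ig|c {}f Cc _ If]; last 2 first.
- by rewrite (eq_bigr _ (fun i _ => mulrDr _ _ _)) big_split/= If Ig addr0.
- by rewrite (eq_bigr _ (fun i _ => mulrCA _ _ _)) -mulr_sumr If mulr0.
have E i : th *+ i *+ 2 *+ k = (th *+ 2 *+ k) *+ i.
  by rewrite -!mulrnA; congr (_ *+ _); lia.
under eq_bigr do rewrite E.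
apply: alternating_cos_sum => //.
- rewrite (_ : _ *+ N = pi *+ 2 *+ k) ?cos_natpi2//.
  by rewrite -thN -!mulrnA; congr (_ *+ _); lia.
- rewrite (_ : _ / 2 = th / 2 * (k.*2)%:R).
    apply/lt0r_neq0/cos_gt0_pihalf/andP; split.
      apply: (@lt_le_trans _ _ 0); first by rewrite oppr_lt0 divr_gt0 ?pi_gt0.
      by rewrite mulr_ge0// divr_ge0// ltW.
    by apply: th_lt; rewrite ltn_double; exact: leq_ltn_trans DH.
  by rewrite -muln2 natrM -(mulr_natr (th *+ 2)) -(mulr_natr th); field.
Qed.

(** For a single cosine the sum is minus sin th / 2 divided by a product of two
    cosines in ]0, 1]. The sign is the same for all frequencies, so a combination
    with nonnegative coefficients cannot cancel. *)
Lemma alternating_sin_cospan D f : (D < H)%N -> cospan (fun c => 0 <= c) D f ->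
  \sum_(i < N) (-1) ^+ i * (sin (th *+ i) * f (th *+ i *+ 2)) <= - (sin th / 2 * f 0).
Proof.
move=> DH; elim=> [k kD|{}f g _ If _ Ig|c {}f Cc _ If]; last 2 first.
- rewrite mulrDr opprD; apply: le_trans (lerD If Ig).
  by rewrite -big_split/=; apply: ler_sum => i _; rewrite !mulrDr.
- rewrite (_ : - _ = c * - (sin th / 2 * f 0)); last by ring.
  apply: le_trans (ler_wpM2l Cc If).
  by rewrite mulr_sumr; apply: ler_sum => i _; rewrite [leLHS](_ : _ = c * ((-1) ^+ i * (sin (th *+ i) * f (th *+ i *+ 2))))//; ring.
have kH : (k < H)%N by exact: leq_ltn_trans DH.
pose b1 := th * (1 + (k.*2)%:R); pose b2 := th * (1 - (k.*2)%:R).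
(* both frequencies 1 + 2k and 1 - 2k are odd, so the sine sums are taken at
   multiples of th whose N-th multiple is pi modulo 2 pi *)
have bN b (e : R) : b = th * (1 + e * (k.*2)%:R) -> e = 1 \/ e = -1 -> cos (b *+ N) = -1.
  move=> -> e1; rewrite (_ : _ *+ N = pi + e * (pi *+ 2 *+ k)).
    rewrite cosD cospi sinpi mul0r subr0.
    case: e1 => ->; first by rewrite mul1r cos_natpi2 mulr1.
    by rewrite mulN1r [-1 * _]mulN1r cosN cos_natpi2.
  rewrite -thN -muln2 natrM -[in LHS]mulr_natr -(mulr_natr _ k) -(mulr_natr _ 2) -(mulr_natr th).
  by ring.
have s1 := alternating_sin_sum N b1 evenN (bN b1 1 _ (or_introl erefl)).
have s2 := alternating_sin_sum N b2 evenN (bN b2 (-1) _ (or_intror erefl)).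
have {}s1 := s1 ltac:(by rewrite mul1r).
have {}s2 := s2 ltac:(by rewrite mulN1r).
have k2N : (k.*2 < N.-1)%N by lia.
have kN : (k.*2)%:R + 1 <= N%:R - 1 :> R.
  by rewrite lerBrDr !natr1 ler_nat; lia.
have k0 : (0 : R) <= (k.*2)%:R by [].
have pi2 := @pi_gt0 R.
have thNR : th * N%:R = pi by rewrite divfK// lt0r_neq0.
have c1 : 0 < cos (b1 / 2).
  by apply: cos_gt0_pihalf; apply/andP; split; rewrite /b1; nra.
have c2 : 0 < cos (b2 / 2).
  by apply: cos_gt0_pihalf; apply/andP; split; rewrite /b2; nra.
rewrite mul0rn cos0 mulr1.
have -> : \sum_(i < N) (-1) ^+ i * (sin (th *+ i) * cos (th *+ i *+ 2 *+ k)) =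
  2^-1 * (\sum_(i < N) (-1) ^+ i * sin (b1 *+ i) + \sum_(i < N) (-1) ^+ i * sin (b2 *+ i)).
  rewrite -big_split/= mulr_sumr; apply: eq_bigr => i _.
  have -> : b1 *+ i = th *+ i + th *+ i *+ 2 *+ k.
    rewrite /b1 -!mulrnA -!(mulr_natr th) -(mulr_natr (th * _)) !natrM -muln2 natrM; ring.
  have -> : b2 *+ i = th *+ i - th *+ i *+ 2 *+ k.
    rewrite /b2 -!mulrnA -!(mulr_natr th) -(mulr_natr (th * _)) !natrM -muln2 natrM; ring.
  by rewrite sinD sinB; field.
have -> : \sum_(i < N) (-1) ^+ i * sin (b1 *+ i) = - sin (b1 / 2) / cos (b1 / 2).
  apply: (mulfI (lt0r_neq0 (mulr_gt0 (ltr0n R 2 : 0 < 2) c1))).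
  by rewrite s1; field; rewrite lt0r_neq0.
have -> : \sum_(i < N) (-1) ^+ i * sin (b2 *+ i) = - sin (b2 / 2) / cos (b2 / 2).
  apply: (mulfI (lt0r_neq0 (mulr_gt0 (ltr0n R 2 : 0 < 2) c2))).
  by rewrite s2; field; rewrite lt0r_neq0.
have sth : sin th = sin (b1 / 2) * cos (b2 / 2) + cos (b1 / 2) * sin (b2 / 2).
  by rewrite -sinD; congr sin; rewrite /b1 /b2; field.
have -> : 2^-1 * (- sin (b1 / 2) / cos (b1 / 2) + - sin (b2 / 2) / cos (b2 / 2)) =
    - (sin th / 2 / (cos (b1 / 2) * cos (b2 / 2))).
  by rewrite sth; field; rewrite !lt0r_neq0.
rewrite lerN2 ler_pdivlMr ?mulr_gt0//.
have sth0 : 0 <= sin th.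
  by apply: sin_ge0_pi; rewrite (ltW th0)/=; nra.
by rewrite ler_piMr ?divr_ge0// mulr_ile1 ?cos_le1// ltW.
Qed.

End cosine_span.

(** * The Dirichlet kernel *)

Section dirichlet_kernel.
Context {R : realType}.
Variable K : nat.
Local Notation M := (K.*2.+1).

(** The Dirichlet kernel, normalized to be 1 at 0. *)
Definition dirichlet (y : R) : R := (1 + 2 * \sum_(k < K) cos (y *+ k.+1)) / M%:R.

Let MR : 0 < M%:R :> R. Proof. by rewrite ltr0n. Qed.

Lemma dirichlet0 : dirichlet 0 = 1.
Proof.
rewrite /dirichlet (eq_bigr (fun=> 1)) => [|k _]; last by rewrite mul0rn cos0.
by rewrite sumr_const card_ord -natrM mul2n nat1r divff// lt0r_neq0.
Qed.

(** This closed form gives the decay of the kernel: at 2 t it is at most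
    1 / (M |sin t|) in absolute value. *)
Lemma sin_dirichlet t : M%:R * sin t * dirichlet (t *+ 2) = sin (t *+ M).
Proof.
transitivity (sin t * (1 + 2 * \sum_(k < K) cos (t *+ 2 *+ k.+1))).
  by rewrite /dirichlet; field; rewrite lt0r_neq0.
elim: K => [|k IH]; first by rewrite big_ord0 mulr0 addr0 mulr1.
rewrite big_ord_recr/= [LHS](_ : _ = sin t * (1 + 2 * \sum_(i < k) cos (t *+ 2 *+ i.+1)) +
  2 * (sin t * cos (t *+ 2 *+ k.+1))); last by ring.
rewrite IH.
have -> : t *+ 2 *+ k.+1 = t *+ k.*2.+1 + t by rewrite -mulrnA -mulrSr; congr (_ *+ _); lia.
have -> : t *+ k.+1.*2.+1 = t *+ k.*2.+1 + t + t.
  by rewrite -!mulrSr; congr (_ *+ _); lia.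
rewrite !sinD !cosD.
have := cos2Dsin2 t; move: (sin (t *+ _)) (cos (t *+ _)) (sin t) (cos t) => a b c e ec.
have -> : (a * e + b * c) * e + (b * e - a * c) * c =
  a * (e ^+ 2 + c ^+ 2) + 2 * (c * (b * e - a * c)) by ring.
by rewrite ec mulr1.
Qed.

Lemma cospan_dirichlet : cospan (fun c => 0 <= c) K dirichlet.
Proof.
rewrite (_ : dirichlet = (fun y => M%:R^-1 * (1 + 2 * \sum_(k < K) cos (y *+ k.+1)))); last first.
  by apply/funext => y; rewrite /dirichlet mulrC.
apply: cospanZ; first by rewrite invr_ge0.
apply: cospanD; first exact: cospan_cst.
apply: cospanZ => //.
have : forall n, (n <= K)%N -> cospan (fun c : R => 0 <= c) K (fun y => \sum_(k < n) cos (y *+ k.+1)).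
  elim=> [_|n IH nK].
    rewrite (_ : (fun y => _) = (fun=> 0)); first exact: cospan_cst.
    by apply/funext => y; rewrite big_ord0.
  rewrite (_ : (fun y => _) = (fun y => \sum_(k < n) cos (y *+ k.+1) + cos (y *+ n.+1))).
    by apply: cospanD; [apply: IH; exact: ltnW|exact: cospan_cos].
  by apply/funext => y; rewrite big_ord_recr.
by apply.
Qed.

End dirichlet_kernel.

Lemma sum_inv_sqr_le {R : realType} (n : nat) : \sum_(1 <= i < n) (i%:R ^+ 2)^-1 <= 2 :> R.
Proof.
suff H : forall n, \sum_(1 <= i < n.+2) (i%:R ^+ 2)^-1 <= 2 - n.+1%:R^-1 :> R.
  case: n => [|[|n]]; [by rewrite big_geq ?ler0n|by rewrite big_geq ?ler0n|].
  by apply: le_trans (H n) _; rewrite gerBl invr_ge0.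
elim=> [|{}n IH]; first by rewrite big_nat1 invr1 expr1n invr1; lra.
rewrite big_nat_recr//=; apply: le_trans (lerD IH (lexx _)) _.
rewrite -[n.+2%:R]natr1; have : (0 : R) < n.+1%:R by [].
move: (n.+1%:R) => x x0.
rewrite -addrA lerD2l -subr_ge0.
have x1 : 0 < x + 1 by lra.
rewrite (_ : _ - _ = (x * (x + 1) ^+ 2)^-1); last by field; rewrite !lt0r_neq0.
by rewrite invr_ge0 mulr_ge0 ?sqr_ge0// ltW.
Qed.

(** * Two laws with equal moments and different absolute moments *)

Section moment_matched_pair.
Context {R : realType}.
Variables (q K : nat).
Hypotheses (q0 : (0 < q)%N) (K0 : (0 < K)%N).
Local Notation M := (K.*2.+1).
Local Notation H := (q.*2 * M)%N.
Local Notation N := (H.*2).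
Let th : R := pi / N%:R.
Let a i : R := sin (th *+ i).
Let J i : R := dirichlet K (th *+ i *+ 2) ^+ q.*2.
Let Z : R := \sum_(i < N) J i.

Let N0 : (0 < N)%N. Proof. by rewrite double_gt0 muln_gt0 double_gt0 q0. Qed.
Let NE : N = (4 * q * M)%N. Proof. by rewrite -!muln2; ring. Qed.
Let K_le_N : (K <= N)%N.
Proof.
rewrite NE; apply: (@leq_trans M); first by rewrite -addnn -addnS leq_addr.
by rewrite leq_pmull// muln_gt0.
Qed.
Let N_le : (2 * N <= 24 * q * K)%N.
Proof.
have qK : (q <= q * K)%N by rewrite leq_pmulr.
rewrite NE (_ : (2 * (4 * q * M) = 16 * (q * K) + 8 * q)%N); last first.
  by rewrite -muln2 -[_.+1]addn1; ring.
rewrite -mulnA; move: (q * K)%N qK => z qz; lia.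
Qed.
Let NR : 0 < N%:R :> R. Proof. by rewrite ltr0n. Qed.
Let MR : 0 < M%:R :> R. Proof. by rewrite ltr0n. Qed.

Let th0 : 0 < th. Proof. by rewrite divr_gt0 ?pi_gt0. Qed.
Let thN : th *+ N = pi.
Proof. by rewrite -mulr_natr divfK// lt0r_neq0. Qed.

Let J_ge0 i : 0 <= J i.
Proof. by rewrite /J -mul2n exprM exprn_ge0// sqr_ge0. Qed.

Let J0 : J 0 = 1. Proof. by rewrite /J mulr0n mul0rn dirichlet0 expr1n. Qed.

Let Z_ge1 : 1 <= Z.
Proof.
by rewrite /Z (bigD1 (Ordinal N0))//= J0 lerDl; apply: sumr_ge0 => i _.
Qed.

Let cospan_J (C : R -> Prop) : (forall c, 0 <= c -> C c) ->
  cospan C (q.*2 * K) (fun y => dirichlet K y ^+ q.*2).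
Proof.
move=> C0; apply: cospanX; [by apply: C0; rewrite invr_ge0|exact: C0|].
exact: cospanS (cospan_dirichlet K).
Qed.

Let a_ge0 i : (i <= N)%N -> 0 <= a i.
Proof.
move=> iN; apply: sin_ge0_pi; rewrite mulrn_wge0 ?(ltW th0)//= -thN.
by apply: ler_wpMn2l => //; exact: ltW.
Qed.

(** Even powers of a sine are cosine polynomials in the double angle, and N is
    large enough for the product with J to have degree below H. *)
Let even_moment l : (l <= K)%N -> \sum_(i < N) (-1) ^+ i * (J i * a i ^+ (2 * l)) = 0.
Proof.
move=> lK.
pose f (y : R) := dirichlet K y ^+ q.*2 * ((1 - cos (y *+ 1)) / 2) ^+ l.
rewrite (eq_bigr (fun i : 'I_N => (-1) ^+ i * f (th *+ i *+ 2))); last first.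
  move=> i _; rewrite /f /J /a exprM mulr1n; congr (_ * (_ * _ ^+ _)).
  by rewrite cos_mulr2n sin2cos2; field.
have H0 : (0 < H)%N by rewrite muln_gt0 double_gt0 q0.
apply: (alternating_cospan H H0 (fun=> True) (q.*2 * K + l * 1)).
  rewrite muln1; apply: (@leq_trans (q.*2 * K + q.*2 * K).+1); last by nia.
  by rewrite ltnS leq_add2l; nia.
apply: cospanM => //; first exact: cospan_J.
apply: cospanX => //.
rewrite (_ : (fun y => _) = (fun y => 2^-1 + (- 2^-1) * cos (y *+ 1))); last first.
  by apply/funext => y; field.
by apply: cospanD; [exact: cospan_cst|apply: cospanZ => //; exact: cospan_cos].
Qed.

Let sin_gap : \sum_(i < N) (-1) ^+ i * (J i * a i) <= - (sin th / 2).
Proof.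
have H0 : (0 < H)%N by rewrite muln_gt0 double_gt0 q0.
have DH : (q.*2 * K < H)%N by nia.
have := alternating_sin_cospan H H0 _ _ DH (cospan_J _ (fun c c0 => c0)).
rewrite dirichlet0 expr1n mulr1; apply: le_trans; apply: ler_sum => i _.
by rewrite [J i * _]mulrC.
Qed.

Let a_bounds i : (0 < i <= H)%N -> i%:R / (2 * N%:R) <= a i <= 4 * i%:R / N%:R.
Proof.
move=> /andP[i0 iH]; have p2 := @pihalf_lt2 R; have p2' := @pi_ge2 R.
have tE : th *+ i = pi / N%:R * i%:R by rewrite mulr_natr.
have t0 : 0 <= th *+ i by rewrite mulrn_wge0// ltW.
apply/andP; split; last first.
  apply: le_trans (sin_le _ t0) _; rewrite tE mulrAC ler_wpM2r ?invr_ge0 ?(ltW NR)//.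
  by rewrite ler_wpM2r//; lra.
have : th *+ i / 4 <= a i.
  apply: sin_ge; rewrite t0 tE mulrAC -mulrA ler_wpM2l ?pi_ge0//.
  rewrite ler_pdivrMr// -(@ler_pM2l _ 2)// mulrA divff// mul1r -natrM ler_nat.
  by rewrite mul2n leq_double.
apply: le_trans; rewrite tE -[_ / (2 * _)]mulr1.
rewrite [leRHS](_ : _ = i%:R / (2 * N%:R) * (pi / 2)); last by field; rewrite lt0r_neq0.
by rewrite ler_wpM2l ?divr_ge0 ?mulr_ge0// ?(ltW NR)//; lra.
Qed.

Let aN i : (i <= N)%N -> a (N - i) = a i.
Proof.
by move=> iN; rewrite /a mulrnBr// thN sinB sinpi cospi; ring.
Qed.

Let D : R := (8 * q%:R) ^+ q.*2.

Let D0 : 0 <= D. Proof. by rewrite exprn_ge0// mulr_ge0. Qed.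

Variable p : R.
Hypothesis p1 : 1 <= p.
Hypothesis pq : p + 2 <= (q.*2)%:R.

(** The kernel decays like 1 / i at the i-th node, so its power 2 q dominates both
    the p-th power of the node and the factor i^2 that makes the sum converge. *)
Let term_bound i : (0 < i <= H)%N ->
  J i <= D * (i%:R ^+ 2)^-1 /\ J i * a i `^ p <= D * 4 `^ p * N%:R `^ (- p) * (i%:R ^+ 2)^-1.
Proof.
move=> iH; have /andP[i0 _] := iH; have /andP[al au] := a_bounds _ iH.
have iR : 1 <= i%:R :> R by rewrite ler1n.
have iR0 : 0 < i%:R :> R by rewrite ltr0n.
have a0 : 0 < a i by apply: lt_le_trans al; rewrite divr_gt0// mulr_gt0.
have JD : J i <= D * i%:R `^ (- (q.*2)%:R).
  rewrite powRN powR_mulrn ?(ltW iR0)// /D -exprVn -exprMn.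
  rewrite -(ger0_norm (J_ge0 i)) /J normrX lerXn2r ?nnegrE ?mulr_ge0 ?invr_ge0//.
  have S : `|dirichlet K (th *+ i *+ 2)| * (M%:R * a i) <= 1.
    have -> : `|dirichlet K (th *+ i *+ 2)| * (M%:R * a i) = `|sin (th *+ i *+ M)|.
      by rewrite -sin_dirichlet -/(a i) (normrM (_ * a i)) (ger0_norm (ltW (mulr_gt0 MR a0))) mulrC.
    exact: sin_max.
  have Ma0 : 0 < M%:R * a i by rewrite mulr_gt0.
  rewrite -ler_pdivlMr// in S; apply: le_trans S _; rewrite mul1r.
  rewrite -[leRHS]invrK lef_pV2 ?posrE ?invr_gt0 ?mulr_gt0// ?invr_gt0//; last first.
    by rewrite ltr0n.
  rewrite invfM invrK mulrC -ler_pdivrMl//; apply: le_trans al.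
  have qR : 0 < q%:R :> R by rewrite ltr0n.
  rewrite le_eqVlt; apply/orP; left; apply/eqP.
  rewrite NE !natrM.
  by field; rewrite !lt0r_neq0.
have pw2 : (i%:R : R) `^ (- 2%:R) = (i%:R ^+ 2)^-1 by rewrite powRN powR_mulrn// ltW.
have i2 : (i%:R : R) `^ (- (q.*2)%:R) <= (i%:R ^+ 2)^-1.
  by rewrite -pw2 ler_powR// lerN2; apply: le_trans pq; rewrite lerDr (le_trans _ p1).
split; first by apply: le_trans JD _; rewrite ler_wpM2l.
apply: (@le_trans _ _ (D * i%:R `^ (- (q.*2)%:R) * (4 * i%:R / N%:R) `^ p)).
  apply: ler_pM => //; first exact: powR_ge0.
  by apply: ge0_ler_powR; rewrite ?nnegrE ?(le_trans _ p1) ?(ltW a0) ?divr_ge0 ?mulr_ge0// ltW.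
rewrite !powRM ?mulr_ge0 ?invr_ge0 ?(ltW NR)// -powR_inv1 ?(ltW NR)// -powRrM mulN1r.
rewrite [leLHS](_ : _ = D * 4 `^ p * N%:R `^ (- p) * (i%:R `^ (- (q.*2)%:R) * i%:R `^ p)); last by ring.
rewrite ler_wpM2l ?mulr_ge0 ?powR_ge0// -powRD; last by rewrite (gt_eqF iR0) implybT.
by rewrite -pw2 ler_powR// addrC lerBlDl lerBrDr.
Qed.

Let JN i : (i <= N)%N -> J (N - i) = J i.
Proof.
move=> iN; rewrite /J; congr (_ ^+ _); rewrite /dirichlet; congr ((1 + 2 * _) / _).
apply: eq_bigr => k _; rewrite mulrnBr// thN.
rewrite [_ *+ k.+1](_ : _ = pi *+ 2 *+ k.+1 - th *+ i *+ 2 *+ k.+1); last first.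
  by rewrite !mulrnBl.
by rewrite cosB cos_natpi2 sin_natpi2; ring.
Qed.

(** The nodes are symmetric under i -> N - i, so a bound on the first half of them,
    where i is comparable to N a_i, is enough. *)
Let fold_sum (g : nat -> R) (c : R) : 0 <= c ->
  (forall i, (0 < i <= H)%N -> g i <= c * (i%:R ^+ 2)^-1) ->
  (forall i, (i <= N)%N -> g (N - i)%N = g i) ->
  \sum_(i < N) g i <= g 0%N + 4 * c.
Proof.
move=> c0 gc gN.
rewrite -(big_mkord xpredT g) big_ltn// lerD2l.
apply: (@le_trans _ _ (\sum_(1 <= i < N) (c * (i%:R ^+ 2)^-1 + c * ((N - i)%:R ^+ 2)^-1))).
  rewrite big_nat [leRHS]big_nat; apply: ler_sum => i /andP[i0 iN].
  have [iH|Hi] := leqP i H.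
    by apply: le_trans (gc i _) _; rewrite ?i0// lerDl mulr_ge0// invr_ge0 sqr_ge0.
  rewrite -gN; last exact: ltnW.
  apply: le_trans (gc _ _) _; last by rewrite lerDr mulr_ge0// invr_ge0 sqr_ge0.
  by rewrite subn_gt0 iN/= leq_subLR; lia.
rewrite big_split/= [X in _ + X]big_nat_rev/=.
rewrite (eq_big_nat _ _ (F1 := fun i => c * ((N - (1 + N - i.+1))%:R ^+ 2)^-1)
  (F2 := fun i => c * (i%:R ^+ 2)^-1)); last first.
  by move=> i /andP[i0 iN]; rewrite (_ : (N - (1 + N - i.+1))%N = i)//; lia.
rewrite -!mulr_sumr -mulrDr mulrC ler_wpM2r//.
have := @sum_inv_sqr_le R N; lra.
Qed.

Let Z_le : Z <= 1 + 4 * D.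
Proof.
by have := fold_sum J D D0 (fun i iH => proj1 (term_bound i iH)) JN; rewrite J0.
Qed.

Let moment_le : \sum_(i < N) J i * a i `^ p <= 4 * (D * 4 `^ p * N%:R `^ (- p)).
Proof.
have c0 : 0 <= D * 4 `^ p * N%:R `^ (- p) by rewrite !mulr_ge0// powR_ge0.
have := fold_sum (fun i => J i * a i `^ p) _ c0.
rewrite /a mulr0n sin0 powR0 ?mulr0 ?add0r; last first.
  by rewrite gt_eqF// (lt_le_trans _ p1).
apply.
- by move=> i iH; have [_] := term_bound i iH.
- by move=> i iN; rewrite JN// -/(a _) aN.
Qed.

(** The nodes are the a_i and their opposites, with equal weights so that odd
    moments vanish; the two laws share the weights J, one over the even i and the
    other over the odd i. *)
Let x (j : 'I_N * bool) : R := (-1) ^+ j.2 * a j.1.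
Let mu (e : bool) (j : 'I_N * bool) : R := J j.1 * (1 + (-1) ^+ e * (-1) ^+ j.1) / (2 * Z).

Let mu_ge0 e j : 0 <= mu e j.
Proof.
rewrite divr_ge0 ?mulr_ge0//; last by rewrite (le_trans _ Z_ge1).
by rewrite -exprD -signr_odd; case: (odd _); rewrite ?expr0 ?expr1; lra.
Qed.

Let sum_mu e (f : R -> R) : \sum_j mu e j * f (x j) =
  (\sum_(i < N) J i * (f (a i) + f (- a i)) +
   (-1) ^+ e * \sum_(i < N) (-1) ^+ i * (J i * (f (a i) + f (- a i)))) / (2 * Z).
Proof.
rewrite -(pair_bigA _ (fun i b => mu e (i, b) * f (x (i, b))))/= mulr_sumr -big_split/= mulr_suml.
apply: eq_bigr => i _; rewrite big_bool/= /mu /x/= expr0 expr1 mul1r mulN1r; ring.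
Qed.

Lemma moment_matched_pair_at : exists (I : finType) (x mu1 mu0 : I -> R),
  [/\ (forall i, 0 <= mu1 i) /\ \sum_i mu1 i = 1,
      (forall i, 0 <= mu0 i) /\ \sum_i mu0 i = 1,
      (forall i, `|x i| <= 1) /\
      (forall k, (k < K)%N -> \sum_i (mu1 i - mu0 i) * x i ^+ k = 0),
      (24 * q%:R * (1 + 4 * D))^-1 / K%:R <= \sum_i (mu1 i - mu0 i) * `|x i| &
      (\sum_i mu1 i * `|x i| `^ p <= 8 * D * 4 `^ p * K%:R `^ (- p)) /\
      (\sum_i mu0 i * `|x i| `^ p <= 8 * D * 4 `^ p * K%:R `^ (- p))].
Proof.
have Z0 : 0 < Z by rewrite (lt_le_trans _ Z_ge1).
have alt0 l : (l <= K)%N -> \sum_(i < N) (-1) ^+ i * (J i * a i ^+ (2 * l)) = 0.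
  exact: even_moment.
have sum1 e : \sum_j mu e j = 1.
  have := sum_mu e (fun=> 1); under eq_bigr do rewrite mulr1; move=> ->.
  rewrite -mulr_suml -/Z (eq_bigr (fun i : 'I_N => 2 * ((-1) ^+ i * (J i * a i ^+ (2 * 0))))).
    by rewrite -mulr_sumr alt0//; field; rewrite lt0r_neq0.
  by move=> i _; rewrite muln0 expr0; ring.
have p_moment e : \sum_i mu e i * `|x i| `^ p <= 8 * D * 4 `^ p * K%:R `^ (- p).
  apply: (@le_trans _ _ (2 * \sum_(i < N) J i * a i `^ p)); last first.
    apply: le_trans (ler_wpM2l _ moment_le) _ => //.
    rewrite [leLHS](_ : _ = 8 * D * 4 `^ p * N%:R `^ (- p)); last by ring.
    rewrite ler_wpM2l ?mulr_ge0 ?powR_ge0// !powRN lef_pV2 ?posrE ?powR_gt0 ?ltr0n//.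
    by apply: ge0_ler_powR; rewrite ?nnegrE ?ler0n ?(le_trans _ p1)// ler_nat K_le_N.
  rewrite (sum_mu e (fun t => `|t| `^ p)) ler_pdivrMr ?mulr_gt0//.
  have E i : `|a i| `^ p + `|- a i| `^ p = 2 * `|a i| `^ p by rewrite normrN; ring.
  have Ea (i : 'I_N) : `|a i| = a i by rewrite ger0_norm// a_ge0// ltnW.
  have S0 : 0 <= \sum_(i < N) J i * a i `^ p.
    by apply: sumr_ge0 => i _; rewrite mulr_ge0// powR_ge0.
  apply: (@le_trans _ _ (4 * \sum_(i < N) J i * a i `^ p)); last first.
    have := ler_wpM2r S0 Z_ge1; lra.
  rewrite !mulr_sumr -big_split/=; apply: ler_sum => i _; rewrite E Ea.
  have Ji : 0 <= J i * a i `^ p by rewrite mulr_ge0// powR_ge0.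
  rewrite [leLHS](_ : _ = 2 * (1 + (-1) ^+ e * (-1) ^+ i) * (J i * a i `^ p)); last by ring.
  by rewrite ler_wpM2r// -exprD -signr_odd; case: (odd _); rewrite ?expr0 ?expr1; lra.
have diff f : \sum_j (mu true j - mu false j) * f (x j) =
    - (\sum_(i < N) (-1) ^+ i * (J i * (f (a i) + f (- a i)))) / Z.
  under eq_bigr do rewrite mulrBl; rewrite sumrB !sum_mu expr0 expr1.
  by field; rewrite lt0r_neq0.
exists ('I_N * bool)%type, x, (mu true), (mu false); split; [| | split | |].
- by split=> //; exact: mu_ge0.
- by split=> //; exact: mu_ge0.
- by move=> j; rewrite /x normrMsign sin_max.
- move=> k kK; rewrite (diff (fun t => t ^+ k)).
  rewrite [X in - X](_ : _ = 0) ?oppr0 ?mul0r//.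
  have [ok|ek] := boolP (odd k).
    rewrite big1// => i _; rewrite [(- a i) ^+ k]exprNn -(signr_odd R k) ok expr1; ring.
  rewrite (eq_bigr (fun i : 'I_N => 2 * ((-1) ^+ i * (J i * a i ^+ (2 * k./2))))).
    by rewrite -mulr_sumr alt0 ?mulr0// -divn2 (leq_trans (leq_div _ _))// ltnW.
  move=> i _; rewrite mul2n even_halfK// [(- a i) ^+ k]exprNn -(signr_odd R k) (negbTE ek) expr0; ring.
- rewrite (diff (fun t => `|t|)).
  have -> : \sum_(i < N) (-1) ^+ i * (J i * (`|a i| + `|- a i|)) =
      2 * \sum_(i < N) (-1) ^+ i * (J i * a i).
    rewrite mulr_sumr; apply: eq_bigr => i _.
    by rewrite normrN ger0_norm ?a_ge0 1?ltnW//; ring.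
  have H1 : (0 < 1 <= H)%N by rewrite muln_gt0 double_gt0 q0.
  have /andP[sth _] := a_bounds 1 H1; rewrite /a mulr1n in sth.
  have D1 : 0 < 1 + 4 * D by rewrite (lt_le_trans _ (_ : 1 <= _))// lerDl mulr_ge0.
  have KR : 0 < K%:R :> R by rewrite ltr0n.
  have qR : 0 < q%:R :> R by rewrite ltr0n.
  apply: (@le_trans _ _ (sin th / Z)); last first.
    by rewrite ler_wpM2r ?invr_ge0 ?(ltW Z0)//; have := sin_gap; lra.
  apply: (@le_trans _ _ (1 / (2 * N%:R) / (1 + 4 * D))); last first.
    by apply: ler_pM => //; rewrite ?lef_pV2 ?posrE// ?divr_ge0 ?mulr_ge0 ?invr_ge0 ?(ltW D1)// ltW.
  rewrite [leLHS](_ : _ = 1 / (24 * q%:R * K%:R) / (1 + 4 * D)); last first.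
    by field; rewrite !lt0r_neq0.
  rewrite ler_wpM2r ?invr_ge0 ?(ltW D1)// ler_wpM2l// lef_pV2 ?posrE ?mulr_gt0//.
  by rewrite -!natrM ler_nat N_le.
- by split; exact: p_moment.
Qed.

End moment_matched_pair.

(** The gap c / K is of the order of the error of best approximation of |x| by
    polynomials of degree K, hence optimal up to the constant. The p-th moments have
    the order K^(-p), that is, both laws live at the scale 1 / K around the origin.
    This is what keeps the random
    functions built from K x in a ball of fixed radius although K x may be as
    large as K. *)
Lemma moment_matched_pair {R : realType} (p : R) : 1 <= p ->
  exists c C : R, [/\ 0 < c, 0 < C & forall K : nat, (0 < K)%N ->
  exists (I : finType) (x mu1 mu0 : I -> R),
  [/\ (forall i, 0 <= mu1 i) /\ \sum_i mu1 i = 1,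
      (forall i, 0 <= mu0 i) /\ \sum_i mu0 i = 1,
      (forall i, `|x i| <= 1) /\
      (forall k, (k < K)%N -> \sum_i (mu1 i - mu0 i) * x i ^+ k = 0),
      c / K%:R <= \sum_i (mu1 i - mu0 i) * `|x i| &
      (\sum_i mu1 i * `|x i| `^ p <= C * K%:R `^ (- p)) /\
      (\sum_i mu0 i * `|x i| `^ p <= C * K%:R `^ (- p))]].
Proof.
move=> p1; pose q := (Num.truncn p).+2.
have pq : p + 2 <= (q.*2)%:R.
  have /ltW pt : p < (Num.truncn p).+1%:R by apply: truncnS_gt.
  apply: (@le_trans _ _ ((Num.truncn p).+1%:R + 2)); first by rewrite lerD2r.
  by rewrite -natrD ler_nat /q; lia.
have q0 : (0 < q)%N by [].
have D0 : 0 < (8 * q%:R) ^+ q.*2 :> R by rewrite exprn_gt0// mulr_gt0.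
exists (24 * q%:R * (1 + 4 * (8 * q%:R) ^+ q.*2))^-1, (8 * (8 * q%:R) ^+ q.*2 * 4 `^ p).
split; last by move=> K K0; exact: moment_matched_pair_at.
- by rewrite invr_gt0 !mulr_gt0// addr_gt0// mulr_gt0.
- by rewrite mulr_gt0 ?powR_gt0// mulr_gt0.
Qed.

(** * Differences of a polynomial bump *)

Section finite_differences.
Context {R : realType}.

(** Differences of order m annihilate polynomials of degree below m. The induction
    on m uses (k + 1) C(m + 1, k + 1) = (m + 1) C(m, k). *)
Lemma alternating_binomial_moment (m i : nat) : (i < m)%N ->
  \sum_(k < m.+1) (-1) ^+ (m - k) * 'C(m, k)%:R * k%:R ^+ i = 0 :> R.
Proof.
suff H : (i < m)%N -> \sum_(k < m.+1) (-1) ^+ k * 'C(m, k)%:R * k%:R ^+ i = 0 :> R.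
  move=> im; rewrite (eq_bigr (fun k : 'I_m.+1 =>
      (-1) ^+ m * ((-1) ^+ k * 'C(m, k)%:R * k%:R ^+ i))).
    by rewrite -mulr_sumr H// mulr0.
  move=> k _; rewrite !mulrA -exprD; congr (_ * _ * _).
  by rewrite -signr_odd -[RHS]signr_odd oddD oddB// -ltnS.
elim: m i => // m IH [_|i im].
  have := exprBn (1 : R) 1 m.+1; rewrite subrr expr0n/= => /esym E.
  rewrite -[RHS]E; apply: eq_bigr => k _.
  by rewrite !expr1n expr0 !mulr1 mulr_natr.
rewrite big_ord_recl expr0n/= mulr0 add0r.
rewrite (eq_bigr (fun k : 'I_m.+1 => - m.+1%:R * \sum_(l < i.+1)
    'C(i, l)%:R * ((-1) ^+ k * 'C(m, k)%:R * k%:R ^+ l))); last first.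
  move=> k _; rewrite /bump/= add1n.
  have binE : 'C(m.+1, k.+1)%:R * k.+1%:R = m.+1%:R * 'C(m, k)%:R :> R.
    by rewrite -!natrM mulnC -mul_bin_diag.
  rewrite [LHS](_ : _ = - (-1) ^+ k * ('C(m.+1, k.+1)%:R * k.+1%:R) * k.+1%:R ^+ i); last first.
    by rewrite !exprS; ring.
  rewrite binE -(nat1r k) exprDn !mulr_sumr; apply: eq_bigr => l _.
  rewrite expr1n mul1r -mulr_natr; ring.
rewrite -mulr_sumr exchange_big/= big1 ?mulr0// => l _.
by rewrite -mulr_sumr IH ?mulr0//; exact: leq_trans (ltn_ord l) im.
Qed.

Lemma poly_difference_bound (p : {poly R}) (m : nat) : exists2 C : R, 0 <= C &
  forall y u : R, `|y| <= 1 -> 0 <= u <= 1 ->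
  `|\sum_(k < m.+1) (-1) ^+ (m - k) * 'C(m, k)%:R * p.[y + k%:R * u]| <= C * u ^+ m.
Proof.
pose c (k : 'I_m.+1) : R := (-1) ^+ (m - k) * 'C(m, k)%:R.
pose S i := \sum_k c k * k%:R ^+ i.
pose B i := \sum_(j < size p^`N(i)) `|p^`N(i)`_j|.
exists (\sum_(i < size p) B i * `|S i|).
  by apply: sumr_ge0 => i _; rewrite mulr_ge0//; exact: sumr_ge0.
move=> y u y1 /andP[u0 u1].
rewrite (eq_bigr (fun k : 'I_m.+1 => \sum_(i < size p) p^`N(i).[y] * u ^+ i * (c k * k%:R ^+ i))); last first.
  move=> k _; rewrite nderiv_taylor; last exact: mulrC.
  by rewrite mulr_sumr; apply: eq_bigr => i _; rewrite exprMn /c; ring.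
rewrite exchange_big/= mulr_suml; apply: le_trans (ler_norm_sum _ _ _) _.
apply: ler_sum => i _; rewrite -mulr_sumr -/(S i).
have [im|mi] := ltnP i m.
  by rewrite /S /c alternating_binomial_moment// normr0 !mulr0 normr0 mul0r.
rewrite !normrM [leRHS]mulrAC ler_wpM2r// normrX (ger0_norm u0).
apply: ler_pM; rewrite ?exprn_ge0//; last exact: ler_wiXn2l.
rewrite horner_coef; apply: le_trans (ler_norm_sum _ _ _) _; apply: ler_sum => j _.
by rewrite normrM normrX ler_piMr// exprn_ile1.
Qed.

(** A bump supported by the unit interval that vanishes to order m at both ends:
    this much regularity suffices for differences of order m. *)
Definition polybump m (x : R) : R := if 0 <= x < 1 then (x * (1 - x)) ^+ m else 0.

Lemma polybump_ge0 m x : 0 <= polybump m x.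
Proof.
rewrite /polybump; case: ifP => // /andP[x0 x1].
by rewrite exprn_ge0// mulr_ge0// subr_ge0 ltW.
Qed.

Lemma polybump_le m x : polybump m x <= ((0 <= x < 1)%R : nat)%:R.
Proof.
rewrite /polybump; case: ifP => // /andP[x0 x1].
by rewrite exprn_ile1//; nra.
Qed.

(** The sum of indicators on the right localizes the difference. When u < 1 and
    all the points lie in [0, 1[ the bump is a polynomial there; when one of them
    lies outside, those inside are within m u of an endpoint, where the bump is at
    most (m u)^m. *)
Lemma polybump_difference_bound m : (0 < m)%N -> exists2 C : R, 0 <= C &
  forall u x, 0 <= u ->
  `|\sum_(k < m.+1) (-1) ^+ (m - k) * 'C(m, k)%:R * polybump m (x + (k%:R - m%:R / 2) * u)| <=
  C * Num.min 1 u ^+ m *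
    \sum_(k < m.+1) ((0 <= x + (k%:R - m%:R / 2) * u < 1)%R : nat)%:R.
Proof.
move=> m0; have [C1 C10 HC1] := poly_difference_bound (('X * (1 - 'X)) ^+ m) m.
pose C2 : R := 2 ^+ m * m%:R ^+ m.
have C20 : 0 <= C2 by rewrite mulr_ge0// exprn_ge0.
have C30 : 0 <= 2 ^+ m :> R by rewrite exprn_ge0.
exists (C1 + C2 + 2 ^+ m); first by rewrite !addr_ge0.
move=> u x u0; pose X (k : nat) := x + (k%:R - m%:R / 2) * u.
pose T := \sum_(k < m.+1) ((0 <= X k < 1)%R : nat)%:R : R.
rewrite -/T.
have T0 : 0 <= T by apply: sumr_ge0.
have binle k : 'C(m, k)%:R <= 2 ^+ m :> R.
  rewrite -natrX ler_nat -[(2 ^ m)%N]/((1 + 1) ^ m)%N expnDn.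
  have [km|mk] := leqP k m; last by rewrite bin_small.
  rewrite (bigD1 (inord k : 'I_m.+1))//= inordK// !exp1n !mul1n muln1; exact: leq_addr.
have term (B : R) : (forall k : 'I_m.+1, polybump m (X k) <= B * ((0 <= X k < 1)%R : nat)%:R) ->
    `|\sum_(k < m.+1) (-1) ^+ (m - k) * 'C(m, k)%:R * polybump m (X k)| <= 2 ^+ m * B * T.
  move=> XB; apply: le_trans (ler_norm_sum _ _ _) _; rewrite mulr_sumr.
  apply: ler_sum => k _; rewrite -mulrA normrMsign normrM (ger0_norm (polybump_ge0 _ _)) ger0_norm//.
  by rewrite -mulrA; apply: ler_pM => //; exact: polybump_ge0.
have [u1|u1] := leP 1 u.
  rewrite expr1n mulr1.
  apply: le_trans (term 1 _) _; first by move=> k; rewrite mul1r polybump_le.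
  by rewrite mulr1 ler_wpM2r// lerDr addr_ge0.
have um : 0 <= u ^+ m by rewrite exprn_ge0.
have [/forallP/= allin|] := boolP [forall k : 'I_m.+1, 0 <= X k < 1].
  have T1 : 1 <= T.
    rewrite /T (bigD1 ord0)//= (allin ord0 : (0 <= X 0%N < 1) = true) lerDl.
    exact: sumr_ge0.
  apply: (@le_trans _ _ (C1 * u ^+ m)).
    have := HC1 (X 0%N) u _ _; rewrite (ger0_norm _) ?u0 ?(ltW u1); last by have /andP[] := allin ord0.
    have /andP[_ /ltW X1] := allin ord0; move=> /(_ X1 isT); apply: le_trans.
    rewrite le_eqVlt; apply/orP; left; apply/eqP; congr `|_|; apply: eq_bigr => k _.
    have := allin k; rewrite /polybump -/(X k) => ->; rewrite !hornerE/=.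
    by congr (_ * (_ * _) ^+ _); rewrite /X; ring.
  rewrite -[C1 * _]mulr1; apply: ler_pM => //; first by rewrite mulr_ge0.
  by rewrite ler_wpM2r// -addrA lerDl addr_ge0.
rewrite negb_forall => /existsP[k1 k1out].
apply: le_trans (term ((m%:R * u) ^+ m) _) _; last first.
  rewrite ler_wpM2r// exprMn mulrA -/C2 ler_wpM2r//; lra.
move=> k; rewrite /polybump; case: ifPn => [/andP[a0 a1]|_]; last by rewrite mulr0.
rewrite mulr1.
have mu0 : 0 <= m%:R * u by rewrite mulr_ge0.
rewrite lerXn2r ?nnegrE// ?mulr_ge0 ?subr_ge0// ?(ltW a1)//.
have dist : `|X k - X k1| <= m%:R * u.
  rewrite [X in `|X|](_ : _ = (k%:R - k1%:R) * u); last by rewrite /X; ring.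
  rewrite normrM (ger0_norm u0) ler_wpM2r//.
  have : (k <= m)%N by rewrite -ltnS. have : (k1 <= m)%N by rewrite -ltnS.
  rewrite -(ler_nat R) -[(k <= m)%N](ler_nat R) ler_norml => h1 h2.
  have k0 : 0 <= k%:R :> R by []. have k10 : 0 <= k1%:R :> R by [].
  by apply/andP; split; lra.
move: dist k1out; rewrite ler_norml negb_and -ltNge -leNgt => /andP[d1 d2] /orP[h|h].
  by nra.
by nra.
Qed.

End finite_differences.

(** * Step functions on a grid of cells *)

Section cells.
Context {R : realType}.
Implicit Types (N m n : nat) (th : nat -> R) (p x y : R).

(** Cells are closed on the left and open on the right, hence disjoint. *)
Definition in_cell N (i : nat) y : R := ((0 <= N%:R * y - i%:R < 1)%R : nat)%:R.

Lemma in_cell_unique N (i j : nat) y :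
  0 <= N%:R * y - i%:R < 1 -> 0 <= N%:R * y - j%:R < 1 -> i = j.
Proof.
move=> /andP[i0 i1] /andP[j0 j1].
have ij : (i%:R : R) < j.+1%:R by rewrite -natr1; lra.
have ji : (j%:R : R) < i.+1%:R by rewrite -natr1; lra.
by apply/eqP; rewrite eqn_leq; move: ij ji; rewrite !ltr_nat !ltnS => -> ->.
Qed.

Definition step N th y : R := \sum_(i < N) `|th i| * in_cell N i y.

Lemma step_ge0 N th y : 0 <= step N th y.
Proof. by apply: sumr_ge0 => i _; rewrite mulr_ge0. Qed.

Lemma powR_step N th p y : 1 <= p ->
  step N th y `^ p = \sum_(i < N) `|th i| `^ p * in_cell N i y.
Proof.
move=> p1; have p0 : p != 0 by rewrite gt_eqF// (lt_le_trans _ p1).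
have [/existsP[i0 ci0]|/existsPn noc] := boolP [exists i : 'I_N, 0 <= N%:R * y - i%:R < 1].
  have others (i : 'I_N) : i != i0 -> in_cell N i y = 0.
    move=> ii0; rewrite /in_cell; have [ci|//] := boolP (0 <= _ < 1); case/eqP: ii0; apply: val_inj.
    exact: (in_cell_unique _ _ _ _ ci ci0).
  rewrite /step (bigD1 i0)//= [RHS](bigD1 i0)//= !big1.
  - by rewrite !addr0 /in_cell ci0 !mulr1.
  - by move=> i /others ->; rewrite mulr0.
  - by move=> i /others ->; rewrite mulr0.
have c0 (i : 'I_N) : in_cell N i y = 0 by rewrite /in_cell (negbTE (noc i)).
by rewrite /step !big1 ?powR0// => i _; rewrite c0 mulr0.
Qed.

Lemma powR_sum_le n (a : 'I_n.+1 -> R) p : 0 <= p -> (forall k, 0 <= a k) ->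
  (\sum_k a k) `^ p <= n.+1%:R `^ p * \sum_k a k `^ p.
Proof.
move=> p0 a0; have [k0 _ k0max] := @arg_maxP _ _ _ ord0 xpredT a isT.
apply: (@le_trans _ _ ((n.+1%:R * a k0) `^ p)).
  apply: ge0_ler_powR; rewrite ?nnegrE ?mulr_ge0//; first exact: sumr_ge0.
  apply: (@le_trans _ _ (\sum_(k < n.+1) a k0)).
    by apply: ler_sum => k _; exact: k0max.
  by rewrite sumr_const card_ord mulr_natl.
rewrite powRM// ler_wpM2l ?powR_ge0// (bigD1 k0)//= lerDl.
by apply: sumr_ge0 => k _; exact: powR_ge0.
Qed.

Lemma measurable_in_cell N i (tau : R) :
  measurable_fun [set: R] (fun x => in_cell N i (x + tau)).
Proof.
rewrite (_ : (fun x => _) = (fun x => if 0 <= N%:R * (x + tau) - i%:R < 1 then 1 else 0)).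
  apply: measurable_fun_ifT => //.
  have mN : measurable_fun [set: R] (fun x => N%:R * (x + tau) - i%:R).
    by apply: measurable_funB => //; apply: measurable_funM => //; exact: measurable_funD.
  apply: measurable_and; first exact: measurable_fun_ler.
  exact: measurable_fun_ltr.
by apply/funext => x; rewrite /in_cell; case: (0 <= _ < 1).
Qed.

Lemma integral_in_cell N i (tau : R) : (0 < N)%N ->
  (\int[lebesgue_measure]_x (in_cell N i (x + tau))%:E = (N%:R^-1)%:E)%E.
Proof.
move=> N0; have NR : 0 < N%:R :> R by rewrite ltr0n.
pose I := `[i%:R / N%:R - tau, i.+1%:R / N%:R - tau[ : interval R.
transitivity (\int[lebesgue_measure]_x (\1_([set` I] : set R) x)%:E)%E.
  apply: eq_integral => x _; congr EFin; rewrite indicE /in_cell mem_setE /I in_itv/=.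
  congr (_ : nat)%:R; rewrite lerBlDr ltrBrDr ler_pdivrMr// ltr_pdivlMr// -natr1.
  by rewrite subr_ge0 ltrBlDr [1 + _]addrC mulrC.
rewrite integral_indic//= setIT lebesgue_measure_itv/= lte_fin.
rewrite ltrD2r ltr_pM2r ?invr_gt0// ltr_nat ltnSn -EFinB; congr EFin.
by rewrite -natr1; field; rewrite lt0r_neq0.
Qed.

(** A function dominated by a few translates of a step function has its p-norm
    controlled by the p-mean of the heights: the cells are disjoint, so p-th powers
    can be taken cell by cell, and a translate has the same integral over the line.
    Both a combination of bumps and its differences have this form. *)
Lemma norm01_step_le N th p n (g : R -> R) (c : R) (tau : 'I_n.+1 -> R) :
  (0 < N)%N -> 1 <= p -> 0 <= c -> measurable_fun [set: R] g ->
  (forall x, 0 <= x <= 1 -> `|g x| <= c * \sum_k step N th (x + tau k)) ->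
  (norm01 p g <= (c * n.+1%:R ^+ 2 *
                  (N%:R^-1 * \sum_(i < N) `|th i| `^ p) `^ p^-1)%:E)%E.
Proof.
move=> N0 p1 c0 mg gS.
have p0 : 0 < p by rewrite (lt_le_trans _ p1).
have n1 : 1 <= n.+1%:R :> R by rewrite ler1n.
pose W := \sum_(i < N) `|th i| `^ p.
have W0 : 0 <= W by apply: sumr_ge0 => i _; exact: powR_ge0.
pose c' := (c * n.+1%:R) `^ p.
have c'0 : 0 <= c' by exact: powR_ge0.
pose dom x : R := \sum_(k < n.+1) \sum_(i < N) (c' * `|th i| `^ p) * in_cell N i (x + tau k).
have gdom x : `| (g \_ `[0, 1]) x | `^ p <= dom x.
  rewrite patchE; case: ifPn => [|_]; last first.
    rewrite normr0 powR0 ?gt_eqF//; apply: sumr_ge0 => k _; apply: sumr_ge0 => i _.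
    by rewrite !mulr_ge0// powR_ge0.
  rewrite mem_setE/= in_itv/= => x01.
  apply: (@le_trans _ _ ((c * \sum_k step N th (x + tau k)) `^ p)).
    apply: ge0_ler_powR; rewrite ?nnegrE ?(ltW p0) ?gS// mulr_ge0//.
    by apply: sumr_ge0 => k _; exact: step_ge0.
  rewrite powRM//; last by apply: sumr_ge0 => k _; exact: step_ge0.
  apply: (@le_trans _ _ (c `^ p * (n.+1%:R `^ p * \sum_k step N th (x + tau k) `^ p))).
    rewrite ler_wpM2l ?powR_ge0// powR_sum_le ?(ltW p0)// => k; exact: step_ge0.
  rewrite mulrA -powRM// -/c' mulr_sumr; apply: ler_sum => k _.
  by rewrite powR_step// mulr_sumr; under [leRHS]eq_bigr do rewrite -mulrA.
have mE k : measurable_fun [set: R] (fun x => \sum_(i < N) (c' * `|th i| `^ p) * in_cell N i (x + tau k)).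
  by apply: measurable_sum => i; apply: measurable_funM => //; exact: measurable_in_cell.
have idom : (\int[lebesgue_measure]_x (dom x)%:E = (c' * n.+1%:R * (N%:R^-1 * W))%:E)%E.
  transitivity (\int[lebesgue_measure]_x (\sum_(k < n.+1)
     (\sum_(i < N) (c' * `|th i| `^ p) * in_cell N i (x + tau k))%:E))%E.
    by apply: eq_integral => x _; rewrite sumEFin.
  rewrite ge0_integral_sum//; last 2 first.
  - by move=> k; apply/measurable_EFinP; exact: mE.
  - move=> k x _; rewrite lee_fin; apply: sumr_ge0 => i _.
    by rewrite !mulr_ge0// powR_ge0.
  rewrite (eq_bigr (fun=> (c' * (N%:R^-1 * W))%:E)) => [|k _].
    by rewrite sumEFin sumr_const card_ord -mulr_natl; congr EFin; ring.
  transitivity (\int[lebesgue_measure]_x (\sum_(i < N)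
     ((c' * `|th i| `^ p)%:E * (in_cell N i (x + tau k))%:E)))%E.
    by apply: eq_integral => x _; rewrite -sumEFin.
  rewrite ge0_integral_sum//; last 2 first.
  - move=> i; apply: emeasurable_funM => //; apply/measurable_EFinP.
    exact: measurable_in_cell.
  - by move=> i x _; rewrite -EFinM lee_fin !mulr_ge0// powR_ge0.
  rewrite mulrA mulr_sumr -sumEFin; apply: eq_bigr => i _.
  rewrite ge0_integralZl//.
  - by rewrite integral_in_cell// -EFinM; congr EFin; ring.
  - by apply/measurable_EFinP; exact: measurable_in_cell.
  - by move=> x _; rewrite lee_fin.
  - by rewrite lee_fin mulr_ge0// powR_ge0.
have mg01 : measurable_fun [set: R] (g \_ `[0, 1]).
  by apply/(measurable_restrictT _ _).1 => //; exact: measurable_funTS.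
have mgp : measurable_fun [set: R] (fun x => `| (g \_ `[0, 1]) x | `^ p).
  by apply: (measurableT_comp (@measurable_powR R p)); exact: measurableT_comp.
rewrite /norm01 unlock /=.
apply: (@le_trans _ _ (poweR (c' * n.+1%:R * (N%:R^-1 * W))%:E p^-1)).
  apply: gt0_ler_poweR; rewrite ?in_itv/= ?leey ?andbT.
  - by rewrite invr_ge0 ltW.
  - by apply: integral_ge0 => x _; rewrite lee_fin powR_ge0.
  - by rewrite lee_fin !mulr_ge0// ?invr_ge0.
  - rewrite -idom; apply: ge0_le_integral => //.
    + exact/measurable_EFinP.
    + by apply/measurable_EFinP; apply: measurable_sum => k; exact: mE.
    + by move=> x _ /=; rewrite lee_fin; exact: gdom.
rewrite poweR_EFin lee_fin.
have pV : p * p^-1 = 1 by rewrite divff// gt_eqF.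
rewrite powRM ?mulr_ge0 ?invr_ge0// powRM ?mulr_ge0// ler_wpM2r ?powR_ge0//.
rewrite /c' -powRrM pV powRr1 ?mulr_ge0// expr2 mulrA ler_wpM2l ?mulr_ge0//.
rewrite -[leRHS]powRr1//; apply: ler_powR => //.
by rewrite invf_le1.
Qed.

End cells.

(** * Combinations of bumps in a Besov ball *)

Section bump_combinations.
Context {R : realType}.
Implicit Types (N m : nat) (th : nat -> R) (s p x u : R).

Definition comb m N th x : R := \sum_(i < N) th i * polybump m (N%:R * x - i%:R).

Lemma measurable_polybump m : measurable_fun [set: R] (polybump m).
Proof.
apply: measurable_fun_ifT => //.
  by apply: measurable_and; [exact: measurable_fun_ler|exact: measurable_fun_ltr].
apply: measurable_funX; apply: measurable_funM => //; exact: measurable_funB.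
Qed.

Lemma measurable_comb m N th : measurable_fun [set: R] (comb m N th).
Proof.
apply: measurable_sum => i; apply: measurable_funM => //.
apply: (measurableT_comp (measurable_polybump m)).
by apply: measurable_funB => //; exact: measurable_funM.
Qed.

Lemma comb_le_step m N th x : `|comb m N th x| <= step N th x.
Proof.
apply: le_trans (ler_norm_sum _ _ _) _; apply: ler_sum => i _.
by rewrite normrM ler_wpM2l// ger0_norm ?polybump_ge0// polybump_le.
Qed.

Lemma measurable_diff_op m u (f : R -> R) : measurable_fun [set: R] f ->
  measurable_fun [set: R] (diff_op m u f).
Proof.
move=> mf; have aff (c : R) : measurable_fun [set: R] (fun x : R => x + c).
  exact: measurable_funD.
rewrite /diff_op; apply: measurable_fun_ifT => //.
  have aff' (c : R) : measurable_fun [set: R] (fun x : R => x - c).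
    exact: measurable_funB.
  by apply: measurable_and; apply: measurable_and; apply: measurable_fun_ler => //.
apply: measurable_sum => k; apply: measurable_funM => //.
by apply: measurableT_comp => //.
Qed.

Lemma diff_comb_le_step m : (0 < m)%N -> exists2 C : R, 0 <= C &
  forall N th u x, (0 < N)%N -> 0 <= u ->
  `|diff_op m u (comb m N th) x| <= C * Num.min 1 (N%:R * u) ^+ m *
    \sum_(k < m.+1) step N th (x + (k%:R - m%:R / 2) * u).
Proof.
move=> m0; have [C C0 HC] := @polybump_difference_bound R m m0.
exists C => // N th u x N0 u0.
have NR : 0 < N%:R :> R by rewrite ltr0n.
have Nu0 : 0 <= N%:R * u by rewrite mulr_ge0// ltW.
rewrite /diff_op; case: ifP => _; last first.
  rewrite normr0 mulr_ge0//.
    by rewrite mulr_ge0// exprn_ge0// le_min ler01.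
  by apply: sumr_ge0 => k _; exact: step_ge0.
pose c (k : nat) : R := (-1) ^+ (m - k) * 'C(m, k)%:R.
have -> : \sum_(k < m.+1) (-1) ^+ (m - k) * 'C(m, k)%:R *
      comb m N th (x + (k%:R - m%:R / 2) * u) =
    \sum_(i < N) th i * \sum_(k < m.+1) c k *
      polybump m (N%:R * x - i%:R + (k%:R - m%:R / 2) * (N%:R * u)).
  under eq_bigr do rewrite /comb mulr_sumr.
  rewrite exchange_big/=; apply: eq_bigr => i _.
  rewrite mulr_sumr; apply: eq_bigr => k _; rewrite mulrCA; congr (_ * (_ * polybump _ _)).
  ring.
rewrite /step exchange_big/= mulr_sumr; apply: le_trans (ler_norm_sum _ _ _) _.
apply: ler_sum => i _; rewrite -mulr_sumr normrM mulrCA ler_wpM2l//.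
apply: le_trans (HC _ _ Nu0) _; rewrite le_eqVlt; apply/orP; left; apply/eqP.
congr (_ * _); apply: eq_bigr => k _; rewrite /in_cell.
rewrite (_ : N%:R * x - i%:R + _ = N%:R * (x + (k%:R - m%:R / 2) * u) - i%:R)//.
ring.
Qed.

Lemma min_powR_le s m (z : R) : 0 < s -> s <= m%:R -> 0 < z ->
  z `^ (- s) * Num.min 1 z ^+ m <= 1.
Proof.
move=> s0 sm z0; have [z1|z1] := leP 1 z.
  rewrite expr1n mulr1 powRN invf_le1 ?powR_gt0//.
  by rewrite -[leLHS](@powRr0 _ z) ler_powR// ltW.
rewrite -powR_mulrn ?(ltW z0)// -powRD; last by rewrite (gt_eqF z0) implybT.
by rewrite -[leRHS](@powRr0 _ z) ger_powR ?z0 ?(ltW z1)// addrC subr_ge0.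
Qed.

(** At the scale t, differences of order m gain the factor min(1, N t)^m, and
    t^(-s) min(1, N t)^m is at most N^s because s <= m. The amplitude N^(-s)
    compensates this loss. *)
Lemma comb_besov s p Q L : 0 < s -> 1 <= p -> 0 < Q -> 0 < L ->
  exists2 A : R, 0 < A & forall N th, (0 < N)%N ->
  N%:R^-1 * \sum_(i < N) `|th i| `^ p <= Q ->
  besov_ball s p L (comb (Num.truncn s).+1 N (fun i => A * N%:R `^ (- s) * th i)).
Proof.
move=> s0 p1 Q0 L0; set m := (Num.truncn s).+1.
have p0 : 0 < p by rewrite (lt_le_trans _ p1).
have m0 : (0 < m)%N by [].
have sm : s <= m%:R by apply/ltW/truncnS_gt.
have [C C0 HC] := diff_comb_le_step _ m0.
pose D : R := 1 + C * m.+1%:R ^+ 2.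
have D0 : 0 < D by rewrite ltr_pwDl// mulr_ge0// exprn_ge0.
have Qp : 0 < Q `^ p^-1 by rewrite powR_gt0.
pose A := L / (D * Q `^ p^-1).
have A0 : 0 < A by rewrite divr_gt0// mulr_gt0.
exists A => // N th N0 thQ.
have NR : 0 < N%:R :> R by rewrite ltr0n.
have N1 : 1 <= N%:R :> R by rewrite ler1n.
have Ns0 : 0 < N%:R `^ (- s) :> R by rewrite powR_gt0.
pose B := A * N%:R `^ (- s).
have B0 : 0 < B by rewrite mulr_gt0.
pose th' i := B * th i; set f := comb m N _.
pose E : R := (N%:R^-1 * \sum_(i < N) `|th' i| `^ p) `^ p^-1.
have EB : E <= B * Q `^ p^-1.
  rewrite /E (_ : \sum_(i < N) _ = B `^ p * \sum_(i < N) `|th i| `^ p); last first.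
    rewrite mulr_sumr; apply: eq_bigr => i _.
    by rewrite /th' normrM (gtr0_norm B0) powRM// ltW.
  rewrite mulrCA powRM ?powR_ge0//; last first.
    by rewrite mulr_ge0 ?invr_ge0 ?(ltW NR)//; apply: sumr_ge0 => i _; exact: powR_ge0.
  rewrite -powRrM divff ?gt_eqF// powRr1 ?(ltW B0)// ler_wpM2l ?(ltW B0)//.
  apply: ge0_ler_powR; rewrite ?nnegrE ?invr_ge0 ?(ltW p0) ?(ltW Q0)//.
  by rewrite mulr_ge0 ?invr_ge0 ?(ltW NR)//; apply: sumr_ge0 => i _; exact: powR_ge0.
have E0 : 0 <= E by exact: powR_ge0.
have mf : measurable_fun [set: R] f by exact: measurable_comb.
have nf : (norm01 p f <= E%:E)%E.
  have := norm01_step_le N th' p 0 f 1 (fun=> 0) N0 p1 ler01 mf.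
  rewrite expr1n !mul1r; apply => x _.
  by rewrite big_ord_recl big_ord0 addr0 mul1r addr0 comb_le_step.
split.
- exact: measurable_funTS.
- by apply: le_lt_trans nf _; rewrite ltry.
rewrite /besov_norm -/m.
have mod_le t : 0 < t ->
    ((t `^ (- s))%:E * smoothness_modulus m f t p <=
     (N%:R `^ s * (C * m.+1%:R ^+ 2 * E))%:E)%E.
  move=> t0; have Nt : 0 < N%:R * t by rewrite mulr_gt0.
  have min0 (z : R) : 0 <= z -> 0 <= Num.min 1 z ^+ m.
    by move=> z0; rewrite exprn_ge0// le_min ler01.
  apply: (@le_trans _ _ ((t `^ (- s))%:E *
      (C * Num.min 1 (N%:R * t) ^+ m * m.+1%:R ^+ 2 * E)%:E)%E).
    apply: lee_wpmul2l; first by rewrite lee_fin powR_ge0.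
    apply: ge_ereal_sup => _ [u /= /andP[u0 ut] <-].
    apply: le_trans (norm01_step_le N th' p m (diff_op m u f)
      (C * Num.min 1 (N%:R * u) ^+ m) (fun k => (k%:R - m%:R / 2) * u) N0 p1 _ _ _) _.
    + by rewrite mulr_ge0// min0// mulr_ge0// ltW.
    + exact: measurable_diff_op.
    + by move=> x _; apply: HC => //; exact: ltW.
    + rewrite lee_fin ler_wpM2r// ler_wpM2r ?exprn_ge0// ler_wpM2l//.
      rewrite lerXn2r ?nnegrE ?le_min ?ler01 ?mulr_ge0 ?(ltW u0) ?(ltW t0)//.
      by rewrite ge_min lexx/= ge_min ler_pM2l// ut orbT.
  rewrite -EFinM lee_fin.
  have H := min_powR_le s m (N%:R * t) s0 sm Nt.
  rewrite powRM ?(ltW NR) ?(ltW t0)// powRN in H.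
  rewrite [leLHS](_ : _ = N%:R `^ s * (C * m.+1%:R ^+ 2 * E) *
    ((N%:R `^ s)^-1 * t `^ (- s) * Num.min 1 (N%:R * t) ^+ m)); last first.
    by field; rewrite gt_eqF// powR_gt0.
  by rewrite ler_piMr// !mulr_ge0// ?powR_ge0// exprn_ge0.
have Ns1 : 1 <= N%:R `^ s :> R by rewrite -[leLHS](@powRr0 _ N%:R) ler_powR// ltW.
apply: (@le_trans _ _ (E%:E + (N%:R `^ s * (C * m.+1%:R ^+ 2 * E))%:E)%E).
  by apply: leeD => //; apply: ge_ereal_sup => _ [t /= t0 <-]; exact: mod_le.
rewrite -EFinD lee_fin.
apply: (@le_trans _ _ (N%:R `^ s * D * E)).
  rewrite /D [leRHS](_ : _ = N%:R `^ s * E + N%:R `^ s * (C * m.+1%:R ^+ 2 * E)); last by ring.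
  by rewrite lerD2r ler_peMl.
apply: (@le_trans _ _ (N%:R `^ s * D * (B * Q `^ p^-1))).
  by rewrite ler_wpM2l// mulr_ge0 ?powR_ge0// ltW.
rewrite /B /A powRN le_eqVlt; apply/orP; left; apply/eqP.
by field; rewrite !gt_eqF// powR_gt0.
Qed.

End bump_combinations.

(** * Norms and primitives of bump combinations *)

Section bump_integrals.
Context {R : realType}.
Implicit Types (N m : nat) (th : nat -> R).
Local Notation mu := (@lebesgue_measure R).

Definition bump_mass m N (i : nat) : R :=
  fine (\int[mu]_x (polybump m (N%:R * x - i%:R))%:E)%E.

Lemma measurable_cell_bump m N i : measurable_fun [set: R] (fun x => polybump m (N%:R * x - i%:R)).
Proof.
apply: (measurableT_comp (measurable_polybump m)).
by apply: measurable_funB => //; exact: measurable_funM.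
Qed.

Lemma measurable_in_cell0 N i : measurable_fun [set: R] (in_cell N i).
Proof.
rewrite (_ : in_cell N i = (fun x => in_cell N i (x + 0))); first exact: measurable_in_cell.
by apply/funext => x; rewrite addr0.
Qed.

Lemma integral_in_cell0 N i : (0 < N)%N -> (\int[mu]_x (in_cell N i x)%:E = (N%:R^-1)%:E)%E.
Proof.
by move=> N0; rewrite -(integral_in_cell N i 0 N0); apply: eq_integral => x _; rewrite addr0.
Qed.

Lemma integrable_in_cell N i : (0 < N)%N -> mu.-integrable [set: R] (fun x => (in_cell N i x)%:E).
Proof.
move=> N0; apply/integrableP; split; first by apply/measurable_EFinP; exact: measurable_in_cell0.
rewrite [ltLHS](_ : _ = (N%:R^-1)%:E) ?ltry// -(integral_in_cell0 N i N0).
by apply: eq_integral => x _; rewrite gee0_abs// lee_fin.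
Qed.

Lemma integrable_cell_bump m N i : (0 < N)%N ->
  mu.-integrable [set: R] (fun x => (polybump m (N%:R * x - i%:R))%:E).
Proof.
move=> N0; apply: le_integrable (integrable_in_cell N i N0) => //.
  by apply/measurable_EFinP; exact: measurable_cell_bump.
move=> x _; rewrite !gee0_abs ?lee_fin ?polybump_ge0//.
exact: polybump_le.
Qed.

Lemma bump_massE m N i : (0 < N)%N ->
  (\int[mu]_x (polybump m (N%:R * x - i%:R))%:E = (bump_mass m N i)%:E)%E.
Proof.
move=> N0; rewrite fineK//; apply: (integrable_fin_num measurableT).
exact: integrable_cell_bump.
Qed.

Lemma bump_mass_le m N i : (0 < N)%N -> bump_mass m N i <= N%:R^-1.
Proof.
move=> N0; rewrite -lee_fin -bump_massE// -(integral_in_cell0 N i N0).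
apply: ge0_le_integral => //.
- by move=> x _; rewrite lee_fin polybump_ge0.
- by apply/measurable_EFinP; exact: measurable_cell_bump.
- by apply/measurable_EFinP; exact: measurable_in_cell0.
- by move=> x _; rewrite lee_fin polybump_le.
Qed.

(** On the middle half of the cell, t (1 - t) is at least 3 / 16. *)
Lemma bump_mass_ge m N i : (0 < N)%N -> (3 / 16) ^+ m / 2 / N%:R <= bump_mass m N i.
Proof.
move=> N0; have NR : 0 < N%:R :> R by rewrite ltr0n.
pose I := `[(i%:R + 4^-1) / N%:R, (i%:R + 3 / 4) / N%:R[ : interval R.
rewrite -lee_fin -bump_massE//.
apply: (@le_trans _ _ (\int[mu]_x (((3 / 16) ^+ m)%:E * (\1_([set` I] : set R) x)%:E)%E)%E).
  rewrite integralZl//; last first.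
    apply/integrableP; split; first exact/measurable_EFinP.
    rewrite [ltLHS](_ : _ = \int[mu]_x (\1_([set` I] : set R) x)%:E)%E; last first.
      by apply: eq_integral => x _; rewrite gee0_abs// lee_fin.
    rewrite integral_indic//= setIT lebesgue_measure_itv/=; case: ifP => _; exact: ltry.
  rewrite integral_indic//= setIT lebesgue_measure_itv/= lte_fin.
  rewrite ltr_pM2r ?invr_gt0// ifT; last by lra.
  rewrite -EFinB -EFinM lee_fin le_eqVlt; apply/orP; left; apply/eqP.
  by field; rewrite lt0r_neq0.
apply: ge0_le_integral => //.
- by apply/measurable_EFinP; apply: measurable_funM.
- by apply/measurable_EFinP; exact: measurable_cell_bump.
- move=> x _; rewrite -EFinM lee_fin indicE mem_setE/= in_itv/=.
  have [/andP[]|_] := boolP (_ && _); last by rewrite mulr0 polybump_ge0.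
  rewrite ler_pdivrMr// ltr_pdivlMr// mulr1 [x * _]mulrC => x1 x2.
  rewrite /polybump ifT; last by apply/andP; split; lra.
  by rewrite lerXn2r ?nnegrE//; nra.
Qed.

Lemma norm_comb m N th x : `|comb m N th x| =
  \sum_(i < N) `|th i| * polybump m (N%:R * x - i%:R).
Proof.
have [/existsP[i0 ci0]|/existsPn noc] := boolP [exists i : 'I_N, 0 <= N%:R * x - i%:R < 1].
  have others (i : 'I_N) : i != i0 -> polybump m (N%:R * x - i%:R) = 0.
    move=> ii0; rewrite /polybump; case: ifP => // ci; case/eqP: ii0; apply: val_inj.
    exact: (in_cell_unique _ _ _ _ ci ci0).
  rewrite /comb (bigD1 i0)//= [RHS](bigD1 i0)//= !big1.
  - by rewrite !addr0 normrM (ger0_norm (polybump_ge0 _ _)).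
  - by move=> i /others ->; rewrite mulr0.
  - by move=> i /others ->; rewrite mulr0.
have c0 (i : 'I_N) : polybump m (N%:R * x - i%:R) = 0 by rewrite /polybump (negbTE (noc i)).
by rewrite /comb !big1 ?normr0// => i _; rewrite c0 mulr0.
Qed.

(** The bumps have disjoint supports inside [0, 1], so the norm is additive in the
    absolute values of the heights: on this family the functional to be estimated
    is a sum of the nonsmooth |th i|. *)
Lemma norm01_comb m N th : (0 < N)%N ->
  norm01 1 (comb m N th) = (\sum_(i < N) `|th i| * bump_mass m N i)%:E.
Proof.
move=> N0; have NR : 0 < N%:R :> R by rewrite ltr0n.
rewrite /norm01 Lnorm1.
transitivity (\int[mu]_x (\sum_(i < N) (`|th i|%:E * (polybump m (N%:R * x - i%:R))%:E)))%E.
  apply: eq_integral => x _; rewrite /= patchE.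
  have -> : (if x \in `[0, 1]%classic then comb m N th x else 0) = comb m N th x.
    case: ifPn => //; rewrite mem_setE/= in_itv/= => xN.
    rewrite /comb big1// => i _; rewrite /polybump ifF ?mulr0//.
    apply/negbTE; apply: contra xN => /andP[x0 x1].
    have iN : i%:R + 1 <= N%:R :> R by rewrite natr1 ler_nat.
    have i0 : 0 <= i%:R :> R by [].
    apply/andP; split.
      by rewrite -(@pmulr_rge0 _ N%:R)//; lra.
    by rewrite -(@ler_pM2l _ N%:R)// mulr1; lra.
  by rewrite norm_comb -sumEFin.
rewrite ge0_integral_sum//; last 2 first.
- move=> i; apply: emeasurable_funM => //; apply/measurable_EFinP.
  exact: measurable_cell_bump.
- by move=> i x _; rewrite -EFinM lee_fin mulr_ge0// polybump_ge0.
rewrite -sumEFin; apply: eq_bigr => i _; rewrite integralZl//; last exact: integrable_cell_bump.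
by rewrite bump_massE.
Qed.

Definition primitive (f : R -> R) (t : R) : R := \int[mu]_(x in `[0, t]) f x.

Lemma primitive0 (f : R -> R) : primitive f 0 = 0.
Proof. by rewrite /primitive set_itv1 Rintegral_set1. Qed.

Lemma primitive_comb m N th (t : R) : (0 < N)%N ->
  primitive (comb m N th) t =
  \sum_(i < N) th i * primitive (fun x => polybump m (N%:R * x - i%:R)) t.
Proof.
move=> N0; rewrite /primitive /Rintegral.
have ib i : mu.-integrable `[0, t] (fun x => (polybump m (N%:R * x - i%:R))%:E).
  by apply: integrableS (integrable_cell_bump m N i N0).
transitivity (fine (\int[mu]_(x in `[0%R, t]) (\sum_(i < N) ((th i)%:E * (polybump m (N%:R * x - i%:R))%:E)))%E).
  by congr fine; apply: eq_integral => x _; rewrite /comb -sumEFin.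
rewrite integral_sum//; last by move=> i; apply: integrableZl => //; exact: ib.
rewrite -[RHS]/(fine (_)%:E) -sumEFin; congr fine; apply: eq_bigr => i _.
rewrite integralZl//.
rewrite EFinM fineK//; apply: integrable_fin_num => //; exact: ib.
Qed.

Lemma primitiveB (f : R -> R) (t t' : R) : mu.-integrable [set: R] (EFin \o f) ->
  0 <= t -> t <= t' -> primitive f t' - primitive f t = \int[mu]_(x in `]t, t']) f x.
Proof.
move=> fi t0 tt'; rewrite /primitive Rintegral_itvB//.
by apply: integrableS fi.
Qed.

Lemma primitive_in_cell N i (t t' : R) : (0 < N)%N -> 0 <= t -> t <= t' ->
  0 <= primitive (in_cell N i) t' - primitive (in_cell N i) t <= t' - t.
Proof.
move=> N0 t0 tt'; have ic := integrable_in_cell N i N0.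
rewrite primitiveB//; apply/andP; split; first exact: Rintegral_ge0.
apply: (@le_trans _ _ (\int[mu]_(x in `]t, t']) 1)).
  apply: le_Rintegral => //.
  - by apply: integrableS ic.
  - apply/integrableP; split; first exact: measurable_cst.
    under eq_integral do rewrite /= normr1.
    by rewrite integral_cst//= lebesgue_measure_itv/=; case: ifP => _; rewrite ?mule0 ?mul1e ?ltry.
  - by move=> x _; rewrite /in_cell; case: (0 <= _ < 1).
rewrite Rintegral_cst// mul1r/= lebesgue_measure_itv/=; case: ifP => //= _; lra.
Qed.

Lemma primitive_in_cell_le N i : (0 < N)%N ->
  primitive (in_cell N i) 1 - primitive (in_cell N i) 0 <= N%:R^-1.
Proof.
move=> N0; have ic := integrable_in_cell N i N0.
rewrite primitive0 subr0 /primitive /Rintegral -[leRHS]/(fine (N%:R^-1)%:E).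
rewrite -(integral_in_cell0 N i N0) fine_le//.
- by apply: integrable_fin_num => //; apply: integrableS ic.
- by rewrite integral_in_cell0.
- apply: ge0_subset_integral => //; first by apply/measurable_EFinP; exact: measurable_in_cell0.
  by move=> x _; rewrite lee_fin.
Qed.

(** The primitive of the indicator of a cell serves as the clock along which
    [white_noise_bound] measures the bump of this cell. *)
Lemma primitive_bump_le m N i (t t' : R) : (0 < N)%N -> 0 <= t -> t <= t' ->
  `|primitive (fun x => polybump m (N%:R * x - i%:R)) t' -
    primitive (fun x => polybump m (N%:R * x - i%:R)) t| <=
  primitive (in_cell N i) t' - primitive (in_cell N i) t.
Proof.
move=> N0 t0 tt'; have ic := integrable_in_cell N i N0.
have ib := integrable_cell_bump m N i N0.
rewrite !primitiveB// ger0_norm; last by apply: Rintegral_ge0 => x _; exact: polybump_ge0.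
apply: le_Rintegral => //.
- by apply: integrableS ib.
- by apply: integrableS ic.
- by move=> x _; exact: polybump_le.
Qed.

End bump_integrals.

(** * From two priors to a lower bound on the risk *)

(** Chebyshev's inequality, centred at the target v instead of the mean of X. *)
Lemma chebyshev_risk {d : measure_display} {T : measurableType d} {R : realType}
    (P : probability T R) (X : T -> R) (v eta r : R) (D : set T) :
  measurable_fun [set: T] X -> measurable D -> 0 < eta ->
  ('E_P[fun w => ((X w - v) ^+ 2)%R] <= r%:E)%E ->
  (forall w, D w -> eta <= `|X w - v|) -> fine (P D) <= r / eta ^+ 2.
Proof.
move=> mX mD eta0 Er DX; rewrite ler_pdivlMr ?exprn_gt0// -lee_fin.
apply: le_trans Er; rewrite unlock.
have -> : (fine (P D) * eta ^+ 2)%:E = (\int[P]_w ((eta ^+ 2)%:E * (\1_D w)%:E))%E.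
  rewrite ge0_integralZl//; last 2 first.
  - exact/measurable_EFinP.
  - by rewrite lee_fin sqr_ge0.
  rewrite integral_indic// setIT muleC EFinM fineK//; exact: fin_num_measure.
apply: ge0_le_integral => //.
- by move=> w _; rewrite -EFinM lee_fin mulr_ge0// sqr_ge0.
- by apply: emeasurable_funM => //; exact/measurable_EFinP.
- by apply/measurable_EFinP; apply: measurable_funX; exact: measurable_funB.
move=> w _; rewrite -EFinM lee_fin indicE; have [/set_mem Dw|_] := boolP (w \in D).
  rewrite mulr1 -[leRHS]real_normK ?num_real// lerXn2r ?nnegrE ?(ltW eta0)//.
  exact: DX.
by rewrite mulr0 sqr_ge0.
Qed.

Section two_priors.
Context {d : measure_display} {T : measurableType d} {R : realType}.
Variables (P : probability T R) (B : R -> T -> R).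
Hypothesis bm : brownian_motion01 P B.
Variables (sigma : R) (n m N K : nat) (beta p Q c delta : R).
Hypotheses (sigma0 : 0 < sigma) (n0 : (0 < n)%N) (N0 : (0 < N)%N).
Hypotheses (beta0 : 0 < beta) (Q0 : 0 < Q) (c0 : 0 < c) (delta0 : 0 <= delta).
Variables (I : finType) (x mu1 mu0 : I -> R) (F : set (R -> R)).
Hypotheses (mu1_ge0 : forall i, 0 <= mu1 i) (mu1_1 : \sum_i mu1 i = 1).
Hypotheses (mu0_ge0 : forall i, 0 <= mu0 i) (mu0_1 : \sum_i mu0 i = 1).
Hypothesis x1 : forall i, `|x i| <= 1.

Let phi i : R := `|K%:R * x i|.
Let f (th : nat -> I) : R -> R := comb m N (fun i => beta * (K%:R * x (th i))).
Let gamma : R := c * ((3 / 16) ^+ m / 2).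

Hypothesis fF : forall th : nat -> I, N%:R^-1 * \sum_(i < N) phi (th i) `^ p <= Q -> F (f th).
Hypothesis mu1_p : \sum_i mu1 i * phi i `^ p <= Q / 8.
Hypothesis mu0_p : \sum_i mu0 i * phi i `^ p <= Q / 8.
Hypothesis gap : c <= \sum_i (mu1 i - mu0 i) * phi i.
(* Under either prior the normalized norm V has variance at most K^2 / N; with the
   factor 128, Chebyshev's inequality bounds by 1 / 8 the probability that V is
   more than gamma / 4 away from its mean. *)
Hypothesis varN : 128 * K%:R ^+ 2 <= N%:R * gamma ^+ 2.
Hypothesis deltaN : N%:R * delta <= 4^-1.
Hypothesis Hdelta : forall z,
  0 <= z <= (beta * K%:R) ^+ 2 * N%:R^-1 / (sigma / Num.sqrt n%:R) ^+ 2 ->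
  \sum_i \sum_j (mu1 i - mu0 i) * (mu1 j - mu0 j) * expR (x i * x j * z) <= delta ^+ 2.

Let kap i : R := bump_mass m N i.
Let V (th : nat -> I) : R := \sum_(i < N) phi (th i) * kap i.
Let mean (mu : I -> R) : R := \sum_(i < N) (\sum_a mu a * phi a) * kap i.

Let NR : 0 < N%:R :> R. Proof. by rewrite ltr0n. Qed.
Let nR : 0 < n%:R :> R. Proof. by rewrite ltr0n. Qed.
Let gamma0 : 0 < gamma. Proof. by rewrite mulr_gt0// divr_gt0// exprn_gt0. Qed.
Let phi_ge0 i : 0 <= phi i. Proof. exact: normr_ge0. Qed.
Let phi_le i : phi i <= K%:R.
Proof. by rewrite /phi normrM normr_nat ler_piMr. Qed.
Let kap_ge0 i : 0 <= kap i.
Proof. by apply: le_trans (bump_mass_ge m N i N0); rewrite !divr_ge0// exprn_ge0. Qed.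
Let kap_le i : kap i <= N%:R^-1. Proof. exact: bump_mass_le. Qed.

Let norm_f th : fine (norm01 1 (f th)) = beta * V th.
Proof.
rewrite norm01_comb//= /V mulr_sumr; apply: eq_bigr => i _.
by rewrite normrM (gtr0_norm beta0) -mulrA.
Qed.

Let mean_gap : gamma <= mean mu1 - mean mu0.
Proof.
rewrite /mean -sumrB; under eq_bigr do rewrite -mulrBl -sumrB.
rewrite (eq_bigr (fun i : 'I_N => (\sum_i (mu1 i - mu0 i) * phi i) * kap i)); last first.
  by move=> i _; congr (_ * _); apply: eq_bigr => a _; rewrite mulrBl.
have h0 : 0 <= (3 / 16) ^+ m / 2 :> R by rewrite divr_ge0// exprn_ge0// divr_ge0.
rewrite -mulr_sumr /gamma; apply: (ler_pM (ltW c0) h0) => //.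
apply: (@le_trans _ _ (\sum_(i < N) (3 / 16) ^+ m / 2 / N%:R)).
  by rewrite sumr_const card_ord -[_ *+ N]mulr_natr divfK// lt0r_neq0.
by apply: ler_sum => i _; exact: bump_mass_ge.
Qed.

(** A sum of two indicators, so that a value below 1 excludes both failures: that f
    leaves the class, and that V is far from its mean. *)
Let bad (mu : I -> R) (th : nat -> I) : R :=
  ((Q < N%:R^-1 * \sum_(i < N) phi (th i) `^ p)%R : nat)%:R +
  (((gamma / 4) ^+ 2 < (V th - mean mu) ^+ 2)%R : nat)%:R.

Let bad_ge0 mu th : 0 <= bad mu th. Proof. by rewrite addr_ge0. Qed.

Let bad_le (mu : I -> R) (th0 : nat -> I) : (forall i, 0 <= mu i) -> \sum_i mu i = 1 ->
  \sum_i mu i * phi i `^ p <= Q / 8 -> expect mu N (bad mu) th0 <= 4^-1.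
Proof.
move=> mu_ge0 mu_1 mu_p.
have pp (th : nat -> I) : 0 <= N%:R^-1 * \sum_(i < N) phi (th i) `^ p.
  by rewrite mulr_ge0 ?invr_ge0 ?(ltW NR)//; apply: sumr_ge0 => i _; exact: powR_ge0.
have b1 : expect mu N (fun th : nat -> I => ((Q < N%:R^-1 * \sum_(i < N) phi (th i) `^ p)%R : nat)%:R) th0 <= 8^-1.
  apply: le_trans (expect_markov mu mu_ge0 mu_1 N _ th0 Q pp Q0) _.
  rewrite ler_pdivrMr//.
  rewrite (eq_expect mu N _ (fun th => \sum_(i < N) N%:R^-1 * phi (th i) `^ p)); last first.
    by move=> th; rewrite mulr_sumr.
  rewrite (expect_sum mu mu_1 N (fun _ a => N%:R^-1 * phi a `^ p)).
  under eq_bigr do under eq_bigr do rewrite mulrCA.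
  under eq_bigr do rewrite -mulr_sumr.
  rewrite sumr_const card_ord -[_ *+ N]mulr_natl mulrA divff ?lt0r_neq0// mul1r.
  by rewrite [leRHS]mulrC.
have b2 : expect mu N (fun th : nat -> I => (((gamma / 4) ^+ 2 < (V th - mean mu) ^+ 2)%R : nat)%:R) th0 <= 8^-1.
  have g4 : 0 < (gamma / 4) ^+ 2 by rewrite exprn_gt0// divr_gt0.
  have sq (th : nat -> I) : 0 <= (V th - mean mu) ^+ 2 by exact: sqr_ge0.
  apply: le_trans (expect_markov mu mu_ge0 mu_1 N _ th0 _ sq g4) _.
  rewrite ler_pdivrMr//.
  pose e := \sum_a mu a * phi a.
  rewrite (eq_expect mu N _ (fun th => (\sum_(i < N) (phi (th i) - e) * kap i) ^+ 2)); last first.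
    by move=> th; rewrite /V /mean -sumrB; congr (_ ^+ 2); apply: eq_bigr => i _; rewrite -mulrBl.
  rewrite (expect_sqr_sum mu mu_1 N (fun i a => (phi a - e) * kap i)); last first.
    move=> i; under eq_bigr do rewrite mulrA mulrBr.
    by rewrite -mulr_suml sumrB -mulr_suml mu_1 mul1r subrr mul0r.
  have e0 : 0 <= e by apply: sumr_ge0 => a _; rewrite mulr_ge0.
  have eK : e <= K%:R.
    rewrite -[leRHS]mul1r -[X in _ <= X * _]mu_1 mulr_suml; apply: ler_sum => a _.
    by rewrite ler_wpM2l.
  apply: (@le_trans _ _ (\sum_(i < N) K%:R ^+ 2 * (N%:R^-1) ^+ 2)).
    apply: ler_sum => i _; rewrite -[leRHS]mul1r -[X in _ <= X * _]mu_1 mulr_suml; apply: ler_sum => a _.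
    rewrite ler_wpM2l// exprMn; apply: ler_pM; rewrite ?sqr_ge0//.
      have pa := phi_ge0 a; have pl := phi_le a.
      by rewrite -[leLHS]real_normK ?num_real// lerXn2r ?nnegrE// ler_norml; apply/andP; split; lra.
    by rewrite lerXn2r ?nnegrE// invr_ge0 ltW.
  rewrite sumr_const card_ord -[_ *+ N]mulr_natr.
  rewrite [leLHS](_ : _ = K%:R ^+ 2 / N%:R); last by field; rewrite lt0r_neq0.
  rewrite ler_pdivrMr//.
  move: varN; set k2 := K%:R ^+ 2; move=> h.
  rewrite [leRHS](_ : _ = (N%:R * gamma ^+ 2) / 128); last by field.
  by rewrite ler_pdivlMr// mulrC.
rewrite (eq_expect mu N _ (fun th => 1 * ((Q < N%:R^-1 * \sum_(i < N) phi (th i) `^ p)%R : nat)%:R +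
  (((gamma / 4) ^+ 2 < (V th - mean mu) ^+ 2)%R : nat)%:R)); last by move=> th; rewrite mul1r.
rewrite expectZD mul1r; lra.
Qed.

Variable That : observation_space R -> R.
Hypothesis mThat : measurable_fun [set: observation_space R] That.

Let eps : R := sigma / Num.sqrt n%:R.
Let eps0 : 0 < eps. Proof. by rewrite divr_gt0// sqrtr_gt0. Qed.

Let mid : R := beta * ((mean mu1 + mean mu0) / 2).
Let E : set (observation_space R) := [set y | mid <= That y].

Let mE : measurable E.
Proof.
rewrite (_ : E = That @^-1` `[mid, +oo[%classic).
  by rewrite -[X in measurable X]setTI; exact: mThat.
by apply/seteqP; split => y /=; rewrite /E/= in_itv/= andbT.
Qed.

Let hit (th : nat -> I) : R := fine (P [set w | E (observation B sigma n (f th) w)]).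

Let observationE (th : nat -> I) i a : (i < N)%N ->
  observation B sigma n (f (update th i a)) =
  shifted_noise B
    (fun t => \sum_(j < N | j != i :> nat) beta * (K%:R * x (th j)) *
       primitive (fun y => polybump m (N%:R * y - j%:R)) t)
    (fun t => beta * K%:R * primitive (fun y => polybump m (N%:R * y - i%:R)) t) eps (x a).
Proof.
move=> iN; apply/funext => w; apply/funext => t; rewrite /observation /shifted_noise; congr (_ + _).
rewrite -/(primitive _ _) /f primitive_comb// (bigD1 (Ordinal iN))//= addrC; congr (_ + _).
  by apply: eq_bigr => j ji; rewrite /update ifN.
by rewrite /update eqxx; ring.
Qed.

(** Given the other coordinates, coordinate i is the amplitude of one bump added to
    a known signal. *)
Let hit_swap th i : (i < N)%N ->
  `|\sum_a (mu1 a - mu0 a) * hit (update th i a)| <= delta.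
Proof.
move=> iN; under eq_bigr do rewrite /hit observationE//.
apply: (white_noise_bound P B bm _ _ (primitive (in_cell N i)) eps (beta * K%:R) N%:R^-1) => //.
- by rewrite primitive0 mulr0.
- by rewrite mulr_ge0// ltW.
- by move=> t t' t0 tt' _; exact: primitive_in_cell.
- move=> t t' t0 tt' _; rewrite -mulrBr normrM (ger0_norm (mulr_ge0 (ltW beta0) (ler0n _ _))).
  by rewrite ler_wpM2l ?mulr_ge0 ?(ltW beta0)//; exact: primitive_bump_le.
- exact: primitive_in_cell_le.
Qed.

Let measurable_estimate (g : R -> R) :
  measurable_fun [set: T] (fun w => That (observation B sigma n g w)).
Proof.
apply: (measurableT_comp mThat).
rewrite (_ : observation B sigma n g = shifted_noise B (primitive g) (fun=> 0) eps 0).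
  exact: (measurable_shifted_noise P B bm).
by apply/funext => w; apply/funext => t; rewrite /observation /shifted_noise mul0r addr0.
Qed.

Let hit_measurable th : measurable [set w | E (observation B sigma n (f th) w)].
Proof.
rewrite (_ : [set w | _] = (fun w => That (observation B sigma n (f th) w)) @^-1` `[mid, +oo[%classic).
  by rewrite -[X in measurable X]setTI; exact: measurable_estimate.
by apply/seteqP; split => w /=; rewrite /E/= in_itv/= andbT.
Qed.

Let hit01 th : 0 <= hit th <= 1.
Proof.
apply/andP; split; first exact: fine_ge0.
by rewrite -lee_fin fineK ?fin_num_measure// probability_le1.
Qed.

Let typical mu th : bad mu th < 1 -> F (f th) /\ `|V th - mean mu| <= gamma / 4.
Proof.
rewrite /bad; have [_|b1] := ltP Q; first by rewrite ltNge lerDl ler0n.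
have [_|b2] := ltP ((gamma / 4) ^+ 2); first by rewrite /= add0r ltxx.
move=> _; split; first exact: fF.
rewrite -(@ler_pXn2r _ 2)// ?nnegrE ?divr_ge0 ?(ltW gamma0)//.
by rewrite real_normK ?num_real.
Qed.

(** Under the two priors the norm concentrates around two values at distance
    beta * gamma or more. An estimator of smaller risk would tell them apart by
    comparison with the midpoint: at typical parameters this test errs with
    probability at most 1 / 16, and atypical ones have probability at most 1 / 4,
    so the probabilities that it answers for the upper value under the two priors
    would differ by at least 11 / 16 - 5 / 16 = 3 / 8. Exchanging the laws of the
    N coordinates changes this probability by at most N delta <= 1 / 4. *)
Lemma two_priors_risk : (((beta * gamma / 16) ^+ 2)%:E <=
  ereal_sup [set L1_risk P B sigma n That g | g in F])%E.
Proof.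
rewrite leNgt; apply/negP => small.
have bg0 : 0 < beta * gamma by rewrite mulr_gt0.
have eta0 : 0 < beta * gamma / 4 by rewrite divr_gt0.
have far th (D : set T) : F (f th) -> measurable D ->
    (forall w, D w -> beta * gamma / 4 <= `|That (observation B sigma n (f th) w) - beta * V th|) ->
    fine (P D) <= 16^-1.
  move=> Fth mD DX.
  (* Chebyshev at distance beta * gamma / 4 with risk (beta * gamma / 16)^2 *)
  have -> : 16^-1 = (beta * gamma / 16) ^+ 2 / (beta * gamma / 4) ^+ 2.
    by field; rewrite !lt0r_neq0.
  apply: (chebyshev_risk P _ _ _ _ _ (measurable_estimate (f th)) mD eta0 _ DX).
  apply: le_trans (ltW small); apply: le_ereal_sup_tmp.
  exists (L1_risk P B sigma n That (f th)); first by exists (f th).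
  by rewrite /L1_risk norm_f.
have hit1 th : 15 / 16 - bad mu1 th <= hit th.
  have /andP[h0 h1] := hit01 th.
  have [b1|/typical[Fth Vth]] := leP 1 (bad mu1 th); first by lra.
  suff : fine (P (~` [set w | E (observation B sigma n (f th) w)])) <= 16^-1.
    rewrite probability_setC// fineB ?fin_num_measure// -/(hit th).
    by have := bad_ge0 mu1 th; rewrite /=; lra.
  apply: (far th) => //; first exact: measurableC.
  move=> w /negP; rewrite -ltNge => hw; rewrite distrC.
  have : mid <= beta * (mean mu1 - gamma / 2).
    by rewrite /mid ler_wpM2l ?(ltW beta0)//; have := mean_gap; lra.
  move: Vth; rewrite ler_norml => /andP[V1 V2] hm.
  have : beta * (mean mu1 - gamma / 4) <= beta * V th by rewrite ler_wpM2l ?(ltW beta0)//; lra.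
  move=> hV; apply: le_trans (ler_norm _).
  have -> : beta * gamma / 4 = beta * (mean mu1 - gamma / 4) - beta * (mean mu1 - gamma / 2) by field.
  lra.
have hit0 th : hit th <= 1 * bad mu0 th + 16^-1.
  have /andP[h0 h1] := hit01 th.
  have [b1|/typical[Fth Vth]] := leP 1 (bad mu0 th); first by lra.
  apply: (@le_trans _ _ 16^-1); last by rewrite lerDr mul1r.
  apply: (far th) => // w hw.
  have : beta * (mean mu0 + gamma / 2) <= mid.
    by rewrite /mid ler_wpM2l ?(ltW beta0)//; have := mean_gap; lra.
  move: Vth hw; rewrite /E/= ler_norml => /andP[V1 V2] hw hm.
  have : beta * V th <= beta * (mean mu0 + gamma / 4) by rewrite ler_wpM2l ?(ltW beta0)//; lra.
  move=> hV; apply: le_trans (ler_norm _).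
  have -> : beta * gamma / 4 = beta * (mean mu0 + gamma / 2) - beta * (mean mu0 + gamma / 4) by field.
  lra.
have [i0 _] : exists i0 : I, True.
  apply: contrapT => noI; have noI' (i : I) : False by apply: noI; exists i.
  have : \sum_i mu1 i = 0 by apply: big1 => i; case: (noI' i).
  by rewrite mu1_1 => /eqP; rewrite oner_eq0.
pose th0 : nat -> I := fun=> i0.
have e1 : 15 / 16 - 4^-1 <= expect mu1 N hit th0.
  apply: (@le_trans _ _ (-1 * expect mu1 N (bad mu1) th0 + 15 / 16)).
    by have := bad_le mu1 th0 mu1_ge0 mu1_1 mu1_p; lra.
  rewrite -[X in _ + X <= _](expect_cst mu1 mu1_1 N _ th0) -expectZD.
  apply: le_expect => // th; have := hit1 th; lra.
have e0 : expect mu0 N hit th0 <= 4^-1 + 16^-1.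
  apply: (@le_trans _ _ (1 * expect mu0 N (bad mu0) th0 + 16^-1)).
    rewrite -[X in _ <= _ + X](expect_cst mu0 mu0_1 N _ th0) -expectZD.
    exact: le_expect.
  by have := bad_le mu0 th0 mu0_ge0 mu0_1 mu0_p; lra.
have := expect_telescope mu1 mu0 N hit th0 delta mu1_ge0 mu1_1 mu0_ge0 mu0_1
  (fun i th iN => hit_swap th i iN).
rewrite ler_norml => /andP[_ upper].
have := le_trans (lerB e1 e0) (le_trans upper deltaN).
by apply/negP; rewrite -ltNge; lra.
Qed.

End two_priors.

(** * Choice of the scales *)

Section rates.
Context {R : realType}.

Lemma ln_le_self (y : R) : 0 < y -> ln y <= y.
Proof.
move=> y0; have := expR_ge1Dx (ln y); rewrite lnK ?posrE//; lra.
Qed.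

Lemma ln_le_powR (y e : R) : 0 < y -> 0 < e -> ln y <= y `^ e / e.
Proof.
by move=> y0 e0; rewrite ler_pdivlMr// mulrC -ln_powR ln_le_self// powR_gt0.
Qed.

Lemma truncnS_bounds (y : R) : 0 <= y ->
  y <= (Num.truncn y).+1%:R <= y + 1.
Proof.
move=> y0; have /andP[t1 t2] := truncn_itv y0.
by rewrite (ltW t2)/= -natr1 lerD2r.
Qed.

(** N grows like a power of n and K like ln n. The inequality
    ln n <= (4 / a) n^(a / 4) gives K^2 <= (64 / a^2) n^(a / 2), and
    2^13 = 128 * 64. *)
Lemma log_sqr_le_cells (n a g b N K : R) : 0 < a -> 0 < g -> 1 <= b -> 1 <= n ->
  1 <= ln n -> 0 <= K -> K <= 2 * ln n ->
  (2 ^+ 13 / (a ^+ 2 * g ^+ 2)) `^ (2 / a) <= n ->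
  (b * (n * ln n)) `^ a <= N -> 128 * K ^+ 2 <= N * g ^+ 2.
Proof.
move=> a0 g0 b1 n1 l1 K0 Kl.
set D := 2 ^+ 13 / _ => Dn wN.
have n0 : 0 < n by rewrite (lt_le_trans _ n1).
have ag0 : 0 < a ^+ 2 * g ^+ 2 by rewrite mulr_gt0 ?exprn_gt0.
have D0 : 0 < D by rewrite divr_gt0// exprn_gt0.
pose u := n `^ (a / 4).
have u0 : 0 < u by rewrite powR_gt0.
have lu : ln n <= u / (a / 4) by apply: ln_le_powR => //; rewrite divr_gt0.
have u2 : n `^ (a / 2) = u ^+ 2.
  rewrite -powR_mulrn ?ltW// -powRrM; congr (_ `^ _).
  by field.
have u4 : n `^ a = u ^+ 2 * u ^+ 2.
  rewrite -u2 -powRD; last by rewrite (gt_eqF n0) implybT.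
  by congr (_ `^ _); field.
have Du : D <= u ^+ 2.
  rewrite -u2; have -> : D = (D `^ (2 / a)) `^ (a / 2).
    rewrite -powRrM (_ : 2 / a * (a / 2) = 1) ?powRr1 ?ltW//.
    by field; rewrite gt_eqF.
  by apply: ge0_ler_powR => //; rewrite ?nnegrE ?powR_ge0 ?divr_ge0// ltW.
have nN : u ^+ 2 * u ^+ 2 <= N.
  rewrite -u4; apply: le_trans wN.
  have nw : n <= b * (n * ln n) by rewrite mulrCA; apply: ler_peMr; [exact: ltW|exact: mulr_ege1].
  apply: ge0_ler_powR nw; rewrite ?nnegrE; try exact: ltW.
  by rewrite !mulr_ge0 ?ltW ?(lt_le_trans ltr01).
have Ku : K <= 8 * u / a.
  apply: le_trans Kl _; apply: le_trans (ler_wpM2l _ lu) _ => //.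
  by rewrite le_eqVlt; apply/orP; left; apply/eqP; field; rewrite gt_eqF.
have K2 : K ^+ 2 <= (8 * u / a) ^+ 2 by rewrite ler_sqr ?nnegrE// (le_trans K0).
have H : D * u ^+ 2 * g ^+ 2 <= N * g ^+ 2.
  rewrite ler_wpM2r ?sqr_ge0//; apply: le_trans nN.
  by rewrite ler_wpM2r ?sqr_ge0.
apply: le_trans H; apply: le_trans (ler_wpM2l _ K2) _ => //.
rewrite le_eqVlt; apply/orP; left; apply/eqP; rewrite /D.
by field; rewrite !gt_eqF.
Qed.

(** The number of cells is O(n^2), and exp (- 4 K) <= n^(-4) because K >= ln n. *)
Lemma cells_swap_cost (n a b N K : R) : 0 < a -> a <= 1 -> 1 <= b -> 1 <= n ->
  1 <= ln n -> ln n <= K -> 8 * (2 + b) <= n ->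
  N <= (b * (n * ln n)) `^ a + 1 -> N * (2 * expR (- (4 * K))) <= 4^-1.
Proof.
move=> a0 a1 b1 n1 l1 lK bn Nw.
have n0 : 0 < n by rewrite (lt_le_trans _ n1).
have b0 : 0 < b by rewrite (lt_le_trans _ b1).
have NB : N <= b * n ^+ 2 + 1.
  apply: le_trans Nw _; rewrite lerD2r.
  apply: (@le_trans _ _ ((b * (n * ln n)) `^ 1)).
    by apply: ler_powR => //; rewrite mulr_ege1// mulr_ege1.
  rewrite powRr1; last by rewrite !mulr_ge0 ?(ltW b0) ?(ltW n0)// (le_trans _ l1).
  by rewrite expr2 !ler_pM2l// ln_le_self.
have E : expR (- (4 * K)) <= (n ^+ 4)^-1.
  rewrite expRN lef_pV2 ?posrE ?expR_gt0 ?exprn_gt0//.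
  have -> : n ^+ 4 = expR (4 * ln n) by rewrite expRM_natl lnK ?posrE.
  by rewrite ler_expR ler_pM2l.
have NB0 : 0 <= b * n ^+ 2 + 1 by rewrite addr_ge0// mulr_ge0 ?sqr_ge0 ?ltW.
apply: le_trans (ler_wpM2r _ NB) _; first by rewrite mulr_ge0 ?expR_ge0.
apply: le_trans (ler_wpM2l NB0 (ler_wpM2l _ E)) _ => //.
rewrite mulrA ler_pdivrMr ?exprn_gt0//.
have n2 : 1 <= n ^+ 2 by rewrite exprn_ege1.
have h1 : b * n ^+ 2 + 1 <= (2 + b) * n ^+ 2 by nra.
have h2 : (2 + b) * 8 <= n ^+ 2 by nra.
have h3 : (2 + b) * 8 * n ^+ 2 <= n ^+ 2 * n ^+ 2 by rewrite ler_wpM2r// sqr_ge0.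
have -> : n ^+ 4 = n ^+ 2 * n ^+ 2 by rewrite -exprD.
lra.
Qed.

(** The left-hand side is the squared signal-to-noise ratio of one cell, of order
    K^2 n / N^(2 s + 1). It may be as large as a small multiple of K, since the
    first K moments are matched; hence N^(2 s + 1) is taken of order n ln n, with
    the additional logarithm that appears in the rate. *)
Lemma signal_to_noise (n A sigma s b N K : R) : 0 < A -> 0 < sigma -> 0 < s ->
  1 <= n -> 1 <= ln n -> 0 < N -> 0 < K -> K <= 2 * ln n ->
  2 * A ^+ 2 * expR 9 / sigma ^+ 2 <= b ->
  (b * (n * ln n)) `^ (2 * s + 1)^-1 <= N ->
  (A * N `^ (- s) * K) ^+ 2 * N^-1 / (sigma / Num.sqrt n) ^+ 2 <= K * expR (- 9).
Proof.
move=> A0 sigma0 s0 n1 l1 N0 K0 Kl Ab wN.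
have n0 : 0 < n by rewrite (lt_le_trans _ n1).
have l0 : 0 < ln n by rewrite (lt_le_trans _ l1).
have s21 : 0 < 2 * s + 1 by rewrite ltr_wpDl// mulr_ge0// ltW.
have b0 : 0 < b.
  by apply: lt_le_trans Ab; rewrite divr_gt0 ?exprn_gt0// mulr_gt0 ?expR_gt0// mulr_gt0// exprn_gt0.
have w0 : 0 < b * (n * ln n) by rewrite !mulr_gt0.
have M0 : 0 < N `^ (2 * s + 1) by rewrite powR_gt0.
have wM : b * (n * ln n) <= N `^ (2 * s + 1).
  have -> : b * (n * ln n) = ((b * (n * ln n)) `^ (2 * s + 1)^-1) `^ (2 * s + 1).
    by rewrite -powRrM mulVf ?gt_eqF// powRr1 ?ltW.
  by apply: ge0_ler_powR => //; rewrite ?nnegrE ?powR_ge0// ltW.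
have -> : (A * N `^ (- s) * K) ^+ 2 * N^-1 / (sigma / Num.sqrt n) ^+ 2 =
    A ^+ 2 * K ^+ 2 * n / sigma ^+ 2 / N `^ (2 * s + 1).
  have NE : N `^ (2 * s + 1) = N `^ s ^+ 2 * N.
    rewrite powRD; last by rewrite (gt_eqF N0) implybT.
    rewrite powRr1; last exact: ltW.
    congr (_ * _).
    by rewrite mulrC powRrM powR_mulrn// powR_ge0.
  rewrite NE powRN exprMn (expr_div_n sigma) sqr_sqrtr ?ltW//.
  by field; rewrite !gt_eqF ?powR_gt0.
rewrite ler_pdivrMr//; apply: le_trans (ler_wpM2l _ wM); last first.
  by rewrite mulr_ge0 ?expR_ge0 ?ltW.
rewrite ler_pdivrMr ?exprn_gt0//.
have E9 : expR (- 9) * expR 9 = 1 :> R by rewrite -expRD addNr expR0.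
have Ab' : 2 * A ^+ 2 * expR 9 <= b * sigma ^+ 2 by rewrite -ler_pdivrMr// exprn_gt0.
have Ab2 : 2 * A ^+ 2 <= expR (- 9) * (b * sigma ^+ 2).
  have -> : 2 * A ^+ 2 = expR (- 9) * (2 * A ^+ 2 * expR 9).
    by rewrite [RHS]mulrCA E9 mulr1.
  by rewrite ler_wpM2l ?expR_ge0.
have Kn : 0 < K * n by rewrite mulr_gt0.
have -> : A ^+ 2 * K ^+ 2 * n = (K * n) * (A ^+ 2 * K) by ring.
have -> : K * expR (- 9) * (b * (n * ln n)) * sigma ^+ 2 =
  (K * n) * (expR (- 9) * (b * sigma ^+ 2) * ln n) by ring.
rewrite ler_pM2l//.
apply: (@le_trans _ _ (A ^+ 2 * (2 * ln n))).
  by rewrite ler_wpM2l// sqr_ge0.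
by rewrite mulrA ler_pM2r// mulrC.
Qed.

Lemma separation_rate (n A g s b N : R) : 0 < A -> 0 < g -> 0 < s -> 0 < b ->
  0 < n -> 0 < ln n -> 0 < N -> N <= 2 * (b * (n * ln n)) `^ (2 * s + 1)^-1 ->
  A * g / 16 * (2 `^ (- s) * b `^ (- (s * (2 * s + 1)^-1))) *
    (n * ln n) `^ (- (s / (2 * s + 1))) <= A * N `^ (- s) * g / 16.
Proof.
move=> A0 g0 s0 b0 n0 l0 N0 Nw.
have nl : 0 < n * ln n by rewrite mulr_gt0.
set e := (2 * s + 1)^-1 in Nw *.
have -> : A * N `^ (- s) * g / 16 = A * g / 16 * N `^ (- s) by ring.
rewrite -mulrA; apply: ler_wpM2l; first by rewrite divr_ge0// mulr_ge0// ltW.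
have -> : 2 `^ (- s) * b `^ (- (s * e)) * (n * ln n) `^ (- (s * e)) =
    (2 * (b * (n * ln n)) `^ e) `^ (- s).
  rewrite [RHS]powRM ?powR_ge0// -mulrA -powRM; try exact: ltW.
  by rewrite -powRrM mulrN (mulrC e).
have W0 : 0 < 2 * (b * (n * ln n)) `^ e by rewrite mulr_gt0 ?powR_gt0 ?mulr_gt0.
rewrite !powRN lef_pV2 ?posrE ?powR_gt0//.
by apply: ge0_ler_powR Nw; rewrite ?nnegrE; exact: ltW.
Qed.

End rates.

(** * The lower bound *)

Theorem theorem3p2 (R : realType) (s p L sigma : R)
    (s_gt0 : 0 < s) (p_ge1 : 1 <= p) (L_gt0 : 0 < L) (sigma_gt0 : 0 < sigma) :
  exists C' : R, 0 < C' /\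
    \forall n \near \oo,
      forall (d : measure_display) (T : measurableType d)
             (P : probability T R) (B : R -> T -> R),
        brownian_motion01 P B ->
        ((C' * (n%:R * ln n%:R) `^ (- (s / (2 * s + 1))))%:E
         <= poweR (minimax_L1_risk P B sigma n (besov_ball s p L)) 2^-1)%E.
Proof.
have [c [C1 [c0 C10 pairs]]] := moment_matched_pair p p_ge1.
pose m := (Num.truncn s).+1.
(* by Markov's inequality the p-mean exceeds Q with probability at most 1 / 8 *)
pose Q := 8 * C1; have Q0 : 0 < Q by rewrite mulr_gt0.
have [A A0 inball] := comb_besov s p Q L s_gt0 p_ge1 Q0 L_gt0.
(* the separation of the two means in units of beta, from [bump_mass_ge] *)
pose gamma := c * ((3 / 16) ^+ m / 2).
have gamma0 : 0 < gamma by rewrite mulr_gt0// divr_gt0// exprn_gt0// divr_gt0.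
have s21 : 0 < 2 * s + 1 by rewrite ltr_wpDl// mulr_ge0// ltW.
pose al := (2 * s + 1)^-1; have al0 : 0 < al by rewrite invr_gt0.
have al1 : al <= 1 by rewrite invf_le1// lerDr mulr_ge0// ltW.
pose B0 := 2 * A ^+ 2 * expR 9 / sigma ^+ 2 + 1.
have B0_ge : 2 * A ^+ 2 * expR 9 / sigma ^+ 2 <= B0 by rewrite lerDl.
have B1 : 1 <= B0.
  by rewrite lerDr divr_ge0 ?sqr_ge0// mulr_ge0 ?expR_ge0// mulr_ge0// sqr_ge0.
have B00 : 0 < B0 by rewrite (lt_le_trans _ B1).
pose D2 := 2 ^+ 13 / (al ^+ 2 * gamma ^+ 2).
pose C' := A * gamma / 16 * (2 `^ (- s) * B0 `^ (- (s * al))).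
exists C'; split.
  by rewrite mulr_gt0 ?divr_gt0 ?mulr_gt0 ?powR_gt0.
(* the three terms make ln n at least 1, N delta at most 1 / 4, and N large enough
   for the concentration of the norm *)
pose T0 := expR 1 + 8 * (2 + B0) + D2 `^ (2 / al).
exists (Num.truncn T0).+1 => // n /= nT d T P B bm.
have T0n : T0 <= n%:R by apply/ltW/(lt_le_trans (truncnS_gt T0)); rewrite ler_nat.
have e1 := expR_gt0 (1 : R); have D2p := powR_ge0 D2 (2 / al).
have B2 : 0 <= 8 * (2 + B0) by rewrite mulr_ge0// addr_ge0// ltW.
have ne : expR 1 <= n%:R :> R by apply: le_trans T0n; rewrite /T0 -addrA lerDl addr_ge0.
have nB : 8 * (2 + B0) <= n%:R.
  by apply: le_trans T0n; rewrite /T0 [leRHS]addrAC lerDr addr_ge0// ltW.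
have nD : D2 `^ (2 / al) <= n%:R by apply: le_trans T0n; rewrite /T0 lerDr addr_ge0// ltW.
have nR : 0 < n%:R :> R by exact: lt_le_trans ne.
have n0 : (0 < n)%N by rewrite ltr0n in nR.
have n1 : 1 <= n%:R :> R by rewrite ler1n.
have l1 : 1 <= ln n%:R :> R by rewrite -[leLHS]expRK ler_ln ?posrE.
have l0 : 0 < ln n%:R :> R by rewrite (lt_le_trans _ l1).
pose Y := (B0 * (n%:R * ln n%:R)) `^ al.
have Y1 : 1 <= Y.
  rewrite -[leLHS](@powRr0 _ (B0 * (n%:R * ln n%:R))); apply: ler_powR; last exact: ltW.
  by rewrite mulr_ege1// mulr_ege1.
have Y0 : 0 < Y by rewrite (lt_le_trans _ Y1).
pose N := (Num.truncn Y).+1; pose K := (Num.truncn (ln n%:R : R)).+1.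
have /andP[YN NY] := truncnS_bounds Y (ltW Y0).
have /andP[lK Kl] := truncnS_bounds (ln n%:R) (ltW l0).
rewrite -/N in YN NY; rewrite -/K in lK Kl.
have N0 : (0 < N)%N by []. have K0 : (0 < K)%N by [].
have NR : 0 < N%:R :> R by rewrite ltr0n.
have KR : 0 < K%:R :> R by rewrite ltr0n.
have K2 : K%:R <= 2 * ln n%:R :> R by rewrite (le_trans Kl)// mulr2n mulrDl mul1r lerD2l.
have N2 : N%:R <= 2 * Y by rewrite (le_trans NY)// mulr2n mulrDl mul1r lerD2l.
have [I [x [mu1 [mu0 [[mu1_0 mu1_1] [mu0_0 mu0_1] [x1 mom] gap [mp1 mp0]]]]]] := pairs K K0.
pose beta := A * N%:R `^ (- s).
have beta0 : 0 < beta by rewrite mulr_gt0// powR_gt0.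
pose delta : R := 2 * expR (- (4 * K%:R)).
have delta0 : 0 <= delta by rewrite mulr_ge0// expR_ge0.
have pmom (mu : I -> R) : \sum_i mu i * `|x i| `^ p <= C1 * K%:R `^ (- p) ->
    \sum_i mu i * `|K%:R * x i| `^ p <= Q / 8.
  move=> H; rewrite (eq_bigr (fun i => K%:R `^ p * (mu i * `|x i| `^ p))); last first.
    by move=> i _; rewrite normrM normr_nat powRM// mulrCA.
  rewrite -mulr_sumr; apply: le_trans (ler_wpM2l (powR_ge0 _ _) H) _.
  rewrite powRN le_eqVlt; apply/orP; left; apply/eqP; rewrite /Q.
  by field; rewrite gt_eqF// powR_gt0.
have gapK : c <= \sum_i (mu1 i - mu0 i) * `|K%:R * x i|.
  rewrite (eq_bigr (fun i => K%:R * ((mu1 i - mu0 i) * `|x i|))); last first.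
    by move=> i _; rewrite normrM normr_nat mulrCA.
  by rewrite -mulr_sumr -ler_pdivrMl// mulrC.
have varN : 128 * K%:R ^+ 2 <= N%:R * gamma ^+ 2.
  exact: (log_sqr_le_cells n%:R al gamma B0 N%:R K%:R al0 gamma0 B1 n1 l1 (ltW KR) K2 nD YN).
have deltaN : N%:R * delta <= 4^-1.
  exact: (cells_swap_cost n%:R al B0 N%:R K%:R al0 al1 B1 n1 l1 lK nB NY).
have snr : (beta * K%:R) ^+ 2 * N%:R^-1 / (sigma / Num.sqrt n%:R) ^+ 2 <= K%:R * expR (- 9).
  exact: (signal_to_noise n%:R A sigma s B0 N%:R K%:R A0 sigma_gt0 s_gt0 n1 l1 NR KR K2 B0_ge YN).
(* with z / K <= exp (- 9), the bound 4 (z / K)^K exp K is at most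
   4 exp (- 8 K) = delta^2 *)
have Hdelta z : 0 <= z <= (beta * K%:R) ^+ 2 * N%:R^-1 / (sigma / Num.sqrt n%:R) ^+ 2 ->
    \sum_i \sum_j (mu1 i - mu0 i) * (mu1 j - mu0 j) * expR (x i * x j * z) <= delta ^+ 2.
  move=> /andP[z0 zle]; have zK := le_trans zle snr.
  have zK1 : z / K%:R <= expR (- 9) by rewrite ler_pdivrMr// mulrC.
  apply: (@le_trans _ _ (4 * (z / K%:R) ^+ K * expR K%:R)).
    apply: (moment_matching_bound I x (fun i => mu1 i - mu0 i)) => //.
    - rewrite (_ : 2 = \sum_i mu1 i + \sum_i mu0 i); last by rewrite mu1_1 mu0_1.
      rewrite -big_split/=; apply: ler_sum => i _.
      by rewrite (le_trans (ler_normB _ _))// !ger0_norm.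
    - rewrite z0; apply: le_trans zK _; apply: ler_piMr; first exact: ltW.
      by rewrite -[leRHS]expR0 ler_expR oppr_le0.
  apply: (@le_trans _ _ (4 * expR (- 9) ^+ K * expR K%:R)).
    rewrite ler_wpM2r ?expR_ge0// ler_wpM2l//.
    by rewrite lerXn2r ?nnegrE ?expR_ge0// divr_ge0.
  rewrite /delta exprMn -!expRM_natl -mulrA -expRD le_eqVlt; apply/orP; left; apply/eqP.
  by rewrite -natrX; congr (_ * expR _); ring.
have rate : C' * (n%:R * ln n%:R) `^ (- (s / (2 * s + 1))) <= beta * gamma / 16.
  exact: (separation_rate n%:R A gamma s B0 N%:R A0 gamma0 s_gt0 B00 nR l0 NR N2).
have lower : (((beta * gamma / 16) ^+ 2)%:E <= minimax_L1_risk P B sigma n (besov_ball s p L))%E.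
  apply: le_ereal_inf_tmp => _ [That mThat <-].
  apply: (two_priors_risk P B bm sigma n m N K beta p Q c delta sigma_gt0 n0 N0 beta0
    Q0 c0 delta0 I x mu1 mu0 (besov_ball s p L)) => //.
  - by move=> th; exact: inball.
  - exact: pmom.
  - exact: pmom.
apply: (@le_trans _ _ (poweR ((beta * gamma / 16) ^+ 2)%:E 2^-1)).
  rewrite poweR_EFin lee_fin powR12_sqrt ?sqr_ge0// sqrtr_sqr.
  by apply: le_trans rate _; exact: ler_norm.
apply: gt0_ler_poweR => //; rewrite in_itv/= leey andbT.
  by rewrite lee_fin sqr_ge0.
by apply: le_trans lower; rewrite lee_fin sqr_ge0.
Qed.
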